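(* Let $S$ and $T$ be finite subsets of an abelian group $G$ with $\langle S\cup T\rangle=G$. Assume $|S|\le|T|$, $0\in S\cap T$, $|S+T|=|S|+|T|-1$, $S+T$ is aperiodic, and $\{S,T\}$ is not a weak pair. Let $T^S=G\setminus(T+S)$ and let $U=T^S-a$ for some $a\in T^S$. Then: (i) if $G\ne\langle S\rangle$, then $T$ is $\langle S\rangle$-quasi-periodic; (ii) if $G=\langle S\rangle$ and $G\ne\langle U\rangle$, then $S$ and $T$ are $\langle U\rangle$-quasi-periodic; (iii) if $G=\langle S\rangle=\langle U\rangle$, then there is a proper subgroup $H$ of $G$ such that $S$ and $T$ are $H$-quasi-periodic and $\phi(S)$, $\phi(T)$ are arithmetic progressions in $G/H$, where $\phi:G\to G/H$ is the canonical morphism; moreover $H$ is either a hyper-atom of $S$ or a hyper-atom of $U$.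
   Context: $\langle X\rangle$ is the subgroup generated by $X$. The period of $A$ is $\Pi(A)=\{x:A+x=A\}$; $A$ is aperiodic if $\Pi(A)=\{0\}$. For a subgroup $H$, $A$ is $H$-quasi-periodic if there exists $x$ with $(A\setminus(x+H))+H=A\setminus(x+H)$. A pair $\{A,B\}$ of subsets of $G$ is a weak pair if one of: (WP1) $\min(|A|,|B|)=1$; (WP2) there is $d\in G$ of order $\ge|A|+|B|-1$ such that $A$ and $B$ are arithmetic progressions with difference $d$; (WP3) $A$ is aperiodic and there are a finite subgroup $H$ and $g\in G$ such that $A,B$ are each contained in an $H$-coset and $g-B=H\setminus A$; (WP4) there is a subgroup $H$ such that $A,B$ are each contained in an $H$-coset, $|A|+|B|=|H|+1$, and there is $c\in G$ with $|(c-A)\cap B|=1$. For a finite generating subset $X$ of $G$ with $0\in X$: $\kappa_1(X)=\min\{|Y+X|-|Y|: Y\text{ finite}, |Y|\ge1, |Y+X|\le|G|-1\}$ (empty minimum $=|G|-1$); a $1$-fragment of $X$ is a finite $Y$ with $|Y|\ge1$, $G\setminus(Y+X)\neq\emptyset$ and $|Y+X|-|Y|=\kappa_1(X)$; a hyper-atom of $X$ is a subgroup of maximal cardinality among subgroups that are $1$-fragments of $X$. An arithmetic progression is a set $\{a,a+d,\dots,a+jd\}$. *)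

(* Defs.v *)
From HB Require Import structures.
From mathcomp Require Import all_boot all_order all_algebra finmap.
From mathcomp Require Import boolp classical_sets functions cardinality.
Set Implicit Arguments.
Unset Strict Implicit.
Unset Printing Implicit Defensive.
Import GRing.Theory.
Local Open Scope classical_set_scope.
Local Open Scope ring_scope.

(* Subgroups of [G] are represented by [H : zmodClosed G], with underlying set
   [[set` H]]; as every set is classically decidable, all subgroups arise.
   The quotient group is then [{ideal_quot H}] (whose additive structure only
   requires a [zmodClosed]), with canonical morphism [\pi_({ideal_quot H})]. *)

Section Defs.
Variable G : zmodType.
Implicit Types (A B X Y : set G) (H K : zmodClosed G).

(* Only meaningful on finite sets: it is 0 on infinite ones, so every use below
   comes with a finiteness condition. *)
Definition ncard A : nat := #|` fset_set A|.

Definition sumset A B : set G := [set a + b | a in A & b in B].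

Definition translate (x : G) A : set G := [set x + a | a in A].

Definition gen X : set G :=
  [set x | forall H, X `<=` [set` H] -> x \in H].

Definition period A : set G := [set x | translate x A = A].

Definition aperiodic A : Prop := period A = [set 0].

Definition quasi_periodic (H A : set G) : Prop :=
  exists x, sumset (A `\` translate x H) H = A `\` translate x H.

Definition in_coset H A : Prop := exists x, A `<=` translate x [set` H].

(* Elements of infinite order satisfy this for every [n]. *)
Definition order_ge (d : G) (n : nat) : Prop :=
  forall k, (0 < k)%N -> d *+ k = 0 -> (n <= k)%N.

End Defs.

Definition AP_diff (V : zmodType) (d : V) (A : set V) : Prop :=
  exists a (j : nat), A = [set a + d *+ i | i in [set i : nat | (i <= j)%N]].

Definition AP (V : zmodType) (A : set V) : Prop := exists d, AP_diff d A.

Section WeakPair.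
Variable G : zmodType.
Implicit Types (A B : set G).

Definition WP1 A B : Prop := minn (ncard A) (ncard B) = 1%N.

Definition WP2 A B : Prop :=
  exists d, [/\ order_ge d (ncard A + ncard B - 1)%N, AP_diff d A & AP_diff d B].

Definition WP3 A B : Prop :=
  aperiodic A /\
  exists (H : zmodClosed G) (g : G),
    [/\ finite_set [set` H], in_coset H A, in_coset H B
      & [set g - b | b in B] = [set` H] `\` A].

Definition WP4 A B : Prop :=
  exists H : zmodClosed G,
    [/\ finite_set [set` H], in_coset H A, in_coset H B,
        (ncard A + ncard B = ncard [set` H] + 1)%N
      & exists c, ncard ([set c - a | a in A] `&` B) = 1%N].

(* Intended for finite [A] and [B]; finiteness of [H] in [WP4] is then implied
   by the equation between cardinalities. *)
Definition weak_pair A B : Prop :=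
  [\/ WP1 A B, WP2 A B, WP3 A B | WP4 A B].

End WeakPair.

Section HyperAtom.
Variable G : zmodType.
Implicit Types (X Y : set G) (H K : zmodClosed G).

(* When [G] is infinite, [|Y + X| <= |G| - 1] holds for all finite [X] and [Y]. *)
Definition kappa1_admissible X Y : Prop :=
  [/\ finite_set Y, (1 <= ncard Y)%N
    & finite_set [set: G] -> (ncard (sumset Y X) <= ncard [set: G] - 1)%N].

(* For finite [X] containing 0 and finite [Y], [Y `<=` sumset Y X], so that the
   subtraction is not truncated. *)
Definition kappa1_value X (n : nat) : Prop :=
  exists2 Y, kappa1_admissible X Y & n = (ncard (sumset Y X) - ncard Y)%N.

Lemma kappa1_value_asbool X :
  (exists n, kappa1_value X n) -> exists n, `[< kappa1_value X n >].
Proof. by move=> [n /asboolP Xn]; exists n. Qed.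

(* The second branch only occurs when [G] is finite. *)
Definition kappa1 X : nat :=
  if pselect (exists n, kappa1_value X n) is left ex
  then ex_minn (kappa1_value_asbool ex)
  else (ncard [set: G] - 1)%N.

Definition fragment1 X Y : Prop :=
  [/\ finite_set Y, (1 <= ncard Y)%N, ~` sumset Y X !=set0
    & (ncard (sumset Y X) - ncard Y)%N = kappa1 X].

(* The first three conditions on [X] are those under which [kappa1] and
   [fragment1] are meaningful; in particular infinite sets have no hyper-atom. *)
Definition hyper_atom X H : Prop :=
  [/\ finite_set X, gen X = setT, X 0, fragment1 X [set` H]
    & forall K, fragment1 X [set` K] -> (ncard [set` K] <= ncard [set` H])%N].

End HyperAtom.

(* Main.v *)
Require Import Defs.
From HB Require Import structures.
From mathcomp Require Import all_boot all_order all_algebra finmap.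
From mathcomp Require Import boolp classical_sets functions cardinality.
From mathcomp Require Import zify.
Set Implicit Arguments.
Unset Strict Implicit.
Unset Printing Implicit Defensive.
Import GRing.Theory.
Local Open Scope classical_set_scope.
Local Open Scope ring_scope.
Local Open Scope quotient_scope.

(** Everything rests on Kneser's theorem |A + B| >= |A| + |B| - |period of A + B|.
    If S generates K, then at most one part of T in a K-coset can fail to be
    completed by S; comparing cardinalities, all other parts are full cosets: this
    is (i).  The complement C of S + T again forms critical aperiodic pairs with -S
    and -T, so (ii) is (i) for these pairs.

    For (iii), exchange S with U if U is smaller, and let H be a hyper-atom of S.
    By maximality of H, A = phi(S) satisfies |A + L| >= |A| + |L| for every proper
    nontrivial subgroup L of G/H.  As kappa_1(S) = (|A| - 1) |H|, a fibre T_i and the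
    holes of S + T in the cosets of i + A have total size at most |H|; summing over
    i, |A + phi(T)| <= |A| + |phi(T)| - 1, and the dual inequality shows that T and C
    contain full H-cosets.  A minimal set critical for A is a Sidon set, which forces
    it to have two elements, so that A and phi(T) are progressions with a common
    difference.  Finally, summing fibres along staircase paths from one corner of the
    grid phi(S) x phi(T) to the other leaves room for only one incomplete coset of
    S + T, at one end; Kneser's theorem in that coset makes all other fibres full. *)

(** * Sumsets, periods and finite subgroups *)

(** For finite G the triple S, T, -C is symmetric: no sum of one element from each is 0, and any two
    of the sets form a critical pair. As U is a translate of C, exchanging S with U arranges that S
    is the smallest of the three, and then |G| >= 3|S| - 1. This bound serves the expansion of
    phi(S) for those subgroups L whose preimage plus S covers G, and |S| <= |C| is what rules out
    that phi(S) + phi(T) omits exactly one coset.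

    The obstacle for minimal critical sets is periodicity, which adds a correction term to Kneser's
    bound. Expansion of phi(S) is the property that makes every critical sum with phi(S), other than
    the whole group, aperiodic; the isoperimetric inequality in the quotient then holds without
    correction.

    G may be infinite. All sets are finite, and finiteness of G is expressed by a finite [W] that
    contains every element; conditions quantified over such [W] are vacuous for infinite G, so that
    one argument covers both cases. *)

Inductive zterm := ZVar of nat | ZZero | ZAdd of zterm & zterm | ZOpp of zterm.

Fixpoint zeval (V : zmodType) (e : seq V) (t : zterm) : V :=
  match t with
  | ZVar i => nth 0 e i
  | ZZero => 0
  | ZAdd t u => zeval e t + zeval e u
  | ZOpp t => - zeval e t
  end.

Fixpoint zcoef (t : zterm) (i : nat) : int :=
  match t with
  | ZVar j => (i == j)%:Z
  | ZZero => 0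
  | ZAdd t u => zcoef t i + zcoef u i
  | ZOpp t => - zcoef t i
  end.

Lemma zevalE (V : zmodType) (e : seq V) (t : zterm) :
  zeval e t = \sum_(i < size e) nth 0 e i *~ zcoef t i.
Proof.
elim: t => [j||t IHt u IHu|t IHt] /=.
- have [ltj|lej] := ltnP j (size e); last first.
    rewrite nth_default // big1 // => i _; case: eqP => [ij|_] //=.
    by move: (ltn_ord i); rewrite ij ltnNge lej.
  rewrite (bigD1 (Ordinal ltj)) //= eqxx big1 ?addr0 // => i ij.
  by case: eqP => [e1|//]; case/eqP: ij; apply: val_inj.
- by rewrite big1.
- by rewrite IHt IHu -big_split; apply: eq_bigr => i _; rewrite /= mulrzDr.
- by rewrite IHt -sumrN; apply: eq_bigr => i _; rewrite mulrNz.
Qed.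

(** Comparing coefficients is a closed boolean computation, so [zmod] proves an identity by
    evaluation, without rewriting to a normal form. *)
Lemma zeval_eq (V : zmodType) (e : seq V) (t u : zterm) :
  all (fun i => zcoef t i == zcoef u i) (iota 0 (size e)) ->
  zeval e t = zeval e u.
Proof.
move=> /allP tu; rewrite !zevalE; apply: eq_bigr => i _.
by rewrite (eqP (tu i _)) // mem_iota add0n ltn_ord.
Qed.

Ltac zindex x e :=
  lazymatch e with
  | x :: _ => constr:(0%N)
  | _ :: ?e' => let i := zindex x e' in constr:(i.+1)
  end.

Ltac zmember x e :=
  lazymatch e with
  | nil => constr:(false)
  | x :: _ => constr:(true)
  | _ :: ?e' => zmember x e'
  end.

Ltac zatoms e t :=
  lazymatch t with
  | @GRing.zero _ => e
  | @GRing.add _ ?x ?y => let e1 := zatoms e x in zatoms e1 y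
  | @GRing.opp _ ?x => zatoms e x
  | ?x => lazymatch zmember x e with
          | true => e
          | false => constr:(x :: e)
          end
  end.

Ltac zquote e t :=
  lazymatch t with
  | @GRing.zero _ => constr:(ZZero)
  | @GRing.add _ ?x ?y =>
      let u := zquote e x in let v := zquote e y in constr:(ZAdd u v)
  | @GRing.opp _ ?x => let u := zquote e x in constr:(ZOpp u)
  | ?x => let i := zindex x e in constr:(ZVar i)
  end.

(* Decides identities between integer combinations in an abelian group. *)
Ltac zmod :=
  lazymatch goal with
  | |- @eq ?V ?x ?y =>
      let e0 := zatoms (@nil V) x in let e := zatoms e0 y in
      let t := zquote e x in let u := zquote e y in
      exact: (@zeval_eq _ e t u isT)
  end.

Section Sumsets.
Local Open Scope fset_scope.
Local Open Scope ring_scope.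

Definition fsum (V : zmodType) (A B : {fset V}) : {fset V} :=
  [fset (a + b)%R | a in A, b in B].

Definition fopp (V : zmodType) (A : {fset V}) : {fset V} := [fset (- a)%R | a in A].

(** A period of a nonempty finite set is a difference of two of its elements, so the period is cut
    out of the finite set A - A. For empty [A] the result is empty, whence the nonemptiness
    hypotheses below. *)
Definition fstab (V : zmodType) (A : {fset V}) : {fset V} :=
  [fset x in fsum A (fopp A) | fsum [fset x] A == A].

Definition fsubgroup (V : zmodType) (K : {fset V}) : Prop :=
  0 \in K /\ forall x y, x \in K -> y \in K -> x - y \in K.

End Sumsets.

Notation "A `+` B" := (fsum A B) (at level 54, left associativity) : fset_scope.

Section SumsetTheory.
Local Open Scope fset_scope.
Local Open Scope ring_scope.

Lemma fsumP (V : zmodType) (A B : {fset V}) (x : V) :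
  reflect (exists a b, [/\ a \in A, b \in B & x = a + b]) (x \in A `+` B).
Proof.
apply: (iffP (imfset2P _ _ _ _ _)) => [[a aA [b bB ->]]|[a [b [aA bB ->]]]].
  by exists a, b.
by exists a => //; exists b.
Qed.

Lemma mem_fsum (V : zmodType) (A B : {fset V}) (a b : V) :
  a \in A -> b \in B -> a + b \in A `+` B.
Proof. by move=> aA bB; apply/fsumP; exists a, b. Qed.

Lemma mem_fopp (V : zmodType) (A : {fset V}) (x : V) :
  (x \in fopp A) = (- x \in A).
Proof.
apply/imfsetP/idP => [[a aA ->]|xA]; first by rewrite opprK.
by exists (- x); rewrite ?opprK.
Qed.

Lemma mem_fsum1 (V : zmodType) (A : {fset V}) (x y : V) :
  (x \in [fset y] `+` A) = (x - y \in A).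
Proof.
apply/fsumP/idP => [[a [b [/fset1P-> bA ->]]]|xA].
  by have -> : y + b - y = b by zmod.
by exists y, (x - y); rewrite fset11; split => //; zmod.
Qed.

Lemma fsumC (V : zmodType) (A B : {fset V}) : A `+` B = B `+` A.
Proof.
by apply/fsetP => x; apply/fsumP/fsumP => -[a [b [aA bB ->]]]; exists b, a;
  rewrite addrC.
Qed.

Lemma fsumA (V : zmodType) (A B C : {fset V}) : A `+` (B `+` C) = A `+` B `+` C.
Proof.
apply/fsetP => x; apply/fsumP/fsumP.
  move=> [a [_ [aA /fsumP[b [c [bB cC ->]]] ->]]]; exists (a + b), c.
  by rewrite mem_fsum // addrA.
move=> [_ [c [/fsumP[a [b [aA bB ->]]] cC ->]]]; exists a, (b + c).
by rewrite mem_fsum // addrA.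
Qed.

Lemma fsumAC (V : zmodType) (A B C : {fset V}) : A `+` B `+` C = A `+` C `+` B.
Proof. by rewrite -fsumA [B `+` C]fsumC fsumA. Qed.

Lemma fsumS (V : zmodType) (A B C D : {fset V}) :
  A `<=` C -> B `<=` D -> A `+` B `<=` C `+` D.
Proof.
move=> /fsubsetP AC /fsubsetP BD; apply/fsubsetP => _ /fsumP[a [b [aA bB ->]]].
by rewrite mem_fsum ?AC ?BD.
Qed.

Lemma fsumUr (V : zmodType) (A B C : {fset V}) :
  A `+` (B `|` C) = (A `+` B) `|` (A `+` C).
Proof.
apply/fsetP => x; rewrite in_fsetU; apply/idP/idP.
  move=> /fsumP[a [b [aA /fsetUP[bB|bC] ->]]]; apply/orP.
    by left; exact: mem_fsum.
  by right; exact: mem_fsum.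
by case/orP; apply/fsubsetP; apply: fsumS; rewrite ?fsubsetUl ?fsubsetUr.
Qed.

Lemma fsumUl (V : zmodType) (A B C : {fset V}) :
  (A `|` B) `+` C = (A `+` C) `|` (B `+` C).
Proof. by rewrite fsumC fsumUr ![C `+` _]fsumC. Qed.

Lemma fsum1_fset1 (V : zmodType) (x y : V) : [fset x] `+` [fset y] = [fset x + y].
Proof.
apply/fsetP => z; rewrite mem_fsum1 !in_fset1.
by apply/eqP/eqP => [<-|->]; zmod.
Qed.

Lemma fsum0 (V : zmodType) (A : {fset V}) : [fset 0] `+` A = A.
Proof. by apply/fsetP => x; rewrite mem_fsum1 subr0. Qed.

Lemma card_fsum1 (V : zmodType) (x : V) (A : {fset V}) :
  #|` [fset x] `+` A| = #|` A|.
Proof.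
have -> : [fset x] `+` A = [fset x + a | a in A].
  apply/fsetP => y; rewrite mem_fsum1; apply/idP/imfsetP => [yA|[a aA ->]].
    by exists (y - x) => //; zmod.
  by have -> : x + a - x = a by zmod.
by rewrite card_imfset //; apply: addrI.
Qed.

Lemma fsum_eq0 (V : zmodType) (A B : {fset V}) :
  A != fset0 -> B != fset0 -> A `+` B != fset0.
Proof.
move=> /fset0Pn[a aA] /fset0Pn[b bB].
by apply/fset0Pn; exists (a + b); rewrite mem_fsum.
Qed.

Lemma fsum_set0 (V : zmodType) (A : {fset V}) : A `+` fset0 = fset0.
Proof.
by apply/eqP; rewrite -fsubset0; apply/fsubsetP => x /fsumP[a [b []]].
Qed.

Lemma leq_card_fsum (V : zmodType) (A B : {fset V}) :
  A != fset0 -> (#|` B| <= #|` A `+` B|)%N.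
Proof.
move=> /fset0Pn[a aA]; rewrite -(card_fsum1 a B); apply: fsubset_leq_card.
by apply: fsumS => //; rewrite fsub1set.
Qed.

Lemma card_fopp (V : zmodType) (A : {fset V}) : #|` fopp A| = #|` A|.
Proof. by rewrite card_imfset //; apply: oppr_inj. Qed.

Lemma foppK (V : zmodType) : involutive (@fopp V).
Proof. by move=> A; apply/fsetP => x; rewrite !mem_fopp opprK. Qed.

Lemma fopp_fsum (V : zmodType) (A B : {fset V}) :
  fopp (A `+` B) = fopp A `+` fopp B.
Proof.
apply/fsetP => x; rewrite mem_fopp; apply/fsumP/fsumP => -[a [b [aA bB xE]]].
  by exists (- a), (- b); rewrite !mem_fopp !opprK -opprD -xE opprK.
by exists (- a), (- b); rewrite -!mem_fopp aA bB xE; split => //; zmod.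
Qed.

Lemma fopp_eq0 (V : zmodType) (A : {fset V}) : (fopp A == fset0) = (A == fset0).
Proof. by rewrite -!cardfs_eq0 card_fopp. Qed.

Lemma mem_fstab (V : zmodType) (A : {fset V}) (x : V) : A != fset0 ->
  (x \in fstab A) = ([fset x] `+` A == A).
Proof.
move=> /fset0Pn[a aA]; rewrite /fstab !inE /= andb_idl // => /eqP xA.
apply/fsumP; exists (x + a), (- a); rewrite mem_fopp opprK aA; split => //.
  by rewrite -[in X in _ \in X]xA mem_fsum ?fset11.
by zmod.
Qed.

Lemma fstab_subgroup (V : zmodType) (A : {fset V}) : A != fset0 ->
  fsubgroup (fstab A).
Proof.
move=> A0; split=> [|x y]; first by rewrite mem_fstab // fsum0.
rewrite !mem_fstab // => /eqP xA /eqP yA; rewrite -{1}yA fsumA fsum1_fset1.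
by rewrite subrK xA.
Qed.

Lemma fsubgroup0 (V : zmodType) (K : {fset V}) : fsubgroup K -> K != fset0.
Proof. by move=> [K0 _]; apply/fset0Pn; exists 0. Qed.

Lemma fsubgroup_gt0 (V : zmodType) (K : {fset V}) :
  fsubgroup K -> (0 < #|` K|)%N.
Proof. by move=> /fsubgroup0; rewrite cardfs_gt0. Qed.

Lemma fsubgroupN (V : zmodType) (K : {fset V}) (x : V) :
  fsubgroup K -> (- x \in K) = (x \in K).
Proof.
move=> [K0 KB]; apply/idP/idP => xK; last by rewrite -sub0r KB.
by rewrite -[x]opprK -sub0r KB.
Qed.

Lemma fsubgroupD (V : zmodType) (K : {fset V}) (x y : V) :
  fsubgroup K -> x \in K -> y \in K -> x + y \in K.
Proof.
by move=> gK xK yK; rewrite -[y]opprK; apply: (proj2 gK); rewrite ?fsubgroupN.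
Qed.

Lemma fsubgroupDr (V : zmodType) (K : {fset V}) (x y : V) :
  fsubgroup K -> y \in K -> (x + y \in K) = (x \in K).
Proof.
move=> gK yK; apply/idP/idP => xK; last exact: fsubgroupD.
by rewrite -[x](addrK y); apply: (proj2 gK).
Qed.

Lemma fsubgroupI (V : zmodType) (K L : {fset V}) :
  fsubgroup K -> fsubgroup L -> fsubgroup (K `&` L).
Proof.
move=> [K0 KB] [L0 LB]; split=> [|x y]; first by rewrite inE K0.
by rewrite !inE => /andP[xK xL] /andP[yK yL]; rewrite KB ?LB.
Qed.

Lemma fsubgroup_opp (V : zmodType) (K : {fset V}) : fsubgroup K -> fopp K = K.
Proof. by move=> gK; apply/fsetP => x; rewrite mem_fopp fsubgroupN. Qed.

Lemma fsubgroup_fsum (V : zmodType) (K : {fset V}) :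
  fsubgroup K -> K `+` K = K.
Proof.
move=> gK; apply/fsetP => x; apply/fsumP/idP => [[a [b [aK bK ->]]]|xK].
  exact: fsubgroupD.
by exists x, 0; rewrite addr0 (proj1 gK).
Qed.

Lemma fsub_fsum (V : zmodType) (A K : {fset V}) : 0 \in K -> A `<=` A `+` K.
Proof.
by move=> K0; apply/fsubsetP => a aA; rewrite -[a]addr0 mem_fsum.
Qed.

Lemma fstab_fsum (V : zmodType) (A K : {fset V}) : A != fset0 ->
  0 \in K -> K `<=` fstab A -> A `+` K = A.
Proof.
move=> A0 K0 /fsubsetP KA; apply/eqP; rewrite eqEfsubset fsub_fsum // andbT.
apply/fsubsetP => _ /fsumP[a [k [aA /KA kK ->]]].
by move: kK; rewrite mem_fstab // => /eqP <-; rewrite mem_fsum1 addrK.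
Qed.

Lemma fsum_fstab (V : zmodType) (A : {fset V}) : A != fset0 ->
  A `+` fstab A = A.
Proof. by move=> A0; rewrite fstab_fsum //; have [] := fstab_subgroup A0. Qed.

Lemma sub_fstab (V : zmodType) (A K : {fset V}) : A != fset0 ->
  A `+` K `<=` A -> K `<=` fstab A.
Proof.
move=> A0 AK; apply/fsubsetP => k kK; rewrite mem_fstab //.
rewrite eqEfcard card_fsum1 leqnn andbT; apply: fsubset_trans AK.
by rewrite fsumC; apply: fsumS; rewrite ?fsub1set.
Qed.

Lemma fstab_fsuml (V : zmodType) (A B : {fset V}) : A != fset0 -> B != fset0 ->
  fstab A `<=` fstab (A `+` B).
Proof.
move=> A0 B0; apply: sub_fstab; first exact: fsum_eq0.
by rewrite fsumAC fsum_fstab.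
Qed.

Lemma fstab_fsum1 (V : zmodType) (x : V) (A : {fset V}) : A != fset0 ->
  fstab ([fset x] `+` A) = fstab A.
Proof.
have x0 y : [fset y] != fset0 :> {fset V} by rewrite -cardfs_gt0 cardfs1.
move=> A0; have xA0 : [fset x] `+` A != fset0 by apply: fsum_eq0.
apply/eqP; rewrite eqEfsubset !sub_fstab //.
  by rewrite -fsumA fsum_fstab.
have {1 3}-> : A = [fset - x] `+` ([fset x] `+` A).
  by rewrite fsumA fsum1_fset1 addNr fsum0.
by rewrite -fsumA fsum_fstab.
Qed.

Lemma fstab_opp (V : zmodType) (A : {fset V}) : A != fset0 ->
  fstab (fopp A) = fstab A.
Proof.
have half (B : {fset V}) : B != fset0 -> fstab B `<=` fstab (fopp B).
  move=> B0; apply: sub_fstab; rewrite ?fopp_eq0 //.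
  by rewrite -{1}(fsubgroup_opp (fstab_subgroup B0)) -fopp_fsum fsum_fstab.
move=> A0; apply/eqP; rewrite eqEfsubset half // andbT.
by rewrite -{2}[A]foppK half // fopp_eq0.
Qed.

Lemma fstab_sub_fsubgroup (V : zmodType) (A K : {fset V}) (x : V) :
  A != fset0 -> fsubgroup K -> A `<=` [fset x] `+` K -> fstab A `<=` K.
Proof.
move=> A0 gK /fsubsetP AK; apply/fsubsetP => y.
rewrite mem_fstab // => /eqP yA; case/fset0Pn: A0 => a aA.
have yaA : y + a \in A by rewrite -[in X in _ \in X]yA mem_fsum ?fset11.
move: (AK _ aA) (AK _ yaA); rewrite !mem_fsum1 => aK yaK.
by have -> : y = y + a - x - (a - x) by [zmod]; apply: (proj2 gK).
Qed.

Definition repr_count (V : zmodType) (A B : {fset V}) (z : V) : nat :=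
  #|` [fset a in A | z - a \in B]|.

Lemma sum_fsum (V : zmodType) (A B : {fset V}) (F : V -> nat) :
  (\sum_(a <- A) \sum_(b <- B) F (a + b)%R =
   \sum_(z <- A `+` B) F z * repr_count A B z)%N.
Proof.
transitivity (\sum_(a <- A) \sum_(z <- A `+` B | (z - a)%R \in B) F z)%N.
  rewrite big_seq [RHS]big_seq; apply: eq_bigr => a aA.
  rewrite [RHS]big_fset_condE /=.
  have -> : [fset z in A `+` B | z - a \in B] = [fset a + b | b in B].
    apply/fsetP => z; rewrite !inE /=; apply/andP/imfsetP => /=.
      by move=> [_ zB]; exists (z - a) => //; zmod.
    by move=> [b bB ->]; rewrite mem_fsum // addrAC subrr add0r.
  by rewrite big_imfset //= => x y _ _; apply: addrI.
under eq_bigr do rewrite big_mkcond.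
rewrite exchange_big /=; apply: eq_bigr => z _.
rewrite -big_mkcond /= big_fset_condE big_const_seq count_predT iter_addn_0.
by rewrite mulnC.
Qed.

Lemma sum1_fset (T : choiceType) (A : {fset T}) : (\sum_(a <- A) 1)%N = #|` A|.
Proof. by rewrite big_const_seq count_predT iter_addn_0 mul1n. Qed.

Lemma sum_nat_fset (T : choiceType) (A : {fset T}) (c : nat) :
  (\sum_(a <- A) c)%N = (c * #|` A|)%N.
Proof. by rewrite big_const_seq count_predT iter_addn_0. Qed.

Lemma repr_count_gt0 (V : zmodType) (A B : {fset V}) (z : V) :
  z \in A `+` B -> (0 < repr_count A B z)%N.
Proof.
move=> /fsumP[a [b [aA bB ->]]]; rewrite cardfs_gt0; apply/fset0Pn; exists a.
by rewrite !inE aA addrAC subrr add0r.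
Qed.

(** Two representations of the same sum differ by an element lying in both [H] and [K], which bounds
    the number of representations. *)
Lemma card_sub_subgroups (V : zmodType) (H K W X : {fset V}) :
  fsubgroup H -> fsubgroup K -> W `<=` H -> X `<=` K ->
  (#|` W| * #|` X| <= #|` H `&` K| * #|` W `+` X|)%N.
Proof.
move=> gH gK WH XK.
have -> : (#|` W| * #|` X| = \sum_(a <- W) \sum_(b <- X) 1)%N.
  by under eq_bigr do rewrite sum1_fset; rewrite sum_nat_fset mulnC.
rewrite (sum_fsum _ _ (fun=> 1%N)) -sum_nat_fset big_seq [leqRHS]big_seq.
apply: leq_sum => z /fsumP[a [b [aW bX zE]]]; rewrite mul1n /repr_count.
rewrite -(card_fsum1 a (H `&` K)); apply: fsubset_leq_card.
apply/fsubsetP => a'; rewrite !inE mem_fsum1 => /andP[/= aW' zX]; rewrite inE.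
rewrite (proj2 gH) ?(fsubsetP WH) //=.
have -> : a' - a = b - (z - a') by rewrite zE; zmod.
by rewrite (proj2 gK) ?(fsubsetP XK).
Qed.

Lemma leq_fsubgroup_sub (V : zmodType) (K L : {fset V}) :
  L != fset0 -> K `+` L `<=` L -> (#|` K| <= #|` L|)%N.
Proof.
move=> /fset0Pn[l lL] KL; rewrite -(card_fsum1 l K) fsumC.
apply/fsubset_leq_card/(fsubset_trans _ KL).
by apply: fsumS; rewrite ?fsub1set.
Qed.

(** Put w' = h - w and u' = l - u. All four sides are at least k, so (w - k)(u' - k) >= 0 gives d >=
    w + u' - k, and likewise c >= u + w' - k. The comparison of u' with w' decides which alternative
    holds. *)
Lemma grid_count (w u d c h l k : nat) : (0 < k)%N ->
  (w <= h)%N -> (u <= l)%N -> (k <= w)%N -> (k <= u)%N ->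
  (k <= h - w)%N -> (k <= l - u)%N ->
  (w * (l - u) <= k * d)%N -> (u * (h - w) <= k * c)%N ->
  (h <= d + k)%N \/ (l <= c + k)%N.
Proof.
move=> k0 wh ul kw ku kw' ku' ed ec.
have [//|dk] := leqP h (d + k)%N; [by left|right].
have [[w' hE] [u' lE]] : (exists w', h = w + w')%N /\ (exists u', l = u + u')%N.
  by split; [exists (h - w)%N|exists (l - u)%N]; lia.
subst h l; rewrite !addKn in ec ed kw' ku'.
by nia.
Qed.

(* The heart of Kneser's theorem.  Let H and K be the stabilisers of C and D.
   A coset x + H + K is a grid in which C is a union of rows and D a union of
   columns, so that D \ C and C \ D are subgrids. *)
Lemma union_stab (V : zmodType) (C D : {fset V}) (m : nat) :
  C != fset0 -> D != fset0 ->
  (m <= #|` C| + #|` fstab C|)%N -> (m <= #|` D| + #|` fstab D|)%N ->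
  (m <= #|` C `|` D| + #|` fstab (C `|` D)|)%N.
Proof.
move=> C0 D0 leC leD.
set H := fstab C in leC *; set K := fstab D in leD *.
have gH : fsubgroup H := fstab_subgroup C0.
have gK : fsubgroup K := fstab_subgroup D0.
have CD0 : C `|` D != fset0 by rewrite fsetU_eq0 negb_and C0.
have kS : (#|` H `&` K| <= #|` fstab (C `|` D)|)%N.
  apply: fsubset_leq_card; apply: sub_fstab => //; rewrite fsumUl.
  apply: fsetUSS; rewrite fstab_fsum // ?fsubsetIl ?fsubsetIr //.
    by rewrite inE (proj1 gH) (proj1 gK).
  by rewrite inE (proj1 gH) (proj1 gK).
have CH x a : a \in H -> (x + a \in C) = (x \in C).
  rewrite mem_fstab // => /eqP aC; apply/idP/idP => xC.
    by move: xC; rewrite -{1}aC mem_fsum1 addrK.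
  by rewrite -aC mem_fsum1 addrK.
have DK x b : b \in K -> (x + b \in D) = (x \in D).
  rewrite mem_fstab // => /eqP aC; apply/idP/idP => xC.
    by move: xC; rewrite -{1}aC mem_fsum1 addrK.
  by rewrite -aC mem_fsum1 addrK.
have [DC|DC] := boolP (D `<=` C).
  by have -> : C `|` D = C by apply/fsetUidPl.
have [CD|CD] := boolP (C `<=` D).
  by have -> : C `|` D = D by apply/fsetUidPr.
clearbody H K.
pose k := #|` H `&` K|; pose h := #|` H|; pose l := #|` K|.
have k0 : (0 < k)%N := fsubgroup_gt0 (fsubgroupI gH gK).
suff : (h <= #|` D `\` C| + k)%N \/ (l <= #|` C `\` D| + k)%N.
  have := cardfsUI C D; have := cardfsID D C; have := cardfsID C D.
  rewrite [D `&` C]fsetIC; move: kS leC leD; rewrite -/h -/l -/k; lia.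
pose W x := [fset a in H | x + a \in D].
pose U x := [fset b in K | x + b \in C].
have WH x : W x `<=` H by apply/fsubsetP => a; rewrite !inE => /andP[].
have UK x : U x `<=` K by apply/fsubsetP => a; rewrite !inE => /andP[].
have cD x : (#|` W x| * (l - #|` U x|) <= k * #|` D `\` C|)%N.
  rewrite -cardfsDS //; apply: leq_trans (card_sub_subgroups gH gK (WH x) _) _.
    exact: fsubsetDl.
  rewrite leq_mul2l; apply/orP; right; rewrite -(card_fsum1 x).
  apply: fsubset_leq_card; apply/fsubsetP => y; rewrite mem_fsum1.
  move=> /fsumP[a [b []]]; rewrite !inE => /andP[aH aD] /andP[bU bK] yE.
  have -> : y = x + a + b by rewrite -addrA -yE; zmod.
  rewrite DK // aD andbT addrAC CH //.
  by apply: contra bU; rewrite bK.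
have cC x : (#|` U x| * (h - #|` W x|) <= k * #|` C `\` D|)%N.
  rewrite -cardfsDS // mulnC.
  apply: leq_trans (card_sub_subgroups gH gK _ (UK x)) _.
    exact: fsubsetDl.
  rewrite leq_mul2l; apply/orP; right; rewrite -(card_fsum1 x).
  apply: fsubset_leq_card; apply/fsubsetP => y; rewrite mem_fsum1.
  move=> /fsumP[a [b []]]; rewrite !inE => /andP[aW aH] /andP[bK bC] yE.
  have -> : y = x + a + b by rewrite -addrA -yE; zmod.
  rewrite DK // addrAC CH // bC andbT.
  by apply: contra aW; rewrite aH.
have kX (X : {fset V}) : X `+` (H `&` K) `<=` X -> X != fset0 -> (k <= #|` X|)%N.
  move=> XHK X0; apply: (leq_fsubgroup_sub) => //.
  by rewrite fsumC.
have WS x : W x `+` (H `&` K) `<=` W x.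
  apply/fsubsetP => _ /fsumP[a [c [aX cX ->]]]; move: aX cX.
  rewrite !inE /= => /andP[aH aD] /andP[cH cK].
  by rewrite fsubgroupD //= addrA DK.
have US x : U x `+` (H `&` K) `<=` U x.
  apply/fsubsetP => _ /fsumP[a [c [aX cX ->]]]; move: aX cX.
  rewrite !inE /= => /andP[aH aD] /andP[cH cK].
  by rewrite fsubgroupD //= addrA CH.
have WS' x : (H `\` W x) `+` (H `&` K) `<=` H `\` W x.
  apply/fsubsetP => _ /fsumP[a [c [aX cX ->]]]; move: aX cX.
  rewrite !inE /= => /andP[aW aH] /andP[cH cK].
  by rewrite fsubgroupD //= addrA DK // andbT; move: aW; rewrite aH.
have US' x : (K `\` U x) `+` (H `&` K) `<=` K `\` U x.
  apply/fsubsetP => _ /fsumP[a [c [aX cX ->]]]; move: aX cX.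
  rewrite !inE /= => /andP[aW aH] /andP[cH cK].
  by rewrite fsubgroupD //= addrA CH // andbT; move: aW; rewrite aH.
have hk (x y z : nat) : (z * y <= k * x)%N -> (k <= z)%N -> (y <= x)%N.
  move=> xy kz; rewrite -(leq_pmul2l k0); apply: leq_trans xy.
  by rewrite leq_mul2r kz orbT.
have Wx x : x \in D -> W x != fset0.
  by move=> xD; apply/fset0Pn; exists 0; rewrite !inE addr0 xD (proj1 gH).
have Ux x : x \in C -> U x != fset0.
  by move=> xD; apply/fset0Pn; exists 0; rewrite !inE addr0 xD (proj1 gK).
have Wx' x : x \notin D -> H `\` W x != fset0.
  move=> xD; apply/fset0Pn; exists 0.
  by rewrite !inE addr0 (negPf xD) (proj1 gH).
have Ux' x : x \notin C -> K `\` U x != fset0.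
  move=> xD; apply/fset0Pn; exists 0.
  by rewrite !inE addr0 (negPf xD) (proj1 gK).
have cW x : #|` H `\` W x| = (h - #|` W x|)%N by rewrite cardfsDS.
have cU x : #|` K `\` U x| = (l - #|` U x|)%N by rewrite cardfsDS.
have leW x : (#|` W x| <= h)%N by apply: fsubset_leq_card.
have leU x : (#|` U x| <= l)%N by apply: fsubset_leq_card.
have grid x : (k <= #|` W x|)%N -> (k <= #|` U x|)%N ->
    (k <= h - #|` W x|)%N -> (k <= l - #|` U x|)%N ->
    (h <= #|` D `\` C| + k)%N \/ (l <= #|` C `\` D| + k)%N.
  move=> kW kU kW' kU'; have := cD x; have := cC x.
  by move=> ec ed; apply: (grid_count k0 _ _ _ _ _ _ ed ec).
case/fsubsetPn: DC => x xD xC; case/fsubsetPn: CD => y yC yD.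
(* Degenerate grids first: if [D] fills the [H] direction at [x], the count [cD] alone gives h <= |D
   \ C|; symmetrically for [C] at [y]. *)
have [Wh|Wh] := eqVneq (H `\` W x) fset0.
  left; have : (h <= #|` D `\` C|)%N.
    apply: (hk _ _ #|` K `\` U x|); last by apply: kX; rewrite ?Ux' ?US'.
    by move: (cW x) (cD x); rewrite Wh cardfs0 -cU mulnC; have := leW x; nia.
  lia.
have [Ul|Ul] := eqVneq (K `\` U y) fset0.
  right; have : (l <= #|` C `\` D|)%N.
    apply: (hk _ _ #|` H `\` W y|); last by apply: kX; rewrite ?Wx' ?WS'.
    by move: (cU y) (cC y); rewrite Ul cardfs0 -cW mulnC; have := leU y; nia.
  lia.
have [U0|U0] := eqVneq (U x) fset0; last first.
  by apply: (grid x); rewrite -?cW -?cU kX ?Wx ?Ux'.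
have [W0|W0] := eqVneq (W y) fset0; last first.
  by apply: (grid y); rewrite -?cW -?cU kX ?Wx' ?Ux.
(* Now [C] misses the grid of [x] and [D] misses that of [y], so D \ C contains a coset of [K] and C
   \ D a coset of [H]. The smaller of h and l settles the claim. *)
have ld : (l <= #|` D `\` C|)%N.
  apply: (hk _ _ #|` W x|); last by rewrite kX ?Wx.
  by have := cD x; rewrite U0 cardfs0 subn0.
have hc : (h <= #|` C `\` D|)%N.
  apply: (hk _ _ #|` U y|); last by rewrite kX ?Ux.
  by have := cC y; rewrite W0 cardfs0 subn0.
by have [|] := leqP h l; [left|right]; lia.
Qed.

End SumsetTheory.

(** * Kneser's theorem *)

(* [lia] on cardinalities: membership hypotheses, on which it would branch, are
   dropped and the cardinalities are generalised. *)
Ltac nlia :=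
  intros;
  repeat match goal with
  | H : is_true (leq _ _) |- _ => revert H
  | H : is_true (negb (@eq_op _ (@size _ _) _)) |- _ => revert H
  | H : @eq nat _ _ |- _ => revert H
  end;
  repeat match goal with
  | |- context [@bigop nat ?I ?a ?r ?F] => move: (@bigop nat I a r F)
  | |- context [@size ?T ?s] => move: (@size T s)
  end;
  repeat match goal with H : is_true _ |- _ => clear H end;
  intros; lia.

Section Kneser.
Local Open Scope fset_scope.
Local Open Scope ring_scope.

(* Dyson's e-transform, iterated until the second set stabilises the first. *)
Lemma kneser_local (V : zmodType) (A B : {fset V}) : 0 \in A -> 0 \in B ->
  exists C : {fset V}, [/\ 0 \in C, C `<=` A `+` B
    & (#|` A| + #|` B| <= #|` C| + #|` fstab C|)%N].
Proof.
have [n] := ubnP #|` B|; elim: n A B => // n IHn A B; rewrite ltnS => leBn A0 B0.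
have AN0 : A != fset0 by apply/fset0Pn; exists 0.
have [BA|] := boolP (B `<=` fstab A).
  exists A; split => //; last by rewrite leq_add2l fsubset_leq_card.
  exact: fsub_fsum.
case/fsubsetPn => b bB bA.
have /fsubsetPn[e eA ebA] : ~~ ([fset b] `+` A `<=` A).
  apply: contra bA => bA; rewrite mem_fstab //.
  by rewrite eqEfcard card_fsum1 bA leqnn.
rewrite mem_fsum1 in eA.
pose B' := [fset x in B | x + (e - b) \in A].
pose A' := A `|` ([fset e - b] `+` B).
have B'0 : 0 \in B' by rewrite !inE B0 add0r.
have B'B : B' `<=` B by apply/fsubsetP => x; rewrite !inE => /andP[].
have ltB' : (#|` B'| < n)%N.
  apply: leq_trans leBn; apply: fproper_ltn_card; rewrite fproperEneq B'B andbT.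
  apply: contraNneq ebA => B'E; move: bB; rewrite -B'E !inE => /andP[_ ].
  by have -> : b + (e - b) = e by zmod.
have cardE : (#|` A'| + #|` B'| = #|` A| + #|` B|)%N.
  have := cardfsUI A ([fset e - b] `+` B); rewrite card_fsum1 => <-.
  congr (_ + _)%N; rewrite -(card_fsum1 (e - b) B'); congr #|` _|.
  apply/fsetP => x; rewrite !inE !mem_fsum1 !inE andbC.
  by have -> : x - (e - b) + (e - b) = x by zmod.
have A'0 : 0 \in A' by rewrite in_fsetU A0.
have [C [C0 CA CE]] := IHn A' B' ltB' A'0 B'0.
exists C; split => //; last by rewrite -cardE.
apply: fsubset_trans CA _; apply/fsubsetP => _ /fsumP[a [c [aA' cB' ->]]].
move: cB'; rewrite !inE => /andP[cB cA]; move: aA'; rewrite in_fsetU mem_fsum1.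
case/orP => [aA|aB]; first exact: mem_fsum.
have -> : a + c = c + (e - b) + (a - (e - b)) by zmod.
exact: mem_fsum.
Qed.

(** The local lemma puts through each element of the sum a subset satisfying the bound; [union_stab]
    preserves the bound under unions, and finitely many of these subsets exhaust the sum. *)
Lemma kneser (V : zmodType) (A B : {fset V}) : A != fset0 -> B != fset0 ->
  (#|` A| + #|` B| <= #|` A `+` B| + #|` fstab (A `+` B)|)%N.
Proof.
move=> A0 B0; pose m := (#|` A| + #|` B|)%N.
have localC z : z \in A `+` B -> exists C : {fset V}, [/\ z \in C, C `<=` A `+` B
    & (m <= #|` C| + #|` fstab C|)%N].
  move=> /fsumP[a [b [aA bB ->]]].
  have [||C [C0 CS mC]] := @kneser_local _ ([fset - a] `+` A) ([fset - b] `+` B).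
  - by rewrite mem_fsum1 opprK add0r.
  - by rewrite mem_fsum1 opprK add0r.
  have CN0 : C != fset0 by apply/fset0Pn; exists 0.
  exists ([fset a + b] `+` C); rewrite mem_fsum1 subrr; split => //.
    have -> : A `+` B = [fset a + b] `+` ([fset - a] `+` A `+` ([fset - b] `+` B)).
      rewrite -fsumA [A `+` (_ `+` B)]fsumA [A `+` [fset _]]fsumC.
      rewrite !fsumA -![_ `+` _ `+` [fset _]]fsumA !fsum1_fset1.
      by have -> : a + b + (- a + - b) = 0 by [zmod]; rewrite fsum0.
    exact: fsumS.
  by rewrite card_fsum1 fstab_fsum1 //; move: mC; rewrite !card_fsum1.
have AB0 : A `+` B != fset0 by apply: fsum_eq0.
suff cover (F : {fset V}) : F != fset0 -> F `<=` A `+` B ->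
    exists C : {fset V}, [/\ F `<=` C, C `<=` A `+` B
      & (m <= #|` C| + #|` fstab C|)%N].
  have [C [SC CS mC]] := cover _ AB0 (fsubset_refl _).
  by have -> : A `+` B = C by apply/eqP; rewrite eqEfsubset SC.
elim/fset1U_rect: F => [/eqP//|x F xF IH _]; rewrite fsubUset fsub1set => /andP[xS FS].
have [C [xC CS mC]] := localC x xS.
have [F0|F0] := eqVneq (F : {fset V}) fset0.
  by exists C; rewrite F0 fsetU0 fsub1set.
have [D [FD DS mD]] := IH F0 FS; exists (C `|` D); split.
- by rewrite fsubUset fsub1set inE xC (fsubset_trans FD) ?fsubsetUr.
- by rewrite fsubUset CS.
- apply: union_stab => //; first by apply/fset0Pn; exists x.
  by apply: contraNneq F0 => D0; rewrite -fsubset0 -D0.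
Qed.

(** Saturating both summands by the period of the sum does not change the sum, so [kneser] applies
    to the saturated sets. *)
Lemma kneser_strong (V : zmodType) (A B : {fset V}) :
  A != fset0 -> B != fset0 ->
  (#|` A `+` fstab (A `+` B)| + #|` B `+` fstab (A `+` B)| <=
   #|` A `+` B| + #|` fstab (A `+` B)|)%N.
Proof.
move=> A0 B0; set K := fstab _.
have AB0 : A `+` B != fset0 by apply: fsum_eq0.
have gK : fsubgroup K := fstab_subgroup AB0.
have K0 := fsubgroup0 gK.
have ABK : (A `+` K) `+` (B `+` K) = A `+` B.
  by rewrite fsumA [_ `+` K `+` B]fsumAC -fsumA fsubgroup_fsum // fsum_fstab.
have := @kneser _ (A `+` K) (B `+` K).
by rewrite ABK; apply; apply: fsum_eq0.
Qed.

Definition faperiodic (V : zmodType) (A : {fset V}) : Prop :=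
  forall x, x \in fstab A -> x = 0.

Lemma card_faperiodic (V : zmodType) (A : {fset V}) : A != fset0 ->
  faperiodic A -> #|` fstab A| = 1%N.
Proof.
move=> A0 apA; have [st0 _] := fstab_subgroup A0.
have -> : fstab A = [fset 0].
  by apply/fsetP => x; rewrite in_fset1; apply/idP/eqP => [/apA|->].
by rewrite cardfs1.
Qed.

Lemma kneser_aperiodic (V : zmodType) (A B : {fset V}) :
  A != fset0 -> B != fset0 -> faperiodic (A `+` B) ->
  (#|` A| + #|` B| <= #|` A `+` B| + 1)%N.
Proof.
move=> A0 B0 apAB; rewrite -(@card_faperiodic _ (A `+` B)) ?fsum_eq0 //.
exact: kneser.
Qed.

Lemma fsubgroup1 (V : zmodType) (K : {fset V}) : fsubgroup K ->
  #|` K| = 1%N -> K = [fset 0].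
Proof.
move=> [K0 _] /eqP/cardfs1P[x Kx]; rewrite Kx in K0 *.
by move/fset1P: K0 => ->.
Qed.

Lemma fsubgroup_gt1P (V : zmodType) (K : {fset V}) : fsubgroup K ->
  reflect (exists2 x, x \in K & x != 0) (1 < #|` K|)%N.
Proof.
move=> gK; apply: (iffP idP) => [K1|[x xK x0]].
  have /fset0Pn[x] : K `\ 0 != fset0.
    by rewrite -cardfs_gt0; move: K1; rewrite (cardfsD1 0) (proj1 gK) add1n ltnS.
  by rewrite !inE => /andP[x0 xK]; exists x.
rewrite ltn_neqAle fsubgroup_gt0 // andbT eq_sym.
by apply: contraNneq x0 => /(fsubgroup1 gK) K0; move: xK; rewrite K0 in_fset1.
Qed.

Lemma fsubgroup_gt1 (V : zmodType) (K : {fset V}) (x : V) : fsubgroup K ->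
  x \in K -> x != 0 -> (1 < #|` K|)%N.
Proof. by move=> gK xK x0; apply/fsubgroup_gt1P => //; exists x. Qed.

Lemma card_coset_ge2 (V : zmodType) (A K : {fset V}) (x y : V) : fsubgroup K ->
  x \in A -> y \in A -> x - y \notin K -> (2 * #|` K| <= #|` A `+` K|)%N.
Proof.
move=> gK xA yA xyK.
have dj : ([fset x] `+` K) `&` ([fset y] `+` K) = fset0.
  apply/eqP; rewrite -fsubset0; apply/fsubsetP => z.
  rewrite in_fsetI !mem_fsum1 => /andP[zx zy]; case/negP: xyK.
  by have -> : x - y = z - y - (z - x) by [zmod]; apply: (proj2 gK).
have := cardfsUI ([fset x] `+` K) ([fset y] `+` K).
rewrite dj cardfs0 addn0 !card_fsum1 mul2n -addnn => <-.
apply: fsubset_leq_card; rewrite -fsumUl; apply: fsumS => //.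
by rewrite fsubUset !fsub1set xA.
Qed.

End Kneser.

(** * Minimal critical sets *)

Section Atoms.
Local Open Scope fset_scope.
Local Open Scope ring_scope.

(** This is what the maximality of a hyper-atom becomes in the quotient. *)
Definition expanding (V : zmodType) (A : {fset V}) : Prop :=
  forall L : {fset V}, fsubgroup L -> (1 < #|` L|)%N -> (exists x, x \notin L) ->
  (#|` A| + #|` L| <= #|` A `+` L|)%N.

(** For expanding [A] these are the 2-fragments with kappa_2 = |A| - 1. Asking for two elements
    inside and two outside makes the notion stable under passing to the complement. *)
Definition fcritical (V : zmodType) (A X : {fset V}) : Prop :=
  [/\ (1 < #|` X|)%N, (#|` A `+` X| + 1 = #|` A| + #|` X|)%N
    & exists x y, [/\ x != y, x \notin A `+` X & y \notin A `+` X]].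

Definition sidon (V : zmodType) (M : {fset V}) : Prop :=
  forall x, x != 0 -> (#|` M `&` ([fset x] `+` M)| <= 1)%N.

Lemma fstab_proper (V : zmodType) (A : {fset V}) : A != fset0 ->
  (exists z, z \notin A) -> exists x, x \notin fstab A.
Proof.
move=> A0 [z zA]; case/fset0Pn: (A0) => a aA; exists (z - a).
apply: contra zA => /(mem_fsum aA); rewrite fsum_fstab //.
by have -> : a + (z - a) = z by zmod.
Qed.

Lemma faperiodicVgt1 (V : zmodType) (A : {fset V}) : A != fset0 ->
  faperiodic A \/ (1 < #|` fstab A|)%N.
Proof.
move=> A0; have gK := fstab_subgroup A0.
have := fsubgroup_gt0 gK; rewrite leq_eqVlt => /predU1P[K1|]; [left|by right].
by move=> x; rewrite (fsubgroup1 gK) // => /fset1P.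
Qed.

(** If the sum has a nontrivial period K, the surplus |K| of A + K cancels the correction term |K|
    in Kneser's bound. *)
Lemma expanding_or (V : zmodType) (A Y : {fset V}) : expanding A ->
  A != fset0 -> Y != fset0 -> (exists z, z \notin A `+` Y) ->
  (#|` A| + #|` Y| <= #|` A `+` Y|)%N \/ faperiodic (A `+` Y).
Proof.
move=> gA A0 Y0 AY; have AY0 : A `+` Y != fset0 by apply: fsum_eq0.
have [|K1] := faperiodicVgt1 AY0; [by right|left].
have := gA _ (fstab_subgroup AY0) K1 (fstab_proper AY0 AY).
have := kneser_strong A0 Y0.
have [K0 _] := fstab_subgroup AY0.
have := fsubset_leq_card (fsub_fsum Y K0).
by nlia.
Qed.

Lemma expanding_kappa (V : zmodType) (A Y : {fset V}) : expanding A ->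
  A != fset0 -> Y != fset0 -> (exists z, z \notin A `+` Y) ->
  (#|` A| + #|` Y| <= #|` A `+` Y| + 1)%N.
Proof.
move=> gA A0 Y0 AY; have [|apAY] := expanding_or gA A0 Y0 AY; first by nlia.
exact: kneser_aperiodic.
Qed.

Lemma fcritical_aperiodic (V : zmodType) (A X : {fset V}) : expanding A ->
  A != fset0 -> fcritical A X -> faperiodic (A `+` X).
Proof.
move=> gA A0 [X1 AX [x [y [xy xAX yAX]]]].
have X0 : X != fset0 by rewrite -cardfs_gt0; nlia.
by have [|//] := expanding_or gA A0 X0 (ex_intro _ x xAX); nlia.
Qed.

Lemma card_lt2 (T : choiceType) (A : {fset T}) (x y : T) : x != y ->
  x \in A -> y \in A -> (1 < #|` A|)%N.
Proof.
move=> xy xA yA; have <- : #|` [fset x; y]| = 2%N by rewrite cardfs2 xy.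
by apply: fsubset_leq_card; rewrite fsubUset !fsub1set xA.
Qed.

Lemma card_gt1P (T : choiceType) (A : {fset T}) : (1 < #|` A|)%N ->
  exists x y, [/\ x != y, x \in A & y \in A].
Proof.
move=> A1; have /fset0Pn[x xA] : A != fset0 by rewrite -cardfs_gt0; nlia.
have /fset0Pn[y] : A `\ x != fset0.
  by rewrite -cardfs_gt0; move: A1; rewrite (cardfsD1 x) xA add1n ltnS.
by rewrite !inE => /andP[yx yA]; exists x, y; rewrite eq_sym.
Qed.

(* Two translates of a minimal critical set M sharing two points would have a
   union violating the isoperimetric inequality. *)
Lemma expanding_atom (V : zmodType) (A : {fset V}) : expanding A -> A != fset0 ->
  (exists X, fcritical A X) -> exists2 M, fcritical A M & sidon M.
Proof.
move=> gA A0 [X0 crX0].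
have ex : exists n, `[< exists2 X, fcritical A X & #|` X| = n >].
  by exists #|` X0|; apply/asboolP; exists X0.
case: (ex_minnP ex) => n /asboolP[M crM Mn] minM; exists M => // x x0.
have {}minM Y : fcritical A Y -> (#|` M| <= #|` Y|)%N.
  by move=> crY; rewrite Mn; apply: minM; apply/asboolP; exists Y.
have apM := fcritical_aperiodic gA A0 crM.
case: crM => M1 AM [u [v [uv uAM vAM]]].
have M0 : M != fset0 by rewrite -cardfs_gt0; nlia.
rewrite leqNgt; apply/negP; set M' := [fset x] `+` M; set I := M `&` M' => I1.
have cM' : #|` M'| = #|` M| by rewrite card_fsum1.
have ltI : (#|` I| < #|` M|)%N.
  rewrite ltn_neqAle fsubset_leq_card ?fsubsetIl // andbT.
  apply/eqP => IM; case/eqP: x0; apply: apM.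
  rewrite fsumC; apply: (fsubsetP (fstab_fsuml M0 A0)).
  rewrite mem_fstab // -/M' eq_sym eqEfcard cM' leqnn andbT.
  by apply/fsetIidPl/eqP; rewrite eqEfcard fsubsetIl IM leqnn.
have I0 : I != fset0 by rewrite -cardfs_gt0; nlia.
have AIM : A `+` I `<=` A `+` M by rewrite fsumS ?fsubsetIl.
have uAI : u \notin A `+` I by apply: contra uAM; apply: (fsubsetP AIM).
have vAI : v \notin A `+` I by apply: contra vAM; apply: (fsubsetP AIM).
(* Otherwise [I] would be critical and smaller than [M]. *)
have AI : (#|` A| + #|` I| <= #|` A `+` I|)%N.
  have := expanding_kappa gA A0 I0 (ex_intro _ u uAI).
  rewrite addn1 leq_eqVlt => /predU1P[AIE|]; last by rewrite ltnS.
  have : fcritical A I.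
    by split => //; [rewrite addn1 -AIE|exists u, v].
  by move/minM; rewrite leqNgt ltI.
have AM' : #|` A `+` M'| = #|` A `+` M|.
  by rewrite /M' fsumA [A `+` _]fsumC -fsumA card_fsum1.
have AIM' : A `+` I `<=` (A `+` M) `&` (A `+` M').
  by rewrite fsubsetI !fsumS ?fsubsetIl ?fsubsetIr.
have cU := cardfsUI (A `+` M) (A `+` M').
have cMU := cardfsUI M M'.
(* Submodularity bounds the sum of [A] with the union of [M] and [M'] by |A| plus the size of the
   union minus 2. This is below [expanding_kappa], so the sum omits nothing and the group is
   finite. *)
have full z : z \in A `+` (M `|` M').
  apply/negPn/negP => zAU.
  have U0 : M `|` M' != fset0 by rewrite fsetU_eq0 negb_and M0.
  have := expanding_kappa gA A0 U0 (ex_intro _ z zAU).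
  have := fsubset_leq_card AIM'; rewrite fsumUr; rewrite -/I in cMU.
  by nlia.
set W := A `+` (M `|` M') in full.
have cW : (#|` W| + #|` A `+` I| <= 2 * #|` A `+` M|)%N.
  by rewrite /W fsumUr; have := fsubset_leq_card AIM'; nlia.
(* [W] is the whole group, so -Y is the dual of [M]. It is critical again, but |Y| <= |M| - |I| - 1
   contradicts minimality. *)
pose Y := W `\` (A `+` M).
have AMW : A `+` M `<=` W by apply/fsubsetP => z _.
have cY : (#|` Y| + #|` A `+` M| = #|` W|)%N.
  by rewrite cardfsDS // subnK // fsubset_leq_card.
have dj z : z \in A `+` fopp Y -> z \notin fopp M.
  move=> /fsumP[a [y [aA yY zE]]]; rewrite mem_fopp; apply/negP => zM.
  move: yY; rewrite mem_fopp !inE => /andP[/negP[]].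
  by have -> : - y = a + - z by [rewrite zE; zmod]; rewrite mem_fsum.
have [m1 [m2 [m12 m1M m2M]]] := card_gt1P M1.
have ne m : m \in M -> - m \notin A `+` fopp Y.
  by move=> mM; apply/negP => /dj; rewrite mem_fopp opprK mM.
have crY : fcritical A (fopp Y).
  have Y1 : (1 < #|` Y|)%N by apply: (card_lt2 uv); rewrite !inE ?uAM ?vAM full.
  rewrite /fcritical card_fopp; split => //.
    have Y0 : fopp Y != fset0 by rewrite fopp_eq0 -cardfs_gt0; nlia.
    have := expanding_kappa gA A0 Y0 (ex_intro (fun z => z \notin _) _ (ne _ m1M)).
    have : (#|` A `+` fopp Y| + #|` M| <= #|` W|)%N.
      rewrite -(card_fopp M) -cardfsUI.
      have -> : (A `+` fopp Y) `&` fopp M = fset0.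
        apply/eqP; rewrite -fsubset0; apply/fsubsetP => z.
        by rewrite in_fsetI => /andP[/dj/negPf->].
      by rewrite cardfs0 addn0; apply/fsubset_leq_card/fsubsetP => z _.
    by rewrite card_fopp; nlia.
  by exists (- m1), (- m2); rewrite !ne // eqr_opp.
have := minM _ crY; rewrite card_fopp.
by nlia.
Qed.

(** Fix a nonzero l in [L]. The parts of [M] in two cosets contain together at most one pair
    differing by l, so their total size is at most |L|; the two cosets, both full in M + L, then
    supply the gain |L|. *)
Lemma sidon_coset (V : zmodType) (M L : {fset V}) (x y : V) : sidon M ->
  fsubgroup L -> (1 < #|` L|)%N -> x \in M -> y \in M -> x - y \notin L ->
  (#|` M| + #|` L| <= #|` M `+` L|)%N.
Proof.
move=> sM gL L1 xM yM xyL; rewrite leqNgt; apply/negP => ltML.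
have [l lL l0] := fsubgroup_gt1P gL L1.
pose cos u := [fset u] `+` L; pose part u := M `&` cos u.
have dj : cos x `&` cos y = fset0.
  apply/eqP; rewrite -fsubset0; apply/fsubsetP => z.
  rewrite in_fsetI !mem_fsum1 => /andP[zx zy]; case/negP: xyL.
  by have -> : x - y = z - y - (z - x) by [zmod]; apply: (proj2 gL).
have ccos u : #|` cos u| = #|` L| by rewrite card_fsum1.
have partl u : (2 * #|` part u| <= #|` part u `&` ([fset l] `+` part u)| + #|` L|)%N.
  have := cardfsUI (part u) ([fset l] `+` part u); rewrite card_fsum1.
  have : part u `|` ([fset l] `+` part u) `<=` cos u.
    rewrite fsubUset fsubsetIr; apply/fsubsetP => z.
    rewrite mem_fsum1 /part in_fsetI /cos !mem_fsum1 => /andP[_ zlu].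
    by have -> : z - u = z - l - u + l by [zmod]; rewrite fsubgroupDr.
  by move/fsubset_leq_card; rewrite ccos; nlia.
have sub2 : (part x `&` ([fset l] `+` part x)) `|` (part y `&` ([fset l] `+` part y))
    `<=` M `&` ([fset l] `+` M).
  by rewrite fsubUset !fsetISS ?fsubsetIl ?fsumS ?fsubsetIl.
have dj2 : (part x `&` ([fset l] `+` part x)) `&` (part y `&` ([fset l] `+` part y)) = fset0.
  apply/eqP; rewrite -fsubset0 -dj; apply: fsetISS.
    by apply: fsubset_trans (fsubsetIl _ _) (fsubsetIr _ _).
  by apply: fsubset_trans (fsubsetIl _ _) (fsubsetIr _ _).
have le1 := sM _ l0; have := fsubset_leq_card sub2.
have := cardfsUI (part x `&` ([fset l] `+` part x)) (part y `&` ([fset l] `+` part y)).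
rewrite dj2 cardfs0 addn0 => -> le2.
pose R := M `\` (cos x `|` cos y).
have cM : (#|` M| = #|` R| + (#|` part x| + #|` part y|))%N.
  rewrite -(cardfsID (cos x `|` cos y) M) -/R addnC; congr (_ + _)%N.
  rewrite fsetIUr -[RHS]cardfsUI -/(part x) -/(part y).
  have -> : part x `&` part y = fset0; last by rewrite cardfs0 addn0.
  by apply/eqP; rewrite -fsubset0 -dj; apply: fsetISS; apply: fsubsetIr.
have : R `|` (cos x `|` cos y) `<=` M `+` L.
  rewrite !fsubUset !fsumS ?fsub1set //= andbT.
  apply: fsubset_trans (fsubsetDl _ _) _; apply: fsub_fsum; exact: (proj1 gL).
move/fsubset_leq_card; have := cardfsUI R (cos x `|` cos y).
have -> : R `&` (cos x `|` cos y) = fset0.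
  by apply/fsetP => z; rewrite in_fsetI in_fsetD; case: (z \in cos x `|` cos y);
    rewrite ?andbF.
have := cardfsUI (cos x) (cos y); rewrite dj !cardfs0 !addn0 !ccos.
have := partl x; have := partl y.
by nlia.
Qed.

(** M + N contains three translates of [M], which meet pairwise in at most one point. *)
Lemma sidon_sum (V : zmodType) (M N : {fset V}) : sidon M ->
  (2 < #|` N|)%N -> (3 * #|` M| <= #|` M `+` N| + 3)%N.
Proof.
move=> sM N3; have [x [y [xy xN yN]]] := card_gt1P (ltnW N3).
have /fset0Pn[z] : N `\` [fset x; y] != fset0.
  rewrite -cardfs_gt0 cardfsDS ?subn_gt0 ?cardfs2 ?xy //.
  by rewrite fsubUset !fsub1set xN.
rewrite in_fsetD in_fset2 negb_or => /andP[/andP[zx zy] zN].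
have tr u v : u != v -> (#|` ([fset u] `+` M) `&` ([fset v] `+` M)| <= 1)%N.
  move=> uv; rewrite -(card_fsum1 (- u)).
  apply: leq_trans (sM (v - u) _); last by rewrite subr_eq0 eq_sym.
  apply/fsubset_leq_card/fsubsetP => w; rewrite mem_fsum1 !in_fsetI !mem_fsum1.
  have -> : w - - u - u = w by zmod.
  by have -> : w - - u - v = w - (v - u) by zmod.
have : ([fset x] `+` M) `|` ([fset y] `+` M) `|` ([fset z] `+` M) `<=` M `+` N.
  by rewrite [M `+` N]fsumC !fsubUset !fsumS ?fsub1set.
move/fsubset_leq_card.
have := cardfsUI (([fset x] `+` M) `|` ([fset y] `+` M)) ([fset z] `+` M).
have := cardfsUI ([fset x] `+` M) ([fset y] `+` M).
rewrite fsetIUl !card_fsum1.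
have := cardfsUI (([fset x] `+` M) `&` ([fset z] `+` M)) (([fset y] `+` M) `&` ([fset z] `+` M)).
have := tr _ _ xy; have xz : x != z by rewrite eq_sym.
have yz : y != z by rewrite eq_sym.
have := tr _ _ xz; have := tr _ _ yz.
by nlia.
Qed.

Lemma fcriticalC (V : zmodType) (A X : {fset V}) : (1 < #|` A|)%N ->
  fcritical A X -> fcritical X A.
Proof.
by move=> A1 [X1 AX [x [y [xy xAX yAX]]]]; split => //; rewrite ?[X `+` A]fsumC //;
  [nlia|exists x, y].
Qed.

(** By [sidon_coset] it remains to exclude that [M] lies in a coset of a proper subgroup; let L be a
    smallest one. As A + M is aperiodic, some coset part [A1] of [A] has a sum with [M] that is not
    L-periodic. That part consumes the whole gain |M| - 1, the rest [A2] is a union of L-cosets, and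
    A + L gains less than |L|, against expansion. *)
Lemma sidon_expanding (V : zmodType) (A M : {fset V}) : expanding A -> A != fset0 ->
  fcritical A M -> sidon M -> expanding M.
Proof.
move=> gA A0 crM sM.
have apM := fcritical_aperiodic gA A0 crM.
case: (crM) => M1 AM _; have M0 : M != fset0 by rewrite -cardfs_gt0; nlia.
have [m mM] := fset0Pn _ M0.
have AM0 : A `+` M != fset0 by apply: fsum_eq0.
pose bad (L : {fset V}) := [/\ fsubgroup L, exists x, x \notin L
  & forall x y, x \in M -> y \in M -> x - y \in L].
suff nobad L : ~ bad L.
  move=> L gL L1 Lp; have [e|] := pselect (forall x y, x \in M -> y \in M -> x - y \in L).
    by case: (nobad L).
  by move=> /existsNP[x /existsNP[y]] /not_implyP[xM] /not_implyP[yM /negP]; apply: sidon_coset.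
move=> badL0.
have ex : exists n, `[< exists2 L, bad L & #|` L| = n >].
  by exists #|` L|; apply/asboolP; exists L.
case: (ex_minnP ex) => n /asboolP[{badL0}{}L [gL Lp ML] Ln] minL.
have {n Ln}minL K : bad K -> (#|` L| <= #|` K|)%N.
  by move=> badK; rewrite Ln; apply: minL; apply/asboolP; exists K.
have L1 : (1 < #|` L|)%N.
  have [x [y [xy xM yM]]] := card_gt1P M1.
  by apply: (@fsubgroup_gt1 _ _ (x - y)); rewrite ?ML ?subr_eq0.
have [l lL l0] := fsubgroup_gt1P gL L1.
have /fsubsetPn[_ /fsumP[_ [k [/fsumP[a [b [aA bM ->]]] kL ->]]] abk] :
    ~~ (A `+` M `+` L `<=` A `+` M).
  by apply: contra l0 => /(sub_fstab AM0)/fsubsetP/(_ _ lL)/apM->.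
pose A1 := [fset x in A | x - a \in L]; pose A2 := [fset x in A | x - a \notin L].
have aA1 : a \in A1 by rewrite !inE /= aA subrr (proj1 gL).
have A10 : A1 != fset0 by apply/fset0Pn; exists a.
have A12 : A = A1 `|` A2.
  by apply/fsetP => x; rewrite !inE /= -andb_orr orbN andbT.
have dA12 : A1 `&` A2 = fset0.
  apply/fsetP => x; rewrite !inE /=; case: (x - a \in L); rewrite ?andbF //.
have cA : (#|` A| = #|` A1| + #|` A2|)%N.
  by rewrite A12 -cardfsUI dA12 cardfs0 addn0.
have A1M0 : A1 `+` M != fset0 by apply: fsum_eq0.
have dS : (A1 `+` M) `&` (A2 `+` M) = fset0.
  apply/eqP; rewrite -fsubset0; apply/fsubsetP => z; rewrite in_fsetI => /andP[].
  move=> /fsumP[x [u [+ uM ->]]] /fsumP[y [v [+ vM xuyv]]].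
  rewrite !inE /= => /andP[xA xa] /andP[yA ya]; case/negP: ya.
  have yE : y = x + u - v by rewrite xuyv; zmod.
  have -> : y - a = x - a + (u - v) by rewrite yE; zmod.
  by rewrite fsubgroupD // ML.
have cS : (#|` A `+` M| = #|` A1 `+` M| + #|` A2 `+` M|)%N.
  by rewrite {1}A12 fsumUl -cardfsUI dS cardfs0 addn0.
(* The period [K] of A1 + M lies in [L] and misses [k]. If it is nontrivial, minimality of [L] keeps
   [M] out of a single [K]-coset, and [sidon_coset] compensates Kneser's correction term. *)
have A1S : (#|` A1| + #|` M| <= #|` A1 `+` M| + 1)%N.
  pose K := fstab (A1 `+` M); have gK : fsubgroup K := fstab_subgroup A1M0.
  have KL : K `<=` L.
    apply: (@fstab_sub_fsubgroup _ _ _ (a + m)) => //.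
    apply/fsubsetP => z /fsumP[x [u [+ uM ->]]]; rewrite !inE /= => /andP[xA xa].
    rewrite mem_fsum1; have -> : x + u - (a + m) = x - a + (u - m) by zmod.
    by rewrite fsubgroupD // ML.
  have kK : k \notin K.
    apply: contra abk => kK.
    have : a + b + k \in A1 `+` M `+` K by rewrite !mem_fsum.
    rewrite fsum_fstab //; apply: (fsubsetP (fsumS _ (fsubset_refl M))).
    by rewrite A12 fsubsetUl.
  have [|K1] := faperiodicVgt1 A1M0; first exact: kneser_aperiodic.
  have [MK|] := pselect (forall x y, x \in M -> y \in M -> x - y \in K).
    have : bad K by split => //; exists k.
    move/minL; have : K `<` L.
      by rewrite fproperEneq KL andbT; apply: contraNneq kK => ->.
    by move/fproper_ltn_card; nlia.
  move=> /existsNP[x /existsNP[y]] /not_implyP[xM] /not_implyP[yM /negP xyK].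
  have := sidon_coset sM gK K1 xM yM xyK.
  have := kneser_strong A10 M0; rewrite -/K.
  have := fsubset_leq_card (fsub_fsum A1 (proj1 gK)).
  by nlia.
(* Nothing is left to gain: |A2 + M| <= |A2|, so the translates of [A2] by elements of [M] coincide
   and differences of [M] are periods of [A2]. Minimality of [L] extends this to all of [L]. *)
have A2L : A2 `+` L = A2.
  have [->|A20] := eqVneq A2 fset0; first by rewrite fsumC fsum_set0.
  pose K := fstab A2 `&` L.
  have gK : fsubgroup K by apply: fsubgroupI => //; apply: fstab_subgroup.
  have : bad K.
    split => //; first by case: Lp => x xL; exists x; rewrite in_fsetI negb_and xL orbT.
    move=> x y xM yM; rewrite in_fsetI ML // andbT mem_fstab //.
    have e u : u \in M -> [fset u] `+` A2 = A2 `+` M.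
      move=> uM; apply/eqP; rewrite eqEfcard card_fsum1 fsumC fsumS ?fsub1set //=.
      by nlia.
    have -> : [fset x - y] `+` A2 = [fset - y] `+` ([fset x] `+` A2).
      by rewrite fsumA fsum1_fset1 [- y + x]addrC.
    rewrite e // -(e _ yM) fsumA fsum1_fset1 addNr fsum0; exact: eqxx.
  move/minL => LK; apply: fstab_fsum => //; first exact: (proj1 gL).
  have : K == L by rewrite eqEfcard fsubsetIr.
  by move/eqP => <-; apply: fsubsetIl.
have := gA L gL L1 Lp.
have : A `+` L `<=` A2 `|` ([fset a] `+` L).
  rewrite {1}A12 fsumUl A2L fsubUset fsubsetUl andbT.
  apply: fsubset_trans (fsubsetUr _ _); apply/fsubsetP => _ /fsumP[x [u [xA1 uL ->]]].
  move: xA1; rewrite !inE /= => /andP[xA xa]; rewrite mem_fsum1.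
  by have -> : x + u - a = x - a + u by [zmod]; apply: fsubgroupD.
move/fsubset_leq_card; have := cardfsUI A2 ([fset a] `+` L).
rewrite card_fsum1; have : (0 < #|` A1|)%N by rewrite cardfs_gt0.
by nlia.
Qed.

(* Hamidoune: a Sidon set critical for an expanding set is again expanding, hence
   has itself a minimal critical set, and two Sidon sets cannot form a critical
   pair. *)
Lemma expanding_progression (V : zmodType) (A : {fset V}) : expanding A ->
  (1 < #|` A|)%N -> (exists X, fcritical A X) ->
  exists2 d, d != 0 & (#|` A `|` ([fset d] `+` A)| <= #|` A| + 1)%N.
Proof.
move=> gA A1 exX; have A0 : A != fset0 by rewrite -cardfs_gt0; nlia.
have [M crM sM] := expanding_atom gA A0 exX.
have pair (B : {fset V}) (x y : V) : [fset x; y] `+` B =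
    [fset x] `+` (B `|` ([fset y - x] `+` B)).
  rewrite fsumUr fsumA fsum1_fset1 fsumUl; congr (_ `|` _).
  by have -> : x + (y - x) = y by zmod.
have size2 (X : {fset V}) : #|` X| = 2%N -> exists x y, x != y /\ X = [fset x; y].
  move=> X2; have [|x [y [xy xX yX]]] := @card_gt1P _ X; first by rewrite X2.
  exists x, y; split => //; apply/esym/eqP.
  by rewrite eqEfcard fsubUset !fsub1set xX yX cardfs2 xy X2.
case: (crM) => M1 AM _.
(* For M = {x, y}, A + M is a translate of the union of [A] and d + A with d = y - x. *)
have [M2|M2] := eqVneq #|` M| 2%N.
  have [x [y [xy Mxy]]] := size2 _ M2; exists (y - x).
    by rewrite subr_eq0 eq_sym.
  by move: AM; rewrite M2 fsumC Mxy pair card_fsum1; nlia.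
have M0 : M != fset0 by rewrite -cardfs_gt0; nlia.
have gM := sidon_expanding gA A0 crM sM.
have [|N crN sN] := expanding_atom gM M0; first by exists A; apply: fcriticalC.
case: (crN) => N1 MN _.
have [N2|N2] := eqVneq #|` N| 2%N.
  have [x [y [xy Nxy]]] := size2 _ N2.
  move: MN; rewrite N2 fsumC Nxy pair card_fsum1.
  have := cardfsUI M ([fset y - x] `+` M); rewrite card_fsum1.
  have : (#|` M `&` ([fset (y - x)%R] `+` M)| <= 1)%N.
    by apply: sM; rewrite subr_eq0 eq_sym.
  by nlia.
(* With at least three elements on both sides, adding the two bounds of [sidon_sum] gives 3(|M| +
   |N|) <= 2(|M| + |N| + 2), hence |M| + |N| <= 4. *)
have M3 : (2 < #|` M|)%N by nlia.
have N3 : (2 < #|` N|)%N by nlia.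
have := sidon_sum sM N3; have := sidon_sum sN M3; rewrite [N `+` M]fsumC.
by nlia.
Qed.

End Atoms.

(** * Arithmetic progressions *)

Section Progressions.
Local Open Scope fset_scope.
Local Open Scope ring_scope.

(** Terms may repeat, so [n] only bounds the cardinality from above; the hypothesis that [n] is at
    most the cardinality expresses that all terms are distinct. *)
Definition fprog (V : zmodType) (x d : V) (n : nat) : {fset V} :=
  [fset x + d *+ i | i in iota 0 n].

Lemma fprogP (V : zmodType) (x d y : V) (n : nat) :
  reflect (exists2 i, (i < n)%N & y = x + d *+ i) (y \in fprog x d n).
Proof.
apply: (iffP (imfsetP _ _ _ _)) => /= -[i].
  by rewrite mem_iota => /andP[_ ltin] ->; exists i.
by move=> ltin ->; exists i; rewrite // mem_iota.
Qed.

Lemma mem_fprog (V : zmodType) (x d : V) (n i : nat) : (i < n)%N ->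
  x + d *+ i \in fprog x d n.
Proof. by move=> ltin; apply/fprogP; exists i. Qed.

Lemma fprog0 (V : zmodType) (x d : V) : fprog x d 0 = fset0.
Proof. by apply/eqP; rewrite -fsubset0; apply/fsubsetP => y /fprogP[]. Qed.

Lemma fprogS (V : zmodType) (x d : V) (n : nat) :
  fprog x d n.+1 = fprog x d n `|` [fset x + d *+ n].
Proof.
apply/fsetP => y; rewrite in_fsetU in_fset1; apply/fprogP/idP => [[i]|/orP[]].
- rewrite ltnS leq_eqVlt => /predU1P[->|ltin] ->; first by rewrite eqxx orbT.
  by rewrite mem_fprog.
- by move=> /fprogP[i ltin ->]; exists i => //; apply: ltnW.
- by move=> /eqP ->; exists n.
Qed.

Lemma fprog1 (V : zmodType) (x d : V) : fprog x d 1 = [fset x].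
Proof. by rewrite fprogS fprog0 fset0U mulr0n addr0. Qed.

Lemma fprog_step (V : zmodType) (x d : V) (n : nat) : (0 < n)%N ->
  fprog x d n.+1 = fprog x d n `|` ([fset d] `+` fprog x d n).
Proof.
move=> n0; apply/fsetP => y; rewrite in_fsetU mem_fsum1; apply/fprogP/idP.
  move=> [[|i] lti ->]; apply/orP; first by left; rewrite mem_fprog.
  right; have -> : x + d *+ i.+1 - d = x + d *+ i by rewrite mulrSr addrA addrK.
  by rewrite mem_fprog.
case/orP => /fprogP[i lti]; first by exists i => //; apply: ltnW.
by move=> yE; exists i.+1; rewrite // mulrSr addrA -yE subrK.
Qed.

Lemma card_fprog_le (V : zmodType) (x d : V) (n : nat) :
  (#|` fprog x d n| <= n)%N.
Proof.
elim: n => [|n IHn]; first by rewrite fprog0 cardfs0.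
rewrite fprogS; have := cardfsUI (fprog x d n) [fset x + d *+ n].
by rewrite cardfs1; nlia.
Qed.

Lemma fprog_inj (V : zmodType) (x d : V) (n i j : nat) :
  (n <= #|` fprog x d n|)%N -> (i < n)%N -> (j < n)%N ->
  x + d *+ i = x + d *+ j -> i = j.
Proof.
elim: n i j => // n IHn i j.
have := cardfsUI (fprog x d n) [fset x + d *+ n].
rewrite -fprogS cardfs1 => cU leU.
have le1 : (n <= #|` fprog x d n|)%N by nlia.
have : #|` fprog x d n `&` [fset x + d *+ n]| = 0%N.
  by have := card_fprog_le x d n; nlia.
move=> /cardfs0_eq I0.
have new k : (k < n)%N -> x + d *+ k <> x + d *+ n.
  move=> ltkn e; have : x + d *+ n \in fprog x d n `&` [fset x + d *+ n].
    by rewrite in_fsetI in_fset1 eqxx andbT -e mem_fprog.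
  by rewrite I0.
rewrite !ltnS (leq_eqVlt i) (leq_eqVlt j) => /predU1P[->|lti] /predU1P[->|ltj] //.
- by move=> e; case: (new _ ltj).
- by move=> e; case: (new _ lti).
- exact: IHn.
Qed.

Lemma big_fprog (V : zmodType) (x d : V) (n : nat) (F : V -> nat) :
  (n <= #|` fprog x d n|)%N ->
  (\sum_(z <- fprog x d n) F z = \sum_(i < n) F (x + d *+ i)%R)%N.
Proof.
move=> len; rewrite big_imfset /=.
  rewrite undup_id ?iota_uniq // -{1}[n]subn0.
  exact: (big_mkord xpredT (fun i => F (x + d *+ i))).

move=> i j; rewrite /= !mem_iota /= => lti ltj; exact: (fprog_inj len).
Qed.

(* A set with at most one element leaving it under translation by d is the
   union of a d-periodic set and a progression: remove its last element. *)
Lemma fprog_decomp (V : zmodType) (X : {fset V}) (d : V) :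
  (#|` X `|` ([fset d] `+` X)| <= #|` X| + 1)%N ->
  exists x n (Y : {fset V}), [/\ X = Y `|` fprog x d n,
    #|` X| = (#|` Y| + n)%N & [fset d] `+` Y `<=` Y].
Proof.
have [m] := ubnP #|` X|; elim: m X => // m IHm X; rewrite ltnS => leXm cX.
have [dX|/fsubsetPn[z]] := boolP ([fset d] `+` X `<=` X).
  by exists 0, 0%N, X; rewrite fprog0 fsetU0 addn0.
rewrite mem_fsum1; set e := z - d => eX zX.
have zE : z = e + d by rewrite /e; zmod.
have uniq_e x : x \in X -> x + d \notin X -> x = e.
  move=> xX xdX; apply/eqP/negPn/negP => xe.
  have : X `|` [fset x + d; z] `<=` X `|` ([fset d] `+` X).
    rewrite fsubUset fsubsetUl; apply: fsubset_trans (fsubsetUr _ _).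
    by rewrite fsubUset !fsub1set !mem_fsum1 zE !addrK xX eX.
  move/fsubset_leq_card; have := cardfsUI X [fset x + d; z].
  have -> : X `&` [fset x + d; z] = fset0.
    apply/eqP; rewrite -fsubset0; apply/fsubsetP => y.
    by rewrite in_fsetI in_fset2 => /andP[yX /orP[]/eqP yE];
      move: xdX zX; rewrite -yE yX.
  rewrite cardfs0 cardfs2 zE (inj_eq (addIr d)) xe.
  by nlia.
pose X' := X `\ e.
have XE : X = X' `|` fprog e d 1 by rewrite fprog1 fsetUC fsetD1K.
have cX' : #|` X| = (#|` X'| + 1)%N by rewrite (cardfsD1 e X) eX addnC.
have dX'X : [fset d] `+` X' `<=` X.
  apply/fsubsetP => y; rewrite mem_fsum1 in_fsetD1 => /andP[ye yX].
  by apply: contraNT ye => yNX; apply/eqP/uniq_e; rewrite ?subrK.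
have [dX'|dX'] := boolP ([fset d] `+` X' `<=` X'); first by exists e, 1%N, X'.
have [||x [n [Y [X'E cX'E dY]]]] := IHm X'.
- by nlia.
- have : X' `|` ([fset d] `+` X') `<=` X by rewrite fsubUset dX'X fsubD1set.
  by move/fsubset_leq_card; nlia.
have [n0|n0] := posnP n.
  by case/negP: dX'; rewrite X'E n0 fprog0 fsetU0.
have tX' : x + d *+ n.-1 \in X' by rewrite X'E in_fsetU mem_fprog ?orbT ?prednK.
have tE : x + d *+ n.-1 + d = x + d *+ n.
  by rewrite -[in RHS](prednK n0) mulrSr addrA.
have tdX : x + d *+ n \in X by apply: (fsubsetP dX'X); rewrite mem_fsum1 -tE addrK.
(* The term following the last one of [X'] stays in [X]. If it differed from [e], it would lie in
   [X'], which would then be closed under translation by [d]. *)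
have tde : x + d *+ n = e.
  apply/eqP; apply: contraNT dX' => tde.
  have {tde}tX'' : x + d *+ n \in X' by rewrite in_fsetD1 tde.
  rewrite {1}X'E fsumUr fsubUset; apply/andP; split.
    by apply: fsubset_trans dY _; rewrite X'E fsubsetUl.
  apply/fsubsetP => y; rewrite mem_fsum1 => /fprogP[i lti yE].
  have -> : y = x + d *+ i.+1 by rewrite mulrSr addrA -yE subrK.
  have [->//|ine] := eqVneq i.+1 n.
  by rewrite X'E in_fsetU mem_fprog ?orbT // ltn_neqAle ine.
exists x, n.+1, Y; split => //; last by rewrite cX' cX'E; lia.
by rewrite fprogS fsetUA -X'E tde XE fprog1.
Qed.

Lemma fprog_subcoset (V : zmodType) (x d : V) (n : nat) (K : {fset V}) :
  fsubgroup K -> d \in K -> fprog x d n `+` K `<=` [fset x] `+` K.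
Proof.
move=> gK dK; apply/fsubsetP => _ /fsumP[_ [k [/fprogP[i _ ->] kK ->]]].
rewrite mem_fsum1; have -> : x + d *+ i + k - x = d *+ i + k by zmod.
apply: fsubgroupD => //; elim: i => [|i IHi]; first exact: (proj1 gK).
by rewrite mulrS fsubgroupD.
Qed.

(** A nonempty periodic part [Y] has a proper period K containing [d]. Each application refutes this
    by its own count modulo K. *)
Lemma fprog_of_decomp (V : zmodType) (X : {fset V}) (d : V) :
  (exists z, z \notin X) -> (#|` X `|` ([fset d] `+` X)| <= #|` X| + 1)%N ->
  (forall (Y K : {fset V}) (x : V) (n : nat), X = Y `|` fprog x d n ->
     #|` X| = (#|` Y| + n)%N -> Y != fset0 -> fsubgroup K -> d \in K ->
     (exists x, x \notin K) -> Y `+` K = Y -> False) ->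
  exists x, X = fprog x d #|` X|.
Proof.
move=> [z zX] cX hX; have [x [n [Y [XE cXE dY]]]] := fprog_decomp cX.
have [Y0|Y0] := eqVneq Y fset0.
  by exists x; rewrite cXE Y0 cardfs0 add0n {1}XE Y0 fset0U.
case: (hX Y (fstab Y) x n) => //; last exact: fsum_fstab.
- exact: fstab_subgroup.
- by rewrite mem_fstab // eqEfcard dY card_fsum1 leqnn.
- apply: fstab_proper => //; exists z.
  by apply: contra zX; rewrite XE in_fsetU => ->.
Qed.

(** If [Y] were nonempty, all [K]-cosets meeting [A] would be full except at most the one holding
    the progression, so A + K would exceed [A] by less than |K|. *)
Lemma expanding_fprog (V : zmodType) (A : {fset V}) (d : V) : expanding A ->
  (exists z, z \notin A) -> d != 0 ->
  (#|` A `|` ([fset d] `+` A)| <= #|` A| + 1)%N ->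
  exists x, A = fprog x d #|` A|.
Proof.
move=> gA zA d0 cA; apply: fprog_of_decomp => // Y K x n AE cAE Y0 gK dK Kp YK.
have := gA K gK (fsubgroup_gt1 gK dK d0) Kp.
have AKE : A `+` K `<=` Y `|` (fprog x d n `+` K) by rewrite AE fsumUl YK.
move/fsubset_leq_card: AKE.
have := cardfsUI Y (fprog x d n `+` K).
have := fsubset_leq_card (fprog_subcoset x n gK dK); rewrite card_fsum1.
have := fsubgroup_gt1 gK dK d0.
have [n0|n0] := posnP n; last by nlia.
have -> : fprog x d n `+` K = fset0 by rewrite n0 fprog0 fsumC fsum_set0.
by rewrite cardfs0; nlia.
Qed.

(** Increments of a concave sequence decrease, so a positive last one makes all of them at least
    1. *)
Lemma concave_step (c : nat -> nat) (q : nat) : (0 < q)%N ->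
  (forall k, (k.+2 <= q)%N -> (c k + c k.+2 <= 2 * c k.+1)%N) ->
  (c q.-1 < c q)%N -> (c 1 + q <= c q + 1)%N.
Proof.
elim: q => // -[_ _ //|q IHq] _ conc /= cq.
have cqq : (c q < c q.+1)%N by have := conc q (leqnn _); lia.
have := IHq isT (fun k lek => conc k (ltnW lek)) cqq.
by lia.
Qed.

(** The sums of [B] with initial segments of [A] have concave sizes by submodularity. The last
    increment is positive, since otherwise [d] would be a period of A + B. As the total increase is
    q, the first increment is at most 1, which is the hypothesis of [fprog_of_decomp]. *)
Lemma fprog_sum_fprog (V : zmodType) (B : {fset V}) (x d : V) (q : nat) :
  let A := fprog x d q.+1 in
  expanding A -> (0 < q)%N -> #|` A| = q.+1 -> d != 0 -> B != fset0 ->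
  (exists z, z \notin A `+` B) -> (#|` A `+` B| + 1 = #|` A| + #|` B|)%N ->
  exists y, B = fprog y d #|` B|.
Proof.
move=> A gA q0 cA d0 B0 zAB cAB.
have A0 : A != fset0 by rewrite -cardfs_gt0 cA.
have AB0 : A `+` B != fset0 by apply: fsum_eq0.
have apAB : faperiodic (A `+` B) by have [|//] := expanding_or gA A0 B0 zAB; nlia.
pose X k := fprog x d k.+1 `+` B.
have XS k : X k.+1 = X k `|` ([fset d] `+` X k).
  by rewrite /X fprog_step // fsumUl fsumA.
have X0 : #|` X 0| = #|` B| by rewrite /X fprog1 card_fsum1.
have Xq : X q = A `+` B by [].
have step : (#|` X 1| <= #|` B| + 1)%N.
  suff : (#|` X 1| + q <= #|` X q| + 1)%N by rewrite Xq; nlia.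
  apply: (@concave_step (fun k => #|` X k|)) => // [k _|].
    rewrite [X k.+2]XS; have := cardfsUI (X k.+1) ([fset d] `+` X k.+1).
    have : [fset d] `+` X k `<=` X k.+1 `&` ([fset d] `+` X k.+1).
      by rewrite fsubsetI XS fsubsetUr fsumS ?fsubsetUl.
    by move/fsubset_leq_card; rewrite !card_fsum1; nlia.
  have [p qE] : exists p, q = p.+1 by exists q.-1; rewrite prednK.
  rewrite qE /= ltnNge; apply/negP => leX.
  have XpE : X p.+1 = X p by apply/esym/eqP; rewrite eqEfcard leX andbT XS fsubsetUl.
  case/eqP: d0; apply: apAB; rewrite mem_fstab // -Xq eqEfcard card_fsum1 leqnn.
  by rewrite andbT qE {1}XpE XS fsubsetUr.
have {}step : (#|` B `|` ([fset d] `+` B)| <= #|` B| + 1)%N.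
  move: step; rewrite XS /X fprog1 fsumA [[fset d] `+` _]fsumC -fsumA -fsumUr.
  by rewrite card_fsum1.
apply: fprog_of_decomp => //.
  case: zAB => z zAB; have [a aA] := fset0Pn _ A0; exists (z - a).
  apply: contra zAB => /(mem_fsum aA).
  by have -> : a + (z - a) = z by zmod.
move=> Y K y n BE cBE Y0 gK dK Kp YK.
have := gA K gK (fsubgroup_gt1 gK dK d0) Kp.
have := fsubset_leq_card (fprog_subcoset x q.+1 gK dK); rewrite card_fsum1 -/A cA.
by nlia.
Qed.

End Progressions.

(** * Fibre sizes along staircase paths in a grid *)

Section Staircase.

(* [s j], [t i] and [v k] are the sizes of the fibres of S, T and S + T over the
   cosets numbered j, i and k of three progressions with a common difference. *)

Record staircase (q u h : nat) (s t v : nat -> nat) : Prop := Staircase {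
  stair_s : forall j, (j <= q)%N -> (0 < s j <= h)%N;
  stair_sv : forall j i, (j <= q)%N -> (i <= u)%N -> (s j <= v (j + i))%N;
  stair_tv : forall j i, (j <= q)%N -> (i <= u)%N -> (t i <= v (j + i))%N;
  stair_v : forall k, (k <= q + u)%N -> (v k <= h)%N;
  stair_full : forall j i, (j <= q)%N -> (i <= u)%N -> (h < s j + t i)%N ->
    v (j + i)%N = h;
  stair_holes : (q * h < \sum_(j < q.+1) s j)%N;
  stair_sum : (\sum_(k < (q + u).+1) v k + 1 <=
               \sum_(j < q.+1) s j + \sum_(i < u.+1) t i)%N
}.

Lemma sum_ord_rev (n : nat) (F : nat -> nat) :
  (\sum_(i < n.+1) F (n - i)%N = \sum_(i < n.+1) F i)%N.
Proof.
rewrite (reindex_inj rev_ord_inj) /=; apply: eq_bigr => i _.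
by congr F; rewrite subSS subKn // -ltnS.
Qed.

Lemma staircase_rev (q u h : nat) (s t v : nat -> nat) :
  staircase q u h s t v ->
  staircase q u h (fun j => s (q - j)%N) (fun i => t (u - i)%N)
    (fun k => v (q + u - k)%N).
Proof.
move=> [h1 h2 h3 h4 h5 h6 h7].
have e j i : (j <= q)%N -> (i <= u)%N -> (q + u - (j + i) = (q - j) + (u - i))%N by lia.
split => [j lej|j i lej lei|j i lej lei|k lek|j i lej lei lth||].
- by apply: h1; lia.
- by rewrite e // h2 //; lia.
- by rewrite e // h3 //; lia.
- by apply: h4; lia.
- by rewrite e // h5 //; lia.
- by rewrite (sum_ord_rev _ s).
- by rewrite (sum_ord_rev _ s) (sum_ord_rev _ t) (sum_ord_rev _ v).
Qed.

Lemma sum_nat_split (F : nat -> nat) (m n : nat) :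
  (\sum_(k < m + n) F k = \sum_(k < m) F k + \sum_(k < n) F (m + k))%N.
Proof. by rewrite big_split_ord. Qed.

(** Along the path (0,0), (j,0), (j,i), (q,i), (q,u) each entry of [v] except v_(j+i) is bounded
    below by an s on the steps in the first coordinate and by a t on the others; only s_j and t_i
    are left for v_(j+i). *)
Lemma staircase_path (q u h : nat) (s t v : nat -> nat) (j i : nat) :
  staircase q u h s t v -> (j <= q)%N -> (i <= u)%N ->
  (v (j + i) < s j + t i)%N.
Proof.
move=> [_ h2 h3 _ _ _ h7] lej lei; move: h7.
have -> : (q + u).+1 = (j + (i + (1 + ((q - j) + (u - i)))))%N by lia.
have -> : q.+1 = (j + (1 + (q - j)))%N by lia.
have -> : u.+1 = (i + (1 + (u - i)))%N by lia.
rewrite (sum_nat_split v) (sum_nat_split (fun k => v (j + k)%N)).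
rewrite (sum_nat_split (fun k => v (j + (i + k))%N)).
rewrite (sum_nat_split (fun k => v (j + (i + (1 + k)))%N)).
rewrite (sum_nat_split s) (sum_nat_split (fun k => s (j + k)%N)).
rewrite (sum_nat_split t) (sum_nat_split (fun k => t (i + k)%N)).
rewrite !big_ord1 /= !addn0.
have : (\sum_(k < j) s k <= \sum_(k < j) v k)%N.
  apply: leq_sum => k _; have := ltn_ord k => ltk.
  by have := h2 k 0%N; rewrite addn0; apply; lia.
have : (\sum_(k < i) t k <= \sum_(k < i) v (j + k))%N.
  by apply: leq_sum => k _; rewrite h3 //; have := ltn_ord k; lia.
have : (\sum_(k < q - j) s (j + (1 + k)) <=
        \sum_(k < q - j) v (j + (i + (1 + k))))%N.
  apply: leq_sum => k _; have := ltn_ord k => ltk.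
  have -> : (j + (i + (1 + k)) = (j + (1 + k)) + i)%N by lia.
  by rewrite h2 //; lia.
have : (\sum_(k < u - i) t (i + (1 + k)) <=
        \sum_(k < u - i) v (j + (i + (1 + (q - j + k)))))%N.
  apply: leq_sum => k _; have := ltn_ord k => ltk.
  have -> : (j + (i + (1 + (q - j + k))) = q + (i + (1 + k)))%N by lia.
  by rewrite h3 //; lia.
by nlia.
Qed.

(** The same summation, with the three entries over the unit square from (0,k) to (1,k+1) left
    open. *)
Lemma staircase_three (q u h : nat) (s t v : nat -> nat) (k : nat) :
  staircase q u h s t v -> (0 < q)%N -> (k < u)%N ->
  (v k + v k.+1 + v k.+2 < s 0 + s 1 + t k + t k.+1)%N.
Proof.
move=> [_ h2 h3 _ _ _ h7] q0 ltk; move: h7.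
have -> : (q + u).+1 = (k + (1 + (1 + (1 + (q.-1 + (u - k.+1))))))%N by lia.
have -> : q.+1 = (1 + (1 + q.-1))%N by lia.
have -> : u.+1 = (k + (1 + (1 + (u - k.+1))))%N by lia.
rewrite (sum_nat_split v) (sum_nat_split (fun i => v (k + i)%N)).
rewrite (sum_nat_split (fun i => v (k + (1 + i))%N)).
rewrite (sum_nat_split (fun i => v (k + (1 + (1 + i)))%N)).
rewrite (sum_nat_split (fun i => v (k + (1 + (1 + (1 + i))))%N)).
rewrite (sum_nat_split s) (sum_nat_split (fun i => s (1 + i)%N)).
rewrite (sum_nat_split t) (sum_nat_split (fun i => t (k + i)%N)).
rewrite (sum_nat_split (fun i => t (k + (1 + i))%N)).
rewrite !big_ord1 /= !addn0 !addn1 !addnS !addn0.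
have : (\sum_(i < k) t i <= \sum_(i < k) v i)%N.
  apply: leq_sum => i _; have := ltn_ord i => lti.
  by have := h3 0%N i; rewrite add0n; apply; lia.
have : (\sum_(i < q.-1) s (1 + (1 + i)) <=
        \sum_(i < q.-1) v (k + (1 + (1 + (1 + i)))))%N.
  apply: leq_sum => i _; have := ltn_ord i => lti.
  have -> : (k + (1 + (1 + (1 + i))) = (1 + (1 + i)) + k.+1)%N by lia.
  by rewrite h2 //; lia.
have : (\sum_(i < u - k.+1) t (k + (1 + (1 + i))) <=
        \sum_(i < u - k.+1) v (k + (1 + (1 + (1 + (q.-1 + i))))))%N.
  apply: leq_sum => i _; have := ltn_ord i => lti.
  have -> : (k + (1 + (1 + (1 + (q.-1 + i)))) = q + (k + (1 + (1 + i))))%N by lia.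
  by rewrite h3 //; lia.
by nlia.
Qed.

(** By [stair_holes] the s_j fall short of (q+1)h by less than h in total. *)
Lemma staircase_two_s (q u h : nat) (s t v : nat -> nat) :
  staircase q u h s t v -> (0 < q)%N -> (h < s 0 + s 1)%N.
Proof.
move=> [h1 _ _ _ _ h6 _] q0; move: h6.
have -> : q.+1 = (1 + (1 + q.-1))%N by lia.
rewrite (sum_nat_split s) (sum_nat_split (fun i => s (1 + i)%N)) !big_ord1 /=.
have : (\sum_(i < q.-1) s (1 + (1 + i)) <= \sum_(i < q.-1) h)%N.
  apply: leq_sum => i _; have := ltn_ord i => lti.
  by have /andP[] := h1 (1 + (1 + i))%N ltac:(lia).
rewrite sum_nat_const card_ord !addn0.
have : (q * h = q.-1 * h + h)%N by rewrite -{1}(prednK q0) mulSn addnC.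
by nlia.
Qed.

(** Let m be the last incomplete index below [f], so that v_(m+1) = h. Incompleteness at m bounds
    s_0 + t_m and s_1 + t_(m-1) by h, and [staircase_three] gives v_(m-1) + v_m < h. But v_(m-1) >=
    s_0 and v_m >= s_1, against [staircase_two_s]. *)
Lemma staircase_below (q u h : nat) (s t v : nat -> nat) (f k : nat) :
  staircase q u h s t v -> (0 < q)%N -> (f <= u)%N -> t f = h ->
  (0 < k < f)%N -> v k = h.
Proof.
move=> st q0 fu tf /andP[k0 kf]; case: (st) => h1 h2 h3 h4 h5 _ _.
apply/eqP; rewrite eqn_leq h4 /=; last by lia.
rewrite leqNgt; apply/negP => vk.
have ex : exists z, (z < f)%N && (v z < h)%N by exists k; rewrite kf.
have bd z : (z < f)%N && (v z < h)%N -> (z <= f)%N by case/andP=> /ltnW.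
case: (ex_maxnP ex bd) => m /andP[mf vm] maxm.
have m0 : (0 < m)%N by apply: leq_trans k0 (maxm _ _); rewrite kf.
have vf : v f = h.
  rewrite -[f]add0n; apply: h5 => //; rewrite tf.
  by have := h1 0%N isT; lia.
have vm1 : v m.+1 = h.
  have [->//|mf1] := eqVneq m.+1 f.
  apply/eqP; rewrite eqn_leq h4 /=; last by lia.
  rewrite leqNgt; apply/negP => vm1.
  by have := maxm m.+1; rewrite vm1 andbT; lia.
have mE : m = m.-1.+1 by lia.
have := @staircase_three _ _ _ _ _ _ m.-1 st q0; rewrite -mE.
have := staircase_two_s st q0.
have a1 : (s 0 + t m <= h)%N.
  rewrite leqNgt; apply/negP => /h5; rewrite add0n => e.
  by move: vm; rewrite e ?ltnn //; lia.
have a2 : (s 1 + t m.-1 <= h)%N.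
  rewrite leqNgt; apply/negP => /h5; rewrite add1n -mE => e.
  by move: vm; rewrite e ?ltnn //; lia.
have := h2 0%N m.-1; rewrite add0n.
have := h2 1%N m.-1; rewrite add1n -mE.
by lia.
Qed.

(** Let m be the last incomplete index before [f] and n the first one after f + q. Then v_(q+m) =
    v_(n-q) = h, and the paths through (q,m) and (0,n-q) give 2h < s_q + t_m + s_0 + t_(n-q).
    Incompleteness at m and n bounds s_0 + t_m and s_q + t_(n-q) by h. *)
Lemma staircase_one_side (q u h : nat) (s t v : nat -> nat) (f k l : nat) :
  staircase q u h s t v -> (0 < q)%N -> (f <= u)%N -> t f = h ->
  (k < f)%N -> (v k < h)%N -> (f + q < l <= q + u)%N -> v l = h.
Proof.
move=> st q0 fu tf kf vk /andP[fl lu]; case: (st) => h1 h2 h3 h4 h5 _ _.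
apply/eqP; rewrite eqn_leq h4 //= leqNgt; apply/negP => vl.
have mid z : (f <= z <= f + q)%N -> v z = h.
  move=> /andP[fz zq]; have -> : z = ((z - f) + f)%N by lia.
  apply: h5; rewrite ?tf //; first by lia.
  by have := h1 (z - f)%N; lia.
have ex : exists z, (z < f)%N && (v z < h)%N by exists k; rewrite kf.
have bd z : (z < f)%N && (v z < h)%N -> (z <= f)%N by case/andP=> /ltnW.
case: (ex_maxnP ex bd) => m /andP[mf vm] maxm.
have ex' : exists z, (f + q < z <= q + u)%N && (v z < h)%N.
  by exists l; rewrite fl lu.
case: (ex_minnP ex') => n /andP[/andP[fn nu] vn] minn.
have v1 : v (q + m)%N = h.
  have [lt|ge] := leqP f (q + m); first by apply: mid; lia.
  apply/eqP; rewrite eqn_leq h4 /=; last by lia.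
  rewrite leqNgt; apply/negP => vz.
  by have := maxm (q + m)%N; rewrite vz ge; lia.
have v2 : v (n - q)%N = h.
  have [ge|lt] := leqP (n - q) (f + q); first by apply: mid; lia.
  apply/eqP; rewrite eqn_leq h4 /=; last by lia.
  rewrite leqNgt; apply/negP => vz.
  by have := minn (n - q)%N; rewrite vz lt; lia.
have a1 : (s 0 + t m <= h)%N.
  rewrite leqNgt; apply/negP => /h5; rewrite add0n => e.
  by move: vm; rewrite e ?ltnn //; lia.
have nE : (q + (n - q) = n)%N by lia.
have a2 : (s q + t (n - q) <= h)%N.
  rewrite leqNgt; apply/negP => /h5; rewrite nE => e.
  by move: vn; rewrite e ?ltnn //; lia.
have := @staircase_path _ _ _ _ _ _ q m st; have := @staircase_path _ _ _ _ _ _ 0 (n - q) st.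
rewrite add0n v1 v2.
by lia.
Qed.

(** The full t_f completes the entries from [f] to f + q. [staircase_below] and its reversal leave
    only the two ends, and [staircase_one_side] excludes that both are incomplete. *)
Lemma staircaseP (q u h : nat) (s t v : nat -> nat) (f : nat) :
  staircase q u h s t v -> (0 < q)%N -> (f <= u)%N -> t f = h ->
  (forall k, (0 < k <= q + u)%N -> v k = h) \/
  (forall k, (k < q + u)%N -> v k = h).
Proof.
move=> st q0 fu tf; case: (st) => h1 _ _ h4 h5 _ _.
have mid z : (f <= z <= f + q)%N -> v z = h.
  move=> /andP[fz zq]; have -> : z = ((z - f) + f)%N by lia.
  apply: h5; rewrite ?tf //; first by lia.
  by have := h1 (z - f)%N; lia.
have [[k kf vk]|below] := pselect (exists2 k, (k < f)%N & (v k < h)%N).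
  left => l /andP[l0 lu]; have [lf|fl] := ltnP l f.
    by apply: (staircase_below st q0 fu tf); rewrite l0.
  have [lq|ql] := leqP l (f + q); first by rewrite mid ?fl.
  by apply: (staircase_one_side st q0 fu tf kf vk); rewrite ql.
right => l lu; have [lf|fl] := ltnP l f.
  apply/eqP; rewrite eqn_leq h4 ?(ltnW lu) //= leqNgt; apply/negP => vl.
  by apply: below; exists l.
have [lq|ql] := leqP l (f + q); first by rewrite mid ?fl.
have := @staircase_below _ _ _ _ _ _ (u - f) (q + u - l) (staircase_rev st) q0.
rewrite subKn // subKn ?(ltnW lu) //; apply; rewrite ?leq_subr //; lia.
Qed.

End Staircase.

(** * Sets generating a proper subgroup, and the dual pair *)

Section QuasiPeriodic.
Local Open Scope fset_scope.
Local Open Scope ring_scope.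

(** [P] is membership in the subgroup generated by [S], kept as a predicate because that subgroup
    may be infinite. If the sum of [S] with a part of [T] is not stable under [S], its period misses
    an element of [S], and Kneser gives a gain of at least |S|/2. Two such parts would exceed the
    total gain |S| - 1. *)
Lemma quasi_periodic_gen (V : zmodType) (S T : {fset V}) (P : pred V) :
  (forall x y, P x -> P y -> P (x - y)) -> (forall x, x \in S -> P x) ->
  (forall K : {fset V}, fsubgroup K -> S `<=` K -> forall x, P x -> x \in K) ->
  0 \in S -> (1 < #|` S|)%N -> T != fset0 ->
  faperiodic (S `+` T) -> (#|` S `+` T| + 1 = #|` S| + #|` T|)%N ->
  exists t, forall x k, x \in T -> ~~ P (x - t) -> P k -> x + k \in T.
Proof.
move=> PB SP Pmin S0 S1 T0; rewrite fsumC => apST cST.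
have PN x : P x -> P (- x) by move=> Px; rewrite -sub0r; apply: PB => //; apply: SP.
have PD x y : P x -> P y -> P (x + y).
  by move=> Px Py; rewrite -[y]opprK; apply: PB => //; apply: PN.
have SN0 : S != fset0 by rewrite -cardfs_gt0 ltnW.
have TS0 : T `+` S != fset0 by apply: fsum_eq0.
pose part t := [fset x in T | P (x - t)]; pose rest t := [fset x in T | ~~ P (x - t)].
have partS t : part t `<=` T by apply/fsubsetP => x; rewrite !inE => /andP[].
have part_t t : t \in T -> t \in part t by move=> tT; rewrite !inE /= tT subrr SP.
have dj (X Y : {fset V}) t : (forall x, x \in X -> P (x - t)) ->
    (forall y, y \in Y -> ~~ P (y - t)) -> (X `+` S) `&` (Y `+` S) = fset0.
  move=> XP YP; apply/eqP; rewrite -fsubset0; apply/fsubsetP => z.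
  rewrite in_fsetI => /andP[/fsumP[x [s [/XP xX sS ->]]] /fsumP[y [r [yY rS e]]]].
  case/negP: (YP _ yY); have -> : y - t = (x - t) + (s - r).
    have yE : y = x + s - r by rewrite e; zmod.
    by rewrite yE; zmod.
  by apply: PD => //; apply: PB; apply: SP.
have [t tT tS] : exists2 t, t \in T & ~~ (S `<=` fstab (part t `+` S)).
  apply: contrapT => nex; suff : S `<=` fstab (T `+` S).
    move=> /fsubsetP SST; have [x [y [xy xS yS]]] := card_gt1P S1.
    by case/eqP: xy; rewrite (apST _ (SST _ xS)) (apST _ (SST _ yS)).
  apply: sub_fstab => //; apply/fsubsetP => _ /fsumP[_ [r [/fsumP[x [s [xT sS ->]]] rS ->]]].
  have xst : S `<=` fstab (part x `+` S) by apply/negPn/negP => h; apply: nex; exists x.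
  have px0 : part x `+` S != fset0.
    by apply: fsum_eq0 => //; apply/fset0Pn; exists x; apply: part_t.
  have : x + s + r \in part x `+` S `+` S by rewrite !mem_fsum ?part_t.
  by rewrite (fstab_fsum px0 S0 xst); apply: (fsubsetP (fsumS (partS x) (fsubset_refl S))).
have half r : r \in T -> ~~ (S `<=` fstab (part r `+` S)) ->
    (2 * #|` part r| + #|` S| <= 2 * #|` part r `+` S|)%N.
  move=> rT rS; have pr0 : part r != fset0.
    by apply/fset0Pn; exists r; apply: part_t.
  have gL := fstab_subgroup (fsum_eq0 pr0 SN0).
  case/fsubsetPn: rS => s sS sL.
  have := @card_coset_ge2 _ S _ s 0 gL sS S0; rewrite subr0 => /(_ sL).
  have := kneser_strong pr0 SN0.
  have := fsubset_leq_card (fsub_fsum (part r) (proj1 gL)).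
  have := fsubset_leq_card (fsub_fsum S (proj1 gL)).
  by nlia.
exists t; pose R := rest t.
have TE : T = part t `|` R by apply/fsetP => x; rewrite !inE /= -andb_orr orbN andbT.
have dTR : part t `&` R = fset0.
  by apply/fsetP => x; rewrite !inE /=; case: (P (x - t)); rewrite ?andbF.
have cT : (#|` T| = #|` part t| + #|` R|)%N.
  by rewrite {1}TE -cardfsUI dTR cardfs0 addn0.
have cTS : (#|` T `+` S| = #|` part t `+` S| + #|` R `+` S|)%N.
  rewrite {1}TE fsumUl -cardfsUI (dj _ _ t) ?cardfs0 ?addn0 // => x.
    by rewrite !inE => /andP[].
  by rewrite !inE => /andP[].
have pt0 : part t != fset0 by apply/fset0Pn; exists t; apply: part_t.
have RSS : R `+` S `+` S `<=` R `+` S.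
  apply/fsubsetP => _ /fsumP[_ [s' [/fsumP[x [s [xR sS ->]]] s'S ->]]].
  have [xT xt] : x \in T /\ ~~ P (x - t) by move: xR; rewrite !inE => /andP[].
  have pxR : part x `<=` R.
    apply/fsubsetP => y; rewrite !inE /= => /andP[yT yx]; rewrite yT /=.
    apply: contra xt => yt; have -> : x - t = (y - t) - (y - x) by zmod.
    exact: PB.
  have px0 : part x != fset0 by apply/fset0Pn; exists x; apply: part_t.
  have [xst|xS] := boolP (S `<=` fstab (part x `+` S)).
    have : x + s + s' \in part x `+` S `+` S by rewrite !mem_fsum ?part_t.
    rewrite (fstab_fsum (fsum_eq0 px0 SN0) S0 xst).
    by apply: (fsubsetP (fsumS pxR (fsubset_refl S))).
  pose R' := R `\` part x.
  have RE : R = part x `|` R'.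
    by rewrite fsetUDl fsetDv fsetD0; apply/esym/fsetUidPr.
  have cR : (#|` R| = #|` part x| + #|` R'|)%N.
    by rewrite cardfsDS // subnKC // fsubset_leq_card.
  have cRS : (#|` R `+` S| = #|` part x `+` S| + #|` R' `+` S|)%N.
    rewrite {1}RE fsumUl -cardfsUI (dj _ _ x) ?cardfs0 ?addn0 // => y.
      by rewrite !inE => /andP[].
    rewrite in_fsetD => /andP[yx yR]; apply: contra yx => yx.
    by move: yR; rewrite !inE /= => /andP[-> _].
  have := half _ tT tS; have := half _ xT xS.
  by have := fsubset_leq_card (fsub_fsum R' S0); nlia.
have PR (X : {fset V}) : X != fset0 -> X `+` S `<=` X ->
    forall k, P k -> k \in fstab X.
  move=> X0 XS k; apply: Pmin; first exact: fstab_subgroup.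
  exact: sub_fstab.
have ptS0 : part t `+` S != fset0 by apply: fsum_eq0.
(* A period of the exceptional part lies in [P], so it is also a period of the stable rest and hence
   of T + S. Kneser's bound for that part then leaves no gain to [R]. *)
have apt : faperiodic (part t `+` S).
  move=> l lL; apply: apST.
  have Pl : P l.
    have := lL; rewrite mem_fstab // => /eqP lE.
    have ptSP z : z \in part t `+` S -> P (z - t).
      move=> /fsumP[x [s [+ sS ->]]]; rewrite !inE /= => /andP[_ xt].
      by have -> : x + s - t = x - t + s by [zmod]; apply: PD => //; apply: SP.
    have tt : t + 0 \in part t `+` S by rewrite mem_fsum ?part_t.
    have : l + (t + 0) \in part t `+` S by rewrite -[in X in _ \in X]lE mem_fsum ?fset11.
    move=> /ptSP; have -> : l + (t + 0) - t = l by zmod.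
    by [].
  rewrite mem_fstab // TE fsumUl fsumUr; move: lL; rewrite mem_fstab // => /eqP ->.
  have [->|R0] := eqVneq R fset0; first by rewrite ![fset0 `+` S]fsumC fsum_set0 fsum_set0.
  have RS0 : R `+` S != fset0 by apply: fsum_eq0.
  by have := PR _ RS0 RSS l Pl; rewrite mem_fstab // => /eqP ->.
have RS : R `+` S `<=` R.
  have := kneser_aperiodic pt0 SN0 apt => kn.
  have : R == R `+` S by rewrite eqEfcard fsub_fsum //=; nlia.
  by move=> /eqP <-.
move=> x k xT xt Pk; have xR : x \in R by rewrite !inE /= xT.
have R0 : R != fset0 by apply/fset0Pn; exists x.
have := PR _ R0 RS k Pk; rewrite mem_fstab // => /eqP kR.
by rewrite TE in_fsetU; apply/orP; right; rewrite -kR addrC mem_fsum ?fset11.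
Qed.

(** S - C misses -T, which bounds its size by |S| + |C| - 1; Kneser's theorem gives the reverse
    inequality once S - C is aperiodic. *)
Lemma dual_pair (V : zmodType) (S T W : {fset V}) : (forall x, x \in W) ->
  S != fset0 -> T != fset0 -> (exists z, z \notin S `+` T) ->
  faperiodic (S `+` T) -> (#|` S `+` T| + 1 = #|` S| + #|` T|)%N ->
  let C := W `\` (S `+` T) in
  [/\ S `+` fopp C = W `\` fopp T, faperiodic (S `+` fopp C)
    & (#|` S `+` fopp C| + 1 = #|` S| + #|` C|)%N].
Proof.
move=> Wf S0 T0 [z zST] apST cST C.
have ST0 : S `+` T != fset0 by apply: fsum_eq0.
have CE x : (x \in C) = (x \notin S `+` T) by rewrite in_fsetD Wf andbT.
have C0 : fopp C != fset0.
  by rewrite fopp_eq0; apply/fset0Pn; exists z; rewrite CE.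
have SC0 : S `+` fopp C != fset0 by apply: fsum_eq0.
have sub : S `+` fopp C `<=` W `\` fopp T.
  apply/fsubsetP => x /fsumP[s [c [sS]]]; rewrite mem_fopp CE => cC xE.
  rewrite in_fsetD Wf andbT mem_fopp; apply: contra cC => xT.
  by have -> : - c = s + - x by [rewrite xE; zmod]; apply: mem_fsum.
have subW (X : {fset V}) : X `<=` W by apply/fsubsetP => x _.
have cC : (#|` C| + #|` S `+` T| = #|` W|)%N.
  by rewrite cardfsDS // subnK // fsubset_leq_card.
have cT : (#|` W `\` fopp T| + #|` T| = #|` W|)%N.
  by rewrite cardfsDS // card_fopp subnK // -(card_fopp T) fsubset_leq_card.
have ap : faperiodic (S `+` fopp C).
  move=> k kK; apply: apST; set K := fstab (S `+` fopp C) in kK.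
  have gK : fsubgroup K := fstab_subgroup SC0.
  (* [T'] is the largest set with S + T' = S + T. It inherits the periods of S - C and passes them
     on to S + T. *)
  pose T' := [fset x in W | - x \notin S `+` fopp C].
  have TT' : T `<=` T'.
    apply/fsubsetP => x xT; rewrite !inE /= Wf /=; apply/negP => /(fsubsetP sub).
    by rewrite in_fsetD mem_fopp opprK xT.
  have T'0 : T' != fset0 by apply: fsubset_neq0 T0.
  have T'K : T' `+` K `<=` T'.
    apply/fsubsetP => _ /fsumP[x [l [+ lK ->]]]; rewrite !inE /= !Wf /=.
    apply: contra => xl; have -> : - x = - (x + l) + l by zmod.
    by rewrite -(fsum_fstab SC0) mem_fsum.
  have -> : S `+` T = S `+` T'.
    apply/eqP; rewrite eqEfsubset fsumS //=; apply/fsubsetP => y.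
    move=> /fsumP[s [x [sS + ->]]]; rewrite !inE /= Wf /= => xSC.
    apply/negPn; rewrite -CE; apply: contra xSC => sxC.
    have -> : - x = s + - (s + x) by zmod.
    by rewrite mem_fsum // mem_fopp opprK.
  rewrite fsumC; apply: (fsubsetP (fstab_fsuml T'0 S0)).
  exact: (fsubsetP (sub_fstab T'0 T'K)).
have := kneser_aperiodic S0 C0 ap; rewrite card_fopp => kn.
have := fsubset_leq_card sub => le.
by split => //; [apply/eqP; rewrite eqEfcard sub /=; nlia | nlia].
Qed.

End QuasiPeriodic.

(** * Fibres over the quotient by a hyper-atom *)

Section Fibers.
Local Open Scope fset_scope.
Local Open Scope ring_scope.
Variables (G Q : zmodType) (p : {additive G -> Q}) (H : {fset G}).
Hypothesis p_surj : forall z, exists x, p x = z.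
Hypothesis p_ker : forall x, (x \in H) = (p x == 0).
Implicit Types (X Y : {fset G}) (z : Q).

Definition proj X : {fset Q} := [fset p x | x in X].
Definition fib X z : {fset G} := [fset x in X | p x == z].

Lemma ker_subgroup : fsubgroup H.
Proof.
split=> [|x y]; first by rewrite p_ker raddf0.
by rewrite !p_ker raddfB => /eqP -> /eqP ->; rewrite subrr.
Qed.

Lemma projP X z : reflect (exists2 x, x \in X & z = p x) (z \in proj X).
Proof. by apply: (iffP (imfsetP _ _ _ _)). Qed.

Lemma mem_proj X x : x \in X -> p x \in proj X.
Proof. by move=> xX; apply/projP; exists x. Qed.

Lemma in_fib X z x : (x \in fib X z) = (x \in X) && (p x == z).
Proof. by rewrite !inE. Qed.

Lemma fib_sub X z : fib X z `<=` X.
Proof. by apply/fsubsetP => x; rewrite in_fib => /andP[]. Qed.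

Lemma fib_neq0 X z : (fib X z != fset0) = (z \in proj X).
Proof.
apply/fset0Pn/projP => [[x]|[x xX ->]]; last by exists x; rewrite in_fib xX eqxx.
by rewrite in_fib => /andP[xX /eqP <-]; exists x.
Qed.

Lemma fib_subset X Y z : X `<=` Y -> fib X z `<=` fib Y z.
Proof.
by move=> XY; apply/fsubsetP => x; rewrite !in_fib => /andP[/(fsubsetP XY)->].
Qed.

Lemma proj_fsum X Y : proj (X `+` Y) = proj X `+` proj Y.
Proof.
apply/fsetP => z; apply/projP/fsumP.
  by move=> [_ /fsumP[x [y [xX yY ->]]] ->]; exists (p x), (p y);
    rewrite !mem_proj // raddfD.
move=> [_ [_ [/projP[x xX ->] /projP[y yY ->] ->]]].
by exists (x + y); rewrite ?mem_fsum ?raddfD.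
Qed.

Lemma proj_fopp X : proj (fopp X) = fopp (proj X).
Proof.
apply/fsetP => z; rewrite mem_fopp; apply/projP/projP => -[x].
  by rewrite mem_fopp => xX ->; exists (- x); rewrite // raddfN.
by move=> xX zE; exists (- x); rewrite ?mem_fopp ?opprK // raddfN -zE opprK.
Qed.

Lemma proj_neq0 X : X != fset0 -> proj X != fset0.
Proof. by move=> /fset0Pn[x xX]; apply/fset0Pn; exists (p x); apply: mem_proj. Qed.

Lemma fibU X Y z : fib (X `|` Y) z = fib X z `|` fib Y z.
Proof. by apply/fsetP => x; rewrite in_fsetU !in_fib in_fsetU andb_orl. Qed.

Lemma fib_coset X (x : G) : fib X (p x) `<=` [fset x] `+` H.
Proof.
apply/fsubsetP => y; rewrite in_fib mem_fsum1 p_ker raddfB => /andP[_ /eqP ->].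
by rewrite subrr.
Qed.

Lemma fib_full (x : G) : fib ([fset x] `+` H) (p x) = [fset x] `+` H.
Proof.
apply/eqP; rewrite eqEfsubset fib_sub; apply/fsubsetP => y yxH.
rewrite in_fib yxH /=; move: yxH.
by rewrite mem_fsum1 p_ker raddfB subr_eq0.
Qed.

Lemma card_fib_le X z : (#|` fib X z| <= #|` H|)%N.
Proof.
have [x <-] := p_surj z.
by have := fsubset_leq_card (fib_coset X x); rewrite card_fsum1.
Qed.

Lemma fib_out X z : z \notin proj X -> fib X z = fset0.
Proof. by rewrite -fib_neq0 negbK => /eqP. Qed.

Lemma card_sum_fib X (Z : {fset Q}) : proj X `<=` Z ->
  (\sum_(z <- Z) #|` fib X z| = #|` X|)%N.
Proof.
move=> XZ; rewrite -(big_fset_incl _ XZ); last first.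
  by move=> z _ zX; rewrite fib_out.
rewrite -[RHS]sum1_fset (partition_big_imfset _ p) /=.
by apply: eq_bigr => z _; rewrite big_fset_condE sum1_fset.
Qed.

Lemma big_fsum1 (A : {fset Q}) (i : Q) (F : Q -> nat) :
  (\sum_(z <- [fset i] `+` A) F z = \sum_(j <- A) F (i + j)%R)%N.
Proof.
have -> : [fset i] `+` A = [fset i + a | a in A].
  apply/fsetP => y; rewrite mem_fsum1; apply/idP/imfsetP => [yA|[a aA ->]].
    by exists (y - i) => //; zmod.
  by have -> : i + a - i = a by zmod.
by rewrite big_imfset //= => x y _ _; apply: addrI.
Qed.

Lemma card_fib_shift X (A : {fset Q}) (i : Q) : proj X `<=` [fset i] `+` A ->
  #|` X| = (\sum_(j <- A) #|` fib X (i + j)%R|)%N.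
Proof. by move=> /card_sum_fib <-; rewrite big_fsum1. Qed.

Lemma leq_fib_fsum X Y i j : j \in proj Y ->
  (#|` fib X i| <= #|` fib (X `+` Y) (i + j)|)%N.
Proof.
move=> /projP[y yY ->]; rewrite -(card_fsum1 y); apply: fsubset_leq_card.
apply/fsubsetP => z; rewrite mem_fsum1 !in_fib => /andP[zX /eqP zi].
have -> : z = z - y + y by zmod.
by rewrite mem_fsum //= raddfD zi.
Qed.

(** Pigeonhole: for z in the target coset, X_i and z - Y_j lie in one [H]-coset and are too large to
    be disjoint. *)
Lemma fib_fsum_full X Y i j : (#|` H| < #|` fib X i| + #|` fib Y j|)%N ->
  #|` fib (X `+` Y) (i + j)| = #|` H|.
Proof.
have [xi <-] := p_surj i; have [yj <-] := p_surj j => lt.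
apply/eqP; rewrite eqn_leq card_fib_le /= -raddfD -(card_fsum1 (xi + yj)).
apply: fsubset_leq_card; apply/fsubsetP => z zH.
have pz : p z = p xi + p yj.
  by move: zH; rewrite mem_fsum1 p_ker raddfB raddfD subr_eq0 => /eqP.
rewrite in_fib pz raddfD eqxx andbT.
pose Y' := [fset z] `+` fopp (fib Y (p yj)).
have Y'H : Y' `<=` [fset xi] `+` H.
  apply/fsubsetP => w; rewrite !mem_fsum1 mem_fopp in_fib => /andP[_ /eqP pw].
  rewrite p_ker raddfB; have -> : w = z - (- (w - z)) by zmod.
  by rewrite raddfB pw pz addrK subrr.
have : fib X (p xi) `|` Y' `<=` [fset xi] `+` H by rewrite fsubUset fib_coset.
move/fsubset_leq_card; have := cardfsUI (fib X (p xi)) Y'.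
rewrite !card_fsum1 card_fopp => cU leU.
have /fset0Pn[x] : fib X (p xi) `&` Y' != fset0 by rewrite -cardfs_gt0; nlia.
rewrite in_fsetI mem_fsum1 mem_fopp !in_fib => /andP[/andP[xX _] /andP[yY _]].
by have -> : z = x + - (x - z) by [zmod]; apply: mem_fsum.
Qed.

Lemma fib_full_mem X x : #|` fib X (p x)| = #|` H| -> x \in X.
Proof.
move=> cX; apply: (fsubsetP (fib_sub X (p x))).
suff -> : fib X (p x) = [fset x] `+` H.
  by rewrite mem_fsum1 subrr (proj1 ker_subgroup).
by apply/eqP; rewrite eqEfcard fib_coset card_fsum1 cX leqnn.
Qed.

Lemma card_fsum_ker X : #|` X `+` H| = (#|` proj X| * #|` H|)%N.
Proof.
have pXH : proj (X `+` H) `<=` proj X.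
  apply/fsubsetP => z; rewrite proj_fsum => /fsumP[a [b [aX /projP[k kH ->] ->]]].
  by move: kH; rewrite p_ker => /eqP ->; rewrite addr0.
rewrite -(card_sum_fib pXH) mulnC -sum_nat_fset big_seq [RHS]big_seq.
apply: eq_bigr => _ /projP[x xX ->]; apply/eqP; rewrite eqn_leq card_fib_le /=.
rewrite -(card_fsum1 x H) -fib_full.
by apply/fsubset_leq_card/fib_subset/fsumS; rewrite ?fsub1set.
Qed.

Lemma fib_fopp X z : fib (fopp X) z = fopp (fib X (- z)).
Proof.
apply/fsetP => y; rewrite mem_fopp !in_fib mem_fopp raddfN.
by rewrite (inj_eq oppr_inj).
Qed.

End Fibers.

(** * Counting holes of a critical sum modulo a hyper-atom *)

Section Core.
Local Open Scope fset_scope.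
Local Open Scope ring_scope.
Variables (G Q : zmodType) (p : {additive G -> Q}) (H S : {fset G}) (q : nat).
Hypothesis p_surj : forall z, exists x, p x = z.
Hypothesis p_ker : forall x, (x \in H) = (p x == 0).
Let A := proj p S.
Hypothesis cA : #|` A| = q.+1.
Hypothesis q_gt0 : (0 < q)%N.
(* [kap] and [ltS]: H is a 1-fragment of S with kappa_1(S) = q |H| <= |S| - 1. *)
Hypothesis kap : forall Y : {fset G}, Y != fset0 -> (exists z, z \notin Y `+` S) ->
  (#|` Y| + q * #|` H| <= #|` Y `+` S|)%N.
Hypothesis ltS : (q * #|` H| < #|` S|)%N.
Hypothesis gA : expanding A.

Local Notation h := #|` H|.
Local Notation w := (fun X z => #|` fib p X z|).

Lemma core_A0 : A != fset0. Proof. by rewrite -cardfs_gt0 cA. Qed.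

Lemma core_S0 : S != fset0. Proof. by rewrite -cardfs_gt0; nlia. Qed.

Lemma core_h0 : (0 < h)%N. Proof. exact: fsubgroup_gt0 (ker_subgroup p_ker). Qed.

Lemma core_cS : (\sum_(j <- A) w S j = #|` S|)%N.
Proof. by apply: card_sum_fib. Qed.

Lemma core_S_le : (#|` S| <= q.+1 * h)%N.
Proof.
rewrite -core_cS -cA mulnC -sum_nat_fset; apply: leq_sum => j _.
exact: card_fib_le.
Qed.

Lemma core_s_pos (j : Q) : j \in A -> (0 < w S j)%N.
Proof. by rewrite cardfs_gt0 fib_neq0. Qed.

Lemma core_A_aperiodic : (exists z, z \notin A) -> faperiodic A.
Proof.
move=> zA; have z0 : [fset 0] != fset0 :> {fset Q} by rewrite -cardfs_gt0 cardfs1.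
have A0E : A `+` [fset 0] = A by rewrite fsumC fsum0.
have := expanding_or gA core_A0 z0; rewrite A0E cardfs1 => /(_ zA)[|//].
by nlia.
Qed.

Section Pair.
Variable T : {fset G}.
Let B := proj p T.
Hypothesis cST : (#|` S `+` T| + 1 = #|` S| + #|` T|)%N.
Hypothesis apST : faperiodic (S `+` T).
Hypothesis outST : exists z, z \notin S `+` T.
Hypothesis leST : (#|` S| <= #|` T|)%N.
Local Notation g := (fun z => (h - w (S `+` T) z)%N).

Lemma core_T0 : T != fset0.
Proof. by have := core_S0; rewrite -!cardfs_gt0; have := leST; nlia. Qed.

Lemma core_B0 : B != fset0. Proof. exact: proj_neq0 core_T0. Qed.

Lemma core_cT : (\sum_(i <- B) w T i = #|` T|)%N.
Proof. exact: card_sum_fib. Qed.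

Lemma core_sum_g : (\sum_(z <- B `+` A) g z + #|` S `+` T| = h * #|` B `+` A|)%N.
Proof.
rewrite -(@card_sum_fib _ _ p (S `+` T) (B `+` A)); last by rewrite proj_fsum fsumC.
rewrite -big_split -sum_nat_fset; apply: eq_bigr => z _.
by rewrite /= subnK // card_fib_le.
Qed.

Lemma core_master (i : Q) : i \in B ->
  (w T i + \sum_(j <- A) g (i + j)%R <= h)%N.
Proof.
move=> iB; have Y0 : fib p T i != fset0 by rewrite fib_neq0.
have outY : exists z, z \notin fib p T i `+` S.
  case: outST => z zST; exists z; apply: contra zST; rewrite fsumC.
  by apply: (fsubsetP (fsumS (fsubset_refl S) (fib_sub _ _ _))).
have := kap Y0 outY.
have pY : proj p (fib p T i `+` S) `<=` [fset i] `+` A.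
  rewrite proj_fsum; apply: fsumS => //; apply/fsubsetP => z /projP[x].
  by rewrite in_fib => /andP[_ /eqP ->] ->; rewrite fset11.
rewrite (card_fib_shift pY) => le1.
have : (\sum_(j <- A) w (fib p T i `+` S) (i + j)%R + \sum_(j <- A) g (i + j)%R
        <= q.+1 * h)%N.
  rewrite -cA mulnC -sum_nat_fset -big_split; apply: leq_sum => j _ /=.
  have := card_fib_le p_surj p_ker (S `+` T) (i + j).
  have : fib p (fib p T i `+` S) (i + j) `<=` fib p (S `+` T) (i + j).
    by apply: fib_subset; rewrite [S `+` T]fsumC; apply: fsumS => //; apply: fib_sub.
  by move/fsubset_leq_card; nlia.
by rewrite mulSn; nlia.
Qed.

Lemma core_master_sum :
  (#|` T| + \sum_(z <- B `+` A) g z * repr_count B A z <= #|` B| * h)%N.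
Proof.
rewrite -sum_fsum -core_cT -big_split mulnC -sum_nat_fset big_seq [leqRHS]big_seq.
by apply: leq_sum => i iB; apply: core_master.
Qed.

(** Every hole is counted at least once in [core_master_sum], so h|A + B| <= h|B| + |S| - 1, which
    is less than h(|B| + q + 1). *)
Lemma core_upper : (#|` B `+` A| <= #|` B| + q)%N.
Proof.
have := core_master_sum; have := core_sum_g; have := core_S_le.
have : (\sum_(z <- B `+` A) g z <= \sum_(z <- B `+` A) g z * repr_count B A z)%N.
  rewrite big_seq [leqRHS]big_seq; apply: leq_sum => z zBA.
  by rewrite -[leqLHS]muln1 leq_mul2l repr_count_gt0 ?orbT.
move=> le1 le2 eq1 le3; rewrite -ltnS -addnS -(ltn_pmul2l core_h0) mulnDr.
by move: cST le2 eq1 le3 le1; rewrite ![(_ * h)%N]mulnC; nlia.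
Qed.

Let E := [fset z in B `+` A | (w (S `+` T) z < h)%N].
Let P := (B `+` A) `\` E.
Let r (i : Q) := #|` [fset z in E | (z - i)%R \in A]|.

(** [kap] is applied to -C, where C is the set of holes over [z]: the sum -C + S avoids -T, so the
    fibres of [T] over z - A fit beside it. *)
Lemma core_dual (z : Q) : z \in E ->
  (g z + \sum_(j <- A) w T (z - j)%R <= h)%N.
Proof.
rewrite !inE /= => /andP[zBA zE]; have [x xz] := p_surj z.
pose C := ([fset x] `+` H) `\` fib p (S `+` T) z.
have fx : fib p (S `+` T) z `<=` [fset x] `+` H by rewrite -xz; apply: fib_coset.
have cC : #|` C| = g z by rewrite cardfsDS // card_fsum1.
have CP c : c \in C -> p c = z /\ c \notin S `+` T.
  rewrite in_fsetD -(fib_full p_ker) !in_fib xz => /andP[cNS /andP[_ /eqP pc]].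
  by split => //; move: cNS; rewrite pc eqxx andbT.
have C0 : fopp C != fset0 by rewrite -cardfs_gt0 card_fopp cC subn_gt0.
have dis t : t \in T -> - t \notin fopp C `+` S.
  move=> tT; apply/negP => /fsumP[c [s [+ sS tE]]]; rewrite mem_fopp => /CP[_].
  by case/negP; have -> : - c = s + t by [rewrite -[t]opprK tE; zmod]; apply: mem_fsum.
have outY : exists y, y \notin fopp C `+` S.
  by have [t tT] := fset0Pn _ core_T0; exists (- t); apply: dis.
have := kap C0 outY; rewrite card_fopp cC.
have pY : proj p (fopp C `+` S) `<=` [fset - z] `+` A.
  rewrite proj_fsum proj_fopp; apply: fsumS => //; apply/fsubsetP => y.
  by rewrite mem_fopp in_fset1 => /projP[c /CP[-> _] <-]; rewrite opprK.
rewrite (card_fib_shift pY) => le1.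
have : (\sum_(j <- A) w (fopp C `+` S) (- z + j)%R + \sum_(j <- A) w T (z - j)%R
        <= q.+1 * h)%N.
  rewrite -cA mulnC -sum_nat_fset -big_split; apply: leq_sum => j _ /=.
  have -> : z - j = - (- z + j) by zmod.
  rewrite -(card_fopp (fib p T _)) -fib_fopp.
  have dd : fib p (fopp C `+` S) (- z + j) `&` fib p (fopp T) (- z + j) = fset0.
    apply/eqP; rewrite -fsubset0; apply/fsubsetP => y.
    rewrite in_fsetI !in_fib mem_fopp => /andP[/andP[yC _] /andP[yT _]].
    by have := dis _ yT; rewrite opprK yC.
  have := cardfsUI (fib p (fopp C `+` S) (- z + j)) (fib p (fopp T) (- z + j)).
  rewrite dd cardfs0 addn0 => <-; rewrite -fibU.
  exact: card_fib_le.
by rewrite mulSn; nlia.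
Qed.

Lemma core_dual_sum :
  (\sum_(z <- E) g z + \sum_(i <- B) w T i * r i <= #|` E| * h)%N.
Proof.
pose F i := (w T i * r i)%N.
have FB i : i \notin B -> F i = 0%N by move=> iB; rewrite /F fib_out ?cardfs0.
have FE i : i \notin E `+` fopp A -> F i = 0%N.
  move=> iE; rewrite /F; suff -> : r i = 0%N by rewrite muln0.
  apply/eqP; rewrite /r cardfs_eq0 -fsubset0; apply/fsubsetP => z.
  rewrite !inE /= => /andP[zE ziA]; case/negP: iE.
  have -> : i = z + - (z - i) by zmod.
  by rewrite mem_fsum ?mem_fopp ?opprK // !inE.
have -> : (\sum_(i <- B) w T i * r i = \sum_(i <- E `+` fopp A) F i)%N.
  rewrite (@big_fset_incl _ _ _ _ B (B `|` (E `+` fopp A)) F) ?fsubsetUl //.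
    by rewrite -(@big_fset_incl _ _ _ _ (E `+` fopp A) _ F) ?fsubsetUr // => i _ /FE.
  by move=> i _ /FB.
have -> : (\sum_(i <- E `+` fopp A) F i =
           \sum_(z <- E) \sum_(j <- fopp A) w T (z + j)%R)%N.
  rewrite (sum_fsum E (fopp A) (w T)); apply: eq_bigr => i _.
  congr (_ * #|` _|)%N; apply/fsetP => z; rewrite !inE /= mem_fopp.
  by have -> : - (i - z) = z - i by zmod.
rewrite -big_split mulnC -sum_nat_fset big_seq [leqRHS]big_seq.
apply: leq_sum => z zE /=.
have -> : (\sum_(j <- fopp A) w T (z + j)%R = \sum_(j <- A) w T (z - j)%R)%N.
  by rewrite big_imfset //= => x y _ _; apply: oppr_inj.
exact: core_dual.
Qed.

Lemma core_E_sub : E `<=` B `+` A. Proof. exact: fset_sub. Qed.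

Lemma core_total : (#|` P| * h + \sum_(i <- B) w T i * r i < #|` S| + #|` T|)%N.
Proof.
have sE : (\sum_(z <- E) g z = \sum_(z <- B `+` A) g z)%N.
  apply: big_fset_incl core_E_sub _ => z zBA; rewrite !inE /= zBA -leqNgt.
  by rewrite -subn_eq0 => /eqP.
have cP : (#|` P| + #|` E| = #|` B `+` A|)%N.
  by rewrite /P cardfsDS ?core_E_sub // subnK // fsubset_leq_card ?core_E_sub.
have := core_dual_sum; have := core_sum_g; rewrite sE -cP mulnDr.
rewrite [(h * #|` P|)%N]mulnC [(h * #|` E|)%N]mulnC.
by have := cST; nlia.
Qed.

Lemma core_r i : r i = #|` ([fset i] `+` A) `&` E|.
Proof.
rewrite /r; congr #|` _|; apply/fsetP => z.
by rewrite in_fsetI mem_fsum1 andbC !inE.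
Qed.

Lemma core_shift_split i : i \in B ->
  (r i + #|` ([fset i] `+` A) `&` P| = q.+1)%N.
Proof.
move=> iB; rewrite core_r -cA -(card_fsum1 i A) -[RHS](cardfsID E).
congr (_ + #|` _|)%N; rewrite /P fsetIDA; congr (_ `\` _); apply/fsetIidPl.
by apply: fsumS => //; rewrite fsub1set.
Qed.

(** Otherwise a missing point of the fibre could be added to [T] without changing S + T, against
    Kneser's bound. *)
Lemma core_r_pos i : i \in B -> (w T i < h)%N -> (0 < r i)%N.
Proof.
move=> iB iT; rewrite lt0n; apply/negP => /eqP ri.
have full j : j \in A -> w (S `+` T) (i + j) = h.
  move=> jA; apply/eqP; rewrite eqn_leq card_fib_le //= leqNgt; apply/negP => ijE.
  move: ri => /cardfs0_eq /fsetP/(_ (i + j)); rewrite !inE /= mem_fsum // ijE /=.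
  by have -> : i + j - i = j by [zmod]; rewrite jA.
have /projP[x xT xi] := iB.
have /fsubsetPn[y yx yT] : ~~ ([fset x] `+` H `<=` fib p T i).
  by apply/negP => /fsubset_leq_card; rewrite card_fsum1 leqNgt iT.
have py : p y = i by move: yx; rewrite mem_fsum1 p_ker raddfB subr_eq0 -xi => /eqP.
have {}yT : y \notin T by move: yT; rewrite in_fib py eqxx andbT.
have ST' : S `+` (y |` T) = S `+` T.
  apply/eqP; rewrite eqEfsubset fsumUr fsubsetUr andbT fsubUset fsubset_refl andbT.
  apply/fsubsetP => _ /fsumP[s [_ [sS /fset1P -> ->]]].
  by apply: (fib_full_mem p_ker); rewrite raddfD py addrC full // mem_proj.
have y0 : y |` T != fset0 by apply/fset0Pn; exists y; rewrite fset1U1.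
have := kneser_aperiodic core_S0 y0; rewrite ST' cardfsU1 yT => /(_ apST).
by have := cST; nlia.
Qed.

(* Otherwise the master inequality for the complement of S + T, summed over the
   incomplete cosets, forces q = 1 and a contradiction between the two fibres. *)
Lemma core_full_fiber : (exists z, z \notin A) -> exists2 i, i \in B & w T i = h.
Proof.
move=> zA; apply: contrapT => nofull.
have ltT i : i \in B -> (w T i < h)%N.
  move=> iB; rewrite ltn_neqAle card_fib_le // andbT; apply/eqP => iT.
  by apply: nofull; exists i.
have rpos i : i \in B -> (0 < r i)%N by move=> iB; apply: core_r_pos => //; apply: ltT.
have leP i : i \in B -> (#|` ([fset i] `+` A) `&` P| <= #|` P|)%N.
  by move=> _; apply: fsubset_leq_card; apply: fsubsetIr.
have total := core_total.
have sumT c : (forall i, i \in B -> (c <= r i)%N) ->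
    (c * #|` T| <= \sum_(i <- B) w T i * r i)%N.
  move=> cr; rewrite -core_cT big_distrr big_seq [leqRHS]big_seq /=.
  by apply: leq_sum => i iB; rewrite mulnC leq_mul2l cr ?orbT.
(* All r_i >= 1 gives |P|h < |S| <= (q+1)h by [core_total]. If |P| < q, all r_i would be at least 2,
   and 2|T| < |S| + |T| contradicts |S| <= |T|. *)
have cP : #|` P| = q.
  apply/eqP; rewrite eqn_leq; apply/andP; split.
    have := sumT 1%N rpos; rewrite mul1n => le1.
    rewrite -ltnS -(ltn_pmul2r core_h0); apply: leq_trans core_S_le.
    by move: total le1; nlia.
  rewrite leqNgt; apply/negP => Pq.
  have := sumT 2%N; have : forall i, i \in B -> (2 <= r i)%N.
    by move=> i iB; have := core_shift_split iB; have := leP i iB; nlia.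
  by move=> r2 /(_ r2); have := total; have := leST; nlia.
(* Comparing [core_total] with r_i >= 2 outside [Z] shows that the fibres over [Z] have total size
   more than qh. *)
pose Z := [fset i in B | r i == 1%N].
have ZB i : i \in Z -> i \in B /\ r i = 1%N by rewrite !inE /= => /andP[? /eqP].
have sumZ : (q * h < \sum_(i <- Z) w T i)%N.
  have eZ : (\sum_(i <- B) w T i * r i + \sum_(i <- Z) w T i >= 2 * #|` T|)%N.
    have -> : (\sum_(i <- Z) w T i = \sum_(i <- B) w T i * (r i == 1))%N.
      rewrite -big_fset_condE big_mkcond; apply: eq_bigr => i _.
      by case: eqP => _; rewrite ?muln1 ?muln0.
    rewrite -big_split -core_cT big_distrr big_seq [leqRHS]big_seq /=.
    apply: leq_sum => i /rpos; rewrite -mulnDr mulnC => ri.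
    by rewrite leq_mul2l; apply/orP; right; case: eqP; lia.
  by move: total eZ leST; rewrite cP; nlia.
have ZS i : i \in Z -> exists j, [/\ j \in A, i + j \notin P & (w T i + w S j <= h)%N].
  move=> /ZB[iB ri]; have /fset0Pn[z] : [fset z in E | (z - i)%R \in A] != fset0.
    by rewrite -cardfs_gt0 -/(r i) ri.
  rewrite !inE /= => /andP[zE ziA]; exists (z - i); split => //.
    have -> : i + (z - i) = z by zmod.
    by rewrite in_fsetD negb_and negbK !inE zE.
  rewrite leqNgt; apply/negP; rewrite addnC => /(fib_fsum_full p_surj p_ker).
  have -> : z - i + i = z by zmod.
  by move=> zh; case/andP: zE => _; rewrite zh ltnn.
have cZ : (q < #|` Z|)%N.
  have le : (\sum_(i <- Z) w T i <= (h - 1) * #|` Z|)%N.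
    rewrite -sum_nat_fset big_seq [leqRHS]big_seq; apply: leq_sum => i.
    move=> /ZS[j [jA _]]; have := core_s_pos jA; nlia.
  rewrite ltnNge; apply/negP => Zq; have := sumZ; rewrite ltnNge => /negP; apply.
  apply: leq_trans le _; rewrite mulnC.
  by apply: leq_mul => //; apply: leq_subr.
(* For i in [Z], i + A contains q complete cosets, that is all of [P]. Hence Z = a - A for every a
   in [P], and two such a would differ by a period of [A]. *)
have PZ i a : i \in Z -> a \in P -> a - i \in A.
  move=> /ZB[iB ri] aP; rewrite -mem_fsum1.
  have /fsetP/(_ a) : ([fset i] `+` A) `&` P = P.
    apply/eqP; rewrite eqEfcard fsubsetIr /= cP.
    by have := core_shift_split iB; rewrite ri; nlia.
  by rewrite in_fsetI aP andbT.
have ZE a : a \in P -> Z = [fset a] `+` fopp A.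
  move=> aP; apply/eqP; rewrite eqEfcard card_fsum1 card_fopp cA cZ andbT.
  apply/fsubsetP => i iZ; rewrite mem_fsum1 mem_fopp.
  by have -> : - (i - a) = a - i by [zmod]; apply: PZ.
have q1 : q = 1%N.
  apply/eqP; rewrite eqn_leq q_gt0 andbT -cP leqNgt; apply/negP => /card_gt1P.
  move=> [a [b [ab aP bP]]]; case/eqP: ab; apply/eqP; rewrite -subr_eq0; apply/eqP.
  apply: (core_A_aperiodic zA).
  rewrite -(fstab_opp core_A0) mem_fstab ?fopp_eq0 ?core_A0 //.
  have -> : [fset a - b] `+` fopp A = [fset - b] `+` ([fset a] `+` fopp A).
    by rewrite fsumA fsum1_fset1 [- b + a]addrC.
  by rewrite -ZE // (ZE b) // fsumA fsum1_fset1 addNr fsum0.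
have /fset0Pn[a aP] : P != fset0 by rewrite -cardfs_gt0 cP q1.
have PE : P = [fset a].
  by apply/esym/eqP; rewrite eqEfcard fsub1set aP cardfs1 cP q1.
have [j [k [jk jA kA]]] : exists j k, [/\ j != k, j \in A & k \in A].
  by apply: card_gt1P; rewrite cA q1.
have AE : A = [fset j; k].
  by apply/esym/eqP; rewrite eqEfcard fsubUset !fsub1set jA kA cardfs2 jk cA q1.
have aZ l : l \in A -> a - l \in Z.
  move=> lA; rewrite (ZE a) // mem_fsum1 mem_fopp.
  by have -> : - (a - l - a) = l by zmod.
(* Over (a - l) + A the coset [a] is complete, so the incomplete one belongs to the other element of
   [A]. Adding both inequalities gives at most 2h for the fibres over [Z] plus |S|, while each of
   these two exceeds h. *)
have other l m : A = [fset l; m] -> (w T (a - l)%R + w S m <= h)%N.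
  move=> AE'; have lA : l \in A by rewrite AE' fset21.
  have [m' [m'A m'P le]] := ZS _ (aZ l lA).
  move: m'A; rewrite AE' in_fset2 => /orP[]/eqP m'E; last by rewrite -m'E.
  by case/negP: m'P; rewrite PE m'E in_fset1 subrK.
have := other j k AE; have := other k j; rewrite AE fsetUC => /(_ erefl).
have ajk : a - j != a - k by rewrite (inj_eq (addrI a)) eqr_opp.
have ZE2 : Z = [fset a - j; a - k].
  apply/esym/eqP; rewrite eqEfcard fsubUset !fsub1set !aZ //= cardfs2 ajk.
  by rewrite (ZE a) // card_fsum1 card_fopp cA q1.
have := sumZ; rewrite ZE2 big_fsetU1 ?in_fset1 //= big_seq_fset1.
have := core_cS; rewrite AE big_fsetU1 ?in_fset1 //= big_seq_fset1.
by have := ltS; rewrite q1 mul1n; nlia.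
Qed.

Lemma core_card_sum : (exists z, z \notin B `+` A) ->
  #|` B `+` A| = (#|` B| + q)%N.
Proof.
rewrite fsumC => out; have := expanding_kappa gA core_A0 core_B0 out.
by have := core_upper; rewrite fsumC cA; nlia.
Qed.

(** A single full fibre would make S + T periodic under [H]; then [H] is trivial and |T| = 1 <
    |S|. *)
Lemma core_card_B : (exists z, z \notin A) -> (1 < #|` B|)%N.
Proof.
move=> zA; have [i iB iT] := core_full_fiber zA.
rewrite ltn_neqAle cardfs_gt0 core_B0 andbT eq_sym; apply/negP => /cardfs1P[i' Bi].
have {i'}Bi : B = [fset i] by move: iB; rewrite Bi => /fset1P ->.
have TH : T `+` H `<=` T.
  apply/fsubsetP => _ /fsumP[x [k [xT kH ->]]].
  have pxk : p (x + k) = i.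
    have /fset1P <- : p x \in [fset i] by rewrite -Bi mem_proj.
    by rewrite raddfD; move: kH; rewrite p_ker => /eqP ->; rewrite addr0.
  by apply: (fib_full_mem p_ker); rewrite pxk.
have h1 : h = 1%N.
  apply/eqP; rewrite eqn_leq core_h0 andbT leqNgt; apply/negP.
  move=> /(fsubgroup_gt1P (ker_subgroup p_ker))[k kH]; case/eqP; apply: apST.
  rewrite fsumC; apply: (fsubsetP (fstab_fsuml core_T0 core_S0)).
  exact: (fsubsetP (sub_fstab core_T0 TH)).
have := core_cT; rewrite Bi big_seq_fset1 iT h1.
by have := ltS; rewrite h1; have := leST; have := q_gt0; nlia.
Qed.

Lemma core_cover (z : Q) x : p x = z -> z \in B `+` A -> x \in S `+` T `+` H.
Proof.
move=> xz; rewrite fsumC -proj_fsum => /projP[y yST zy].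
by have -> : x = y + (x - y) by [zmod];
  rewrite mem_fsum // p_ker raddfB xz zy subrr.
Qed.

(* If S had no such direction, A + B would omit a single coset, every other
   coset having two representations, and S + T would be too large. *)
Lemma core_direction : (exists z, z \notin A) -> (exists z, z \notin B `+` A) ->
  (forall W : {fset G}, (forall x, x \in W) ->
     (#|` S| <= #|` W `\` (S `+` T)|)%N) ->
  exists2 d, d != 0 & (#|` A `|` ([fset d] `+` A)| <= #|` A| + 1)%N.
Proof.
move=> zA outAB hC; have cAB := core_card_sum outAB.
have cB := core_card_B zA; have [z0 z0AB] := outAB.
apply: contrapT => nd.
have {}nd d : d != 0 -> (#|` A| + 2 <= #|` A `|` ([fset d] `+` A)|)%N.
  by move=> d0; rewrite leqNgt; apply/negP => lt; apply: nd; exists d => //; lia.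
(* With two omitted cosets [B] would be critical for [A], and [expanding_progression] would provide
   the direction. *)
have z0_uniq z : z != z0 -> z \in B `+` A.
  move=> zz0; apply/negPn/negP => zAB; have A1 : (1 < #|` A|)%N by rewrite cA.
  have [|d d0 cd] := expanding_progression gA A1.
    exists B; split => //; first by rewrite fsumC cAB cA; nlia.
    by exists z, z0; rewrite fsumC.
  by have := nd d d0; nlia.
have full z : z \in z0 |` (B `+` A).
  by rewrite in_fset1U; case: eqVneq => //= /z0_uniq.
have Bz0 : B `&` ([fset z0] `+` fopp A) = fset0.
  apply/eqP; rewrite -fsubset0; apply/fsubsetP => i.
  rewrite in_fsetI mem_fsum1 mem_fopp => /andP[iB].
  have -> : - (i - z0) = z0 - i by zmod.
  move=> zi; case/negP: z0AB; have -> : z0 = i + (z0 - i) by zmod.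
  exact: mem_fsum.
have cover z : z \in B `|` ([fset z0] `+` fopp A).
  have -> : B `|` ([fset z0] `+` fopp A) = z0 |` (B `+` A); last exact: full.
  apply/eqP; rewrite eqEfcard; apply/andP; split.
    by apply/fsubsetP => y _; apply: full.
  have := cardfsUI B ([fset z0] `+` fopp A).
  rewrite Bz0 cardfs0 addn0 card_fsum1 card_fopp cA => ->.
  by rewrite cardfsU1 z0AB cAB; nlia.
(* As [B] is the complement of z0 - A, the representations of [z] correspond to the elements of z -
   A outside z0 - A; [nd] for the difference z - z0 yields two. *)
have rep2 z : z \in B `+` A -> (2 <= repr_count B A z)%N.
  move=> zAB; have zz0 : z - z0 != 0.
    by rewrite subr_eq0; apply: contraNneq z0AB => <-.
  have -> : repr_count B A z = #|` B `&` ([fset z] `+` fopp A)|.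
    congr #|` _|; apply/fsetP => i; rewrite in_fsetI mem_fsum1 mem_fopp !inE /=.
    by have -> : - (i - z) = z - i by zmod.
  have := nd _ zz0.
  rewrite -(card_fopp (_ `|` _)) -(card_fsum1 z (fopp _)).
  have -> : [fset z] `+` fopp (A `|` ([fset z - z0] `+` A)) =
      ([fset z] `+` fopp A) `|` ([fset z0] `+` fopp A).
    apply/fsetP => y; rewrite mem_fsum1 mem_fopp !in_fsetU !mem_fsum1 !mem_fopp.
    by have -> : - (y - z) - (z - z0) = - (y - z0) by zmod.
  have : ([fset z] `+` fopp A) `|` ([fset z0] `+` fopp A) `<=`
      (B `&` ([fset z] `+` fopp A)) `|` ([fset z0] `+` fopp A).
    rewrite fsubUset fsubsetUr andbT; apply/fsubsetP => y yz; have := cover y.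
    by rewrite !in_fsetU in_fsetI yz andbT.
  move/fsubset_leq_card.
  have := cardfsUI (B `&` ([fset z] `+` fopp A)) ([fset z0] `+` fopp A).
  by rewrite !card_fsum1 card_fopp; nlia.
have sum2 : (2 * \sum_(z <- B `+` A) g z <=
    \sum_(z <- B `+` A) g z * repr_count B A z)%N.
  rewrite big_distrr big_seq [leqRHS]big_seq /=; apply: leq_sum => z zAB.
  by rewrite mulnC leq_mul2l rep2 ?orbT.
have [x0 x0z] := p_surj z0.
pose W := (S `+` T `+` H) `|` ([fset x0] `+` H).
have Wfull x : x \in W.
  rewrite in_fsetU; have [xz|/z0_uniq xz] := eqVneq (p x) z0.
    by rewrite mem_fsum1 p_ker raddfB xz x0z subrr eqxx orbT.
  by rewrite (core_cover erefl xz).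
have cW : (#|` W| <= h * (#|` B| + q).+1)%N.
  have pW : proj p W `<=` z0 |` (B `+` A) by apply/fsubsetP => z _; apply: full.
  have -> : (#|` B| + q).+1 = #|` z0 |` (B `+` A)| by rewrite cardfsU1 z0AB cAB.
  rewrite -(card_sum_fib pW) -sum_nat_fset.
  by apply: leq_sum => z _; apply: card_fib_le.
have := hC W Wfull; have STW : S `+` T `<=` W by apply/fsubsetP => x _.
(* With each hole counted twice, h|B| + 2qh + 2 <= 2|S| + |T|. The bound |S| <= |W| - |S + T| gives
   2|S| + |T| <= h|B| + qh + h + 1. Together qh < h, impossible for q >= 1. *)
rewrite cardfsDS //; have := core_master_sum; have := core_sum_g; rewrite cAB.
have hq : (h <= q * h)%N by rewrite leq_pmull.
rewrite mulnDr [(h * q)%N]mulnC [(h * #|` B|)%N]mulnC.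
move: cW; rewrite mulnS mulnDr [(h * q)%N]mulnC [(h * #|` B|)%N]mulnC.
by move: hq sum2 cST ltS; nlia.
Qed.

Lemma sum_fset_full (Z : {fset Q}) (F : Q -> nat) (c : nat) :
  (forall z, (F z <= c)%N) -> (c * #|` Z| <= \sum_(z <- Z) F z)%N ->
  forall z, z \in Z -> F z = c.
Proof.
move=> Fc le z zZ; apply/eqP; rewrite eqn_leq Fc /=.
have le2 : (\sum_(y <- Z `\ z) F y <= c * #|` Z `\ z|)%N.
  by rewrite -sum_nat_fset; apply: leq_sum => y _; apply: Fc.
move: le; rewrite (big_fsetD1 z) //= (cardfsD1 z Z) zZ mulnDr muln1.
by move: le2; nlia.
Qed.

(** As all other cosets of S + T are full, a period of its corner fibre is a period of S + T. So
    this fibre is aperiodic, Kneser bounds it below, and the cardinality of S + T leaves no hole in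
    the other fibres of [S] and [T]. *)
Lemma core_corner (j0 i0 : Q) : j0 \in A -> i0 \in B ->
  (forall j i, j \in A -> i \in B -> j + i = j0 + i0 -> j = j0 /\ i = i0) ->
  (forall z, z \in B `+` A -> z != j0 + i0 -> w (S `+` T) z = h) ->
  #|` B `+` A| = (#|` B| + q)%N ->
  (forall j, j \in A -> j != j0 -> w S j = h) /\
  (forall i, i \in B -> i != i0 -> w T i = h).
Proof.
move=> j0A i0B uniq0 full0 cBA.
pose X := fib p S j0; pose Y := fib p T i0.
have X0 : X != fset0 by rewrite fib_neq0.
have Y0 : Y != fset0 by rewrite fib_neq0.
have XY0 : X `+` Y != fset0 by apply: fsum_eq0.
have XYE : X `+` Y = fib p (S `+` T) (j0 + i0).
  apply/fsetP => z; apply/fsumP/idP => [[x [y [+ + ->]]]|].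
    rewrite !in_fib => /andP[xS /eqP px] /andP[yT /eqP py].
    by rewrite mem_fsum // raddfD px py eqxx.
  rewrite in_fib => /andP[/fsumP[x [y [xS yT ->]]]]; rewrite raddfD => /eqP.
  move=> /(uniq0 _ _ (mem_proj p xS) (mem_proj p yT))[px py]; exists x, y.
  by rewrite !in_fib xS yT px py !eqxx.
have ST0 : S `+` T != fset0 by apply: fsum_eq0 core_S0 core_T0.
have apXY : faperiodic (X `+` Y).
  move=> k kK; apply: apST.
  have [x0 x0z] := p_surj (j0 + i0).
  have kH : k \in H.
    apply: (fsubsetP (fstab_sub_fsubgroup (x := x0) XY0 (ker_subgroup p_ker) _)) kK.
    by rewrite XYE -x0z fib_coset.
  rewrite mem_fstab // eqEfcard card_fsum1 leqnn andbT.
  apply/fsubsetP => z; rewrite mem_fsum1 => zk.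
  have pzk : p (z - k) = p z by rewrite raddfB; move: kH; rewrite p_ker => /eqP->; rewrite subr0.
  have pz : p z \in B `+` A by rewrite fsumC -proj_fsum -pzk mem_proj.
  have [zz0|zz0] := eqVneq (p z) (j0 + i0); last first.
    by apply: (fib_full_mem p_ker); rewrite full0.
  have zkXY : z - k \in X `+` Y by rewrite XYE in_fib zk pzk zz0 eqxx.
  apply: (fsubsetP (fib_sub p (S `+` T) (j0 + i0))); rewrite -XYE.
  move: kK; rewrite mem_fstab // => /eqP <-.
  by rewrite mem_fsum1.
have := kneser_aperiodic X0 Y0 apXY; rewrite XYE => kn.
have j0i0 : j0 + i0 \in B `+` A by rewrite addrC mem_fsum.
have pST : proj p (S `+` T) `<=` B `+` A by rewrite proj_fsum fsumC.
have sST : (#|` S `+` T| + h = w (S `+` T) (j0 + i0)%R + h * (#|` B| + q))%N.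
  rewrite -(card_sum_fib pST) (big_fsetD1 (j0 + i0)) //= -addnA; congr (_ + _)%N.
  rewrite -cBA (cardfsD1 (j0 + i0) (B `+` A)) j0i0 mulnDr muln1 addnC.
  congr (_ + _)%N; rewrite -sum_nat_fset big_seq [RHS]big_seq.
  by apply: eq_bigr => z; rewrite in_fsetD1 => /andP[zz zBA]; apply: full0.
have sS := core_cS; rewrite (big_fsetD1 j0) //= in sS.
have sT := core_cT; rewrite (big_fsetD1 i0) //= in sT.
have cA0 : #|` A `\ j0| = q by have := cardfsD1 j0 A; rewrite j0A cA => -[].
have cB0 : #|` B| = (#|` B `\ i0| + 1)%N by rewrite (cardfsD1 i0 B) i0B addnC.
have uS : (\sum_(j <- A `\ j0) w S j <= h * #|` A `\ j0|)%N.
  by rewrite -sum_nat_fset; apply: leq_sum => j _; apply: card_fib_le.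
have uT : (\sum_(i <- B `\ i0) w T i <= h * #|` B `\ i0|)%N.
  by rewrite -sum_nat_fset; apply: leq_sum => j _; apply: card_fib_le.
have key : (h * #|` A `\ j0| + h * #|` B `\ i0| <=
   \sum_(j <- A `\ j0) w S j + \sum_(i <- B `\ i0) w T i)%N.
  move: sST; rewrite cB0 !mulnDr muln1 cA0.
  by move: kn sS sT cST; rewrite /X /Y; nlia.
split=> [j jA jj|i iB ii].
- apply: (@sum_fset_full (A `\ j0) (w S)); rewrite ?in_fsetD1 ?jj //.
    by move=> z; apply: card_fib_le.
  by move: key uT; nlia.
- apply: (@sum_fset_full (B `\ i0) (w T)); rewrite ?in_fsetD1 ?ii //.
    by move=> z; apply: card_fib_le.
  by move: key uS; nlia.
Qed.

Lemma core_progression : (exists z, z \notin A) -> (exists z, z \notin B `+` A) ->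
  (exists2 d, d != 0 & (#|` A `|` ([fset d] `+` A)| <= #|` A| + 1)%N) ->
  [/\ exists a d, A = fprog a d #|` A|, exists b d, B = fprog b d #|` B|,
      exists j0, forall j, j \in A -> j != j0 -> w S j = h
    & exists i0, forall i, i \in B -> i != i0 -> w T i = h].
Proof.
move=> zA outAB [d d0 cd]; have cBA := core_card_sum outAB.
have [a AE] := expanding_fprog gA zA d0 cd; rewrite cA in AE.
have [b BE] : exists b, B = fprog b d #|` B|.
  apply: (@fprog_sum_fprog _ B a d q); rewrite -?AE ?core_B0 //.
    by case: outAB => z; rewrite fsumC; exists z.
  by rewrite fsumC cBA cA; nlia.
have B1 := core_card_B zA.
have [u uE] : exists u, #|` B| = u.+1 by exists #|` B|.-1; lia.
have addE j i : a + d *+ j + (b + d *+ i) = a + b + d *+ (j + i).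
  by rewrite mulrnDr addrACA.
have ABE : B `+` A = fprog (a + b) d (q + u).+1.
  apply/eqP; rewrite eqEfcard; apply/andP; split.
    apply/fsubsetP => z; rewrite fsumC => /fsumP[x [y []]].
    rewrite AE BE uE => /fprogP[j ltj ->] /fprogP[i lti ->] ->.
    by rewrite addE mem_fprog //; lia.
  by rewrite cBA uE; apply: leq_trans (card_fprog_le _ _ _) _; lia.
have lenA : (q.+1 <= #|` fprog a d q.+1|)%N by rewrite -AE cA.
have lenB : (u.+1 <= #|` fprog b d u.+1|)%N by rewrite -uE -BE uE.
(* The size of A + B shows that the numbering of its cosets does not wrap around, so equal sums of
   terms have equal sums of indices. *)
have lenAB : ((q + u).+1 <= #|` fprog (a + b) d (q + u).+1|)%N.
  by rewrite -ABE cBA uE; lia.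
have inA j : (j <= q)%N -> a + d *+ j \in A by move=> lej; rewrite AE mem_fprog.
have inB i : (i <= u)%N -> b + d *+ i \in B by move=> lei; rewrite BE uE mem_fprog.
pose s j := w S (a + d *+ j); pose t i := w T (b + d *+ i).
pose v k := w (S `+` T) (a + b + d *+ k).
have sS : (\sum_(j < q.+1) s j = #|` S|)%N by rewrite -core_cS AE big_fprog.
have sT : (\sum_(i < u.+1) t i = #|` T|)%N by rewrite -core_cT BE uE big_fprog.
have sST : (\sum_(k < (q + u).+1) v k = #|` S `+` T|)%N.
  have pST : proj p (S `+` T) `<=` B `+` A by rewrite proj_fsum fsumC.
  by rewrite -(card_sum_fib pST) ABE big_fprog.
have st : staircase q u h s t v.
  split.
  - by move=> j lej; rewrite core_s_pos ?inA // card_fib_le.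
  - by move=> j i lej lei; rewrite /v -addE leq_fib_fsum // inB.
  - by move=> j i lej lei; rewrite /v -addE addrC fsumC leq_fib_fsum // inA.
  - by move=> k _; apply: card_fib_le.
  - by move=> j i lej lei lt; rewrite /v -addE; apply: fib_fsum_full.
  - by rewrite sS.
  - by rewrite sS sT sST cST.
have [i iB iT] := core_full_fiber zA.
have [f fu fE] : exists2 f, (f <= u)%N & i = b + d *+ f.
  by move: iB; rewrite BE uE => /fprogP[f]; exists f.
rewrite fE in iT.
have corner (j0 i0 : nat) : (j0 <= q)%N -> (i0 <= u)%N ->
    (forall j i, (j <= q)%N -> (i <= u)%N -> (j + i = j0 + i0)%N -> j = j0 /\ i = i0) ->
    (forall k, (k <= q + u)%N -> k != (j0 + i0)%N -> v k = h) ->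
    (forall j, j \in A -> j != a + d *+ j0 -> w S j = h) /\
    (forall i, i \in B -> i != b + d *+ i0 -> w T i = h).
  move=> lej0 lei0 u0 v0; apply: core_corner; rewrite ?inA ?inB //.
    move=> x y; rewrite AE BE uE => /fprogP[j ltj ->] /fprogP[l ltl ->].
    rewrite !addE => /(fprog_inj lenAB) e.
    by have [-> ->] : j = j0 /\ l = i0 by apply: u0 => //; apply: e; lia.
  move=> z; rewrite ABE addE => /fprogP[k ltk ->] kne.
  by apply: v0 => //; apply: contraNneq kne => ->.
have [full|full] := staircaseP st q_gt0 fu iT.
- have [fS fT] : (forall j, j \in A -> j != a + d *+ 0 -> w S j = h) /\
    (forall i, i \in B -> i != b + d *+ 0 -> w T i = h).
    by apply: corner => // [j l _ _|k kq k0]; [lia|apply: full; lia].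
  split; [by exists a, d; rewrite cA|by exists b, d|by exists (a + d *+ 0)|].
  by exists (b + d *+ 0).
- have [fS fT] : (forall j, j \in A -> j != a + d *+ q -> w S j = h) /\
    (forall i, i \in B -> i != b + d *+ u -> w T i = h).
    by apply: corner => // [j l lj ll|k kq k0]; [lia|apply: full; lia].
  split; [by exists a, d; rewrite cA|by exists b, d|by exists (a + d *+ q)|].
  by exists (b + d *+ u).
Qed.

End Pair.

(** [core_progression] needs a coset outside A + B. If there were none, the full fibre of -C in the
    dual pair would yield an [H]-coset disjoint from S + T, although every coset meets S + T. *)
Lemma core_main (T : {fset G}) :
  (#|` S `+` T| + 1 = #|` S| + #|` T|)%N -> faperiodic (S `+` T) ->
  (exists z, z \notin S `+` T) -> (#|` S| <= #|` T|)%N ->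
  (forall W : {fset G}, (forall x, x \in W) ->
     (#|` S| <= #|` W `\` (S `+` T)|)%N) ->
  (exists z, z \notin A) ->
  [/\ exists a d, A = fprog a d #|` A|, exists b d, proj p T = fprog b d #|` proj p T|,
      exists j0, forall j, j \in A -> j != j0 -> w S j = h
    & exists i0, forall i, i \in proj p T -> i != i0 -> w T i = h].
Proof.
move=> cST apST outST leST hC zA.
suff outAB : exists z, z \notin proj p T `+` A.
  by apply: core_progression => //; apply: (core_direction (T := T)).
apply: contrapT => nout.
have full z : z \in proj p T `+` A by apply/negPn/negP => zAB; apply: nout; exists z.
pose W := S `+` T `+` H; pose C := W `\` (S `+` T).
have Wf x : x \in W by apply: (core_cover erefl (full (p x))).
have T0 : T != fset0 by have := core_S0; rewrite -!cardfs_gt0; nlia.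
have [dE dap dcard] := dual_pair Wf core_S0 T0 outST apST cST.
rewrite -/C in dE dap dcard.
have [||i iC iF] := @core_full_fiber (fopp C) _ dap _ zA.
- by rewrite card_fopp.
- by rewrite card_fopp; apply: hC.
have := full (- i); rewrite fsumC -proj_fsum => /projP[x xST xi].
have : - x \in fopp C.
  by apply: (fib_full_mem p_ker); rewrite raddfN -xi opprK.
by rewrite mem_fopp opprK in_fsetD xST.
Qed.

End Core.

(** * Fragments and hyper-atoms *)

Section SetsAndFsets.
Local Open Scope fset_scope.
Local Open Scope ring_scope.

Lemma sumset_fset (V : zmodType) (A B : {fset V}) :
  sumset [set` A] [set` B] = [set` A `+` B].
Proof.
apply/seteqP; split=> x /=.
  by move=> [a aA [b bB <-]]; apply: mem_fsum.
by move=> /fsumP[a [b [aA bB ->]]]; exists a => //; exists b.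
Qed.

Lemma ncard_fset (V : zmodType) (A : {fset V}) : ncard [set` A] = #|` A|.
Proof. by rewrite /ncard set_fsetK. Qed.

Lemma finite_setE (V : zmodType) (X : set V) : finite_set X ->
  exists A : {fset V}, X = [set` A].
Proof. by move=> fX; exists (fset_set X); rewrite fset_setK. Qed.

Lemma faperiodic_aperiodic (V : zmodType) (A : {fset V}) : A != fset0 ->
  aperiodic [set` A] -> faperiodic A.
Proof.
move=> A0 apA x; rewrite mem_fstab // => /eqP xA.
suff : period [set` A] x by rewrite apA.
apply/seteqP; split=> y /=.
  by move=> [z zA <-]; rewrite -xA mem_fsum ?fset11.
by rewrite -{1}xA mem_fsum1 => yA; exists (y - x); rewrite ?xA // addrC subrK.
Qed.

Lemma gen_sub (V : zmodType) (X : set V) (x : V) : X x -> gen X x.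
Proof. by move=> Xx K XK; apply: XK. Qed.

Lemma genB (V : zmodType) (X : set V) (x y : V) : gen X x -> gen X y -> gen X (x - y).
Proof. by move=> gx gy K XK; rewrite rpredB ?gx ?gy. Qed.

Lemma gen0 (V : zmodType) (X : set V) : gen X 0.
Proof. by move=> K _; rewrite rpred0. Qed.

Lemma zmodClosed_of_fsubgroup (V : zmodType) (K : {fset V}) : fsubgroup K ->
  exists H : zmodClosed V, [set` H] = [set` K].
Proof.
move=> [K0 KB]; have zK : zmod_closed (fun x => x \in K) by split.
pose mK := GRing.isZmodClosed.Build V (fun x => x \in K) zK.
pose H : zmodClosed V := HB.pack (fun x : V => x \in K) mK.
by exists H; apply/seteqP; split.
Qed.

Lemma fsubgroup_of_zmodClosed (V : zmodType) (H : zmodClosed V) (K : {fset V}) :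
  [set` H] = [set` K] -> fsubgroup K.
Proof.
move=> HK; have e x : (x \in K) = (x \in H).
  have : [set` H] x = [set` K] x by rewrite HK.
  by move=> e; apply/idP/idP => xK; [move: (xK : [set` K] x); rewrite -e|
    move: (xK : [set` H] x); rewrite e].
by split=> [|x y]; rewrite !e ?rpred0 //; apply: rpredB.
Qed.

Lemma gen_fsubgroup (V : zmodType) (X : set V) (K : {fset V}) (x : V) :
  fsubgroup K -> (X `<=` [set` K])%classic -> gen X x -> x \in K.
Proof.
move=> gK XK gx; have [H HK] := zmodClosed_of_fsubgroup gK.
suff : [set` K] x by [].
by rewrite -HK; apply: gx; rewrite HK.
Qed.

(** Treats finite and infinite groups alike: in an infinite group a finite sum always leaves a point
    uncovered. *)
Lemma kappa1_admissibleP (V : zmodType) (X Y : {fset V}) :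
  kappa1_admissible [set` X] [set` Y] <->
  Y != fset0 /\ exists z, z \notin Y `+` X.
Proof.
rewrite /kappa1_admissible sumset_fset !ncard_fset cardfs_gt0; split.
  move=> [_ Y0 fin]; split => //; apply: contrapT => full.
  have full' z : z \in Y `+` X by apply/negPn/negP => zYX; apply: full; exists z.
  have TE : [set: V] = [set` Y `+` X] by apply/seteqP; split=> x _ //=.
  move: fin; rewrite TE ncard_fset => /(_ (finite_fset _)).
  have : (0 < #|` Y `+` X|)%N by rewrite cardfs_gt0; apply/fset0Pn; exists 0; apply: full'.
  by nlia.
move=> [Y0 [z zYX]]; split => // finT; have [W WE] := finite_setE finT.
have Wf x : x \in W by have : [set: V] x by []; rewrite WE.
rewrite WE ncard_fset.
have : Y `+` X `<` W.
  by rewrite fproperE; apply/andP; split;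
    [apply/fsubsetP => x _|apply/fsubsetPn; exists z].
by move/fproper_ltn_card; nlia.
Qed.

Lemma kappa1_le (V : zmodType) (X Y : {fset V}) : Y != fset0 ->
  (exists z, z \notin Y `+` X) ->
  (kappa1 [set` X] <= #|` Y `+` X| - #|` Y|)%N.
Proof.
move=> Y0 out; have val : kappa1_value [set` X] (#|` Y `+` X| - #|` Y|)%N.
  exists [set` Y]; first by apply/kappa1_admissibleP.
  by rewrite sumset_fset !ncard_fset.
rewrite /kappa1; case: pselect => [ex|[]]; last by exists (#|` Y `+` X| - #|` Y|)%N.
by case: ex_minnP => n _; apply; apply/asboolP.
Qed.

Lemma kappa1_attained (V : zmodType) (X : {fset V}) : (exists z, z \notin X) ->
  exists Y : {fset V}, [/\ Y != fset0, exists z, z \notin Y `+` X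
    & (#|` Y `+` X| - #|` Y|)%N = kappa1 [set` X]].
Proof.
move=> [z zX]; rewrite /kappa1; case: pselect => [ex|[]].
  case: ex_minnP => n /asboolP[Y admY ->] _.
  have [F YF] : exists F : {fset V}, Y = [set` F] by case: admY => /finite_setE.
  move: admY; rewrite YF => /kappa1_admissibleP[F0 outF].
  by exists F; rewrite sumset_fset !ncard_fset.
have out0 : exists z, z \notin [fset 0] `+` X by exists z; rewrite fsum0.
have f0 : [fset 0] != fset0 :> {fset V} by rewrite -cardfs_gt0 cardfs1.
pose Y0 := [fset (0 : V)].
exists (ncard (sumset [set` Y0] [set` X]) - ncard [set` Y0])%N, [set` Y0] => //.
exact/kappa1_admissibleP.
Qed.

Lemma fragment1P (V : zmodType) (X Y : {fset V}) :
  fragment1 [set` X] [set` Y] <->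
  [/\ Y != fset0, exists z, z \notin Y `+` X
    & (#|` Y `+` X| - #|` Y|)%N = kappa1 [set` X]].
Proof.
rewrite /fragment1 sumset_fset !ncard_fset cardfs_gt0; split.
  by move=> [_ Y0 [z /negP zYX] e]; split => //; exists z.
by move=> [Y0 [z zYX] e]; split => //; exists z; apply/negP.
Qed.

(* By Kneser's theorem the period of Y + X is a 1-fragment whenever Y is. *)
Lemma subgroup_fragment (V : zmodType) (X : {fset V}) : X != fset0 ->
  (exists z, z \notin X) -> exists H : zmodClosed V, fragment1 [set` X] [set` H].
Proof.
move=> X0 outX; have [Y [Y0 [z zYX] eY]] := kappa1_attained outX.
have YX0 : Y `+` X != fset0 by apply: fsum_eq0.
set K := fstab (Y `+` X); have gK : fsubgroup K := fstab_subgroup YX0.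
have [H HK] := zmodClosed_of_fsubgroup gK; exists H; rewrite HK; apply/fragment1P.
have K0 := fsubgroup0 gK.
have outK : exists z, z \notin K `+` X.
  have /fset0Pn[y yY] := Y0; exists (z - y); apply: contra zYX => zy.
  have -> : z = y + (z - y) by zmod.
  rewrite -(fsum_fstab YX0) -/K -fsumA [X `+` K]fsumC; exact: mem_fsum.
split => //; apply/eqP; rewrite eqn_leq kappa1_le // andbT -eY.
have := kneser_strong Y0 X0; rewrite -/K [X `+` K]fsumC.
have := fsubset_leq_card (fsub_fsum Y (proj1 gK)).
by have := leq_card_fsum X K0; nlia.
Qed.

Lemma fragment_subgroup_le (V : zmodType) (X K : {fset V}) :
  gen [set` X] = setT -> 0 \in X -> fsubgroup K -> (exists z, z \notin K `+` X) ->
  exists2 x, x \in X & x \notin K.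
Proof.
move=> gX X0 gK [z zKX]; apply/fsubsetPn; apply: contra zKX => XK.
have zK : z \in K.
  apply: (@gen_fsubgroup _ [set` X]) => //; last by rewrite gX.
  by move=> x /=; apply/fsubsetP.
by rewrite -[z]addr0 mem_fsum.
Qed.

(** A generating [X] meets two cosets of any subgroup K that is a 1-fragment, so |K| <= |K + X| -
    |K| = kappa_1(X). This bound makes a largest such K exist, also in an infinite group. *)
Lemma hyper_atom_exists (V : zmodType) (X : {fset V}) :
  gen [set` X] = setT -> 0 \in X -> (exists z, z \notin X) ->
  exists H : zmodClosed V, hyper_atom [set` X] H.
Proof.
move=> gX X0 outX; have XN0 : X != fset0 by apply/fset0Pn; exists 0.
have [H0 frH0] := subgroup_fragment XN0 outX.
pose P n := `[< exists2 H : zmodClosed V, fragment1 [set` X] [set` H]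
                & ncard [set` H] = n >].
have exP : exists n, P n by exists (ncard [set` H0]); apply/asboolP; exists H0.
have boundP n : P n -> (n <= kappa1 [set` X])%N.
  move=> /asboolP[H frH <-].
  have [K HK] : exists K : {fset V}, [set` H] = [set` K] by case: frH => /finite_setE.
  have gK := fsubgroup_of_zmodClosed HK.
  move: frH; rewrite HK ncard_fset => /fragment1P[K0 outK eK].
  have [x xX xK] := fragment_subgroup_le gX X0 gK outK.
  have := @card_coset_ge2 _ X K x 0 gK xX X0; rewrite subr0 => /(_ xK).
  by rewrite fsumC; nlia.
case: (ex_maxnP exP boundP) => n /asboolP[H frH Hn] maxn; exists H.
by split => // K frK; rewrite Hn; apply: maxn; apply/asboolP; exists K.
Qed.

Lemma ideal_quot_ker (V : zmodType) (H : zmodClosed V) (x : V) :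
  (\pi_({ideal_quot H}) x == 0) = (x \in H).
Proof. by rewrite -[x in RHS]subr0 Quotient.idealrBE raddf0. Qed.

Lemma ideal_quot_surj (V : zmodType) (H : zmodClosed V) (z : {ideal_quot H}) :
  exists x, \pi_({ideal_quot H}) x = z.
Proof. by exists (repr z); rewrite reprK. Qed.

Lemma hyper_atom_core (V : zmodType) (X : {fset V}) (H : zmodClosed V) :
  hyper_atom [set` X] H ->
  (forall W : {fset V}, (forall x, x \in W) -> (3 * #|` X| <= #|` W| + 1)%N) ->
  let p : {additive V -> {ideal_quot H}} := \pi_({ideal_quot H}) in
  exists (K : {fset V}) (q : nat),
  [/\ [set` H] = [set` K], forall x, (x \in K) = (p x == 0),
      (#|` proj p X| = q.+1 /\ (0 < q)%N),
      (forall Y : {fset V}, Y != fset0 -> (exists z, z \notin Y `+` X) ->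
        (#|` Y| + q * #|` K| <= #|` Y `+` X|)%N)
    & [/\ (q * #|` K| < #|` X|)%N, expanding (proj p X) & exists z, z \notin proj p X]].
Proof.
move=> [_ gX X0 frH maxH] small p.
have [K HK] : exists K : {fset V}, [set` H] = [set` K] by case: frH => /finite_setE.
have gK := fsubgroup_of_zmodClosed HK.
move: frH; rewrite HK => /fragment1P[K0 outK eK].
have [x xX xK] := fragment_subgroup_le gX X0 gK outK.
have inK y : (y \in K) = (y \in H).
  have e : [set` H] y = [set` K] y by rewrite HK.
  by apply/idP/idP => yK; [move: (yK : [set` K] y); rewrite -e|
    move: (yK : [set` H] y); rewrite e].
have p_ker y : (y \in K) = (p y == 0) by rewrite ideal_quot_ker inK.
have p_surj : forall z, exists y, p y = z := @ideal_quot_surj V H.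
have XN0 : X != fset0 by apply/fset0Pn; exists 0.
have h0 := fsubgroup_gt0 gK.
have cA2 : (1 < #|` proj p X|)%N.
  apply: (@card_lt2 _ _ (p x) (p 0)); rewrite ?mem_proj //.
  by apply: contraNneq xK => e; rewrite p_ker e raddf0.
have [q cA] : exists q, #|` proj p X| = q.+1.
  by exists #|` proj p X|.-1; rewrite prednK // ltnW.
have q0 : (0 < q)%N by rewrite -ltnS -cA.
have kE : kappa1 [set` X] = (q * #|` K|)%N.
  by rewrite -eK fsumC (card_fsum_ker p_surj p_ker) cA mulSn addKn.
have kap (Y : {fset V}) : Y != fset0 -> (exists z, z \notin Y `+` X) ->
    (#|` Y| + q * #|` K| <= #|` Y `+` X|)%N.
  move=> Y0 outY; have := kappa1_le Y0 outY; rewrite kE.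
  by have := leq_card_fsum Y XN0; rewrite fsumC; nlia.
have zA : exists z, z \notin proj p X.
  case: outK => z zKX; exists (p z); apply: contra zKX => /projP[y yX zy].
  have -> : z = z - y + y by zmod.
  by rewrite mem_fsum // p_ker raddfB zy subrr.
have ltX : (q * #|` K| < #|` X|)%N.
  have o0 : [fset 0] != fset0 :> {fset V} by rewrite -cardfs_gt0 cardfs1.
  have := kap [fset 0] o0; rewrite fsum0 cardfs1 add1n; apply.
  case: zA => z zNA; have [y yz] := p_surj z; exists y.
  by apply: contra zNA; rewrite -yz; apply: mem_proj.
exists K, q; split => //; split => //.
move=> L gL L1 [y0 y0L].
pose R := [fset repr z | z in L]; pose L' := R `+` K.
have pR : proj p R = L.
  apply/fsetP => z; apply/projP/idP => [[_ /imfsetP[y /= yL ->] ->]|zL].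
    by rewrite /p /= reprK.
  by exists (repr z); rewrite ?in_imfset // /p /= reprK.
have L'E y : (y \in L') = (p y \in L).
  apply/fsumP/idP => [[a [k [aR kK ->]]]|].
    move: kK; rewrite p_ker raddfD => /eqP ->; rewrite addr0.
    by rewrite -pR mem_proj.
  rewrite -{1}pR => /projP[a aR e]; exists a, (y - a); rewrite p_ker raddfB e.
  by rewrite subrr eqxx; split => //; zmod.
have gL' : fsubgroup L'.
  split=> [|u v]; first by rewrite L'E raddf0; case: gL.
  by rewrite !L'E raddfB; case: gL => _; apply.
have cL' : #|` L'| = (#|` L| * #|` K|)%N by rewrite (card_fsum_ker p_surj p_ker) pR.
have cL'X : #|` L' `+` X| = (#|` proj p X `+` L| * #|` K|)%N.
  by rewrite fsumAC (card_fsum_ker p_surj p_ker) proj_fsum pR fsumC.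
(* [kap] for the preimage [L'] gives |L| + q <= |proj p X + L|. Equality would make [L'] a subgroup
   1-fragment larger than [H], so one more coset is gained. *)
have [outL|full] := pselect (exists z, z \notin L' `+` X).
  have := kap _ (fsubgroup0 gL') outL; rewrite cL' cL'X -mulnDl => le1.
  have [H' HL'] := zmodClosed_of_fsubgroup gL'.
  have ne : (#|` L| + q)%N != #|` proj p X `+` L|.
    apply/eqP => e; have : fragment1 [set` X] [set` H'].
      rewrite HL'; apply/fragment1P; split => //; first exact: fsubgroup0.
      by rewrite cL' cL'X -e mulnDl addKn kE.
    move/maxH; rewrite HK HL' !ncard_fset cL'.
    by rewrite leqNgt -{1}[#|` K|]mul1n ltn_pmul2r // L1.
  by move: le1 ne; rewrite leq_pmul2r // cA; lia.
(* Now [L'] + X is everything. [small] yields at least 3q + 1 cosets, and [L] being proper yields at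
   least 2|L|; the average of the two is at least q + 1 + |L| since q >= 1. *)
have Wf z : z \in L' `+` X by apply/negPn/negP => h; apply: full; exists z.
have := small _ Wf; rewrite cL'X => le1.
have lt3 : (3 * q < #|` proj p X `+` L|)%N.
  by rewrite -(ltn_pmul2r h0) -mulnA; move: le1 ltX; nlia.
have inAL z : z \in proj p X `+` L.
  have [y <-] := p_surj z; have /fsumP[u [v [uL vX ->]]] := Wf y.
  by rewrite raddfD addrC mem_fsum ?mem_proj // -L'E.
have := @card_coset_ge2 _ (proj p X `+` L) L y0 0 gL (inAL _) (inAL _).
rewrite subr0 => /(_ y0L); rewrite -fsumA fsubgroup_fsum // cA.
by move: lt3 q0; nlia.
Qed.

Lemma quasi_periodic_intro (V : zmodType) (K A : set V) (t : V) :
  K 0 -> (forall x y, K x -> K y -> K (x - y)) ->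
  (forall x k, A x -> ~ K (x - t) -> K k -> A (x + k)) -> quasi_periodic K A.
Proof.
move=> K0 KB AK; exists t; apply/seteqP; split=> x /=; last first.
  by move=> xA; exists x => //; exists 0; rewrite ?addr0.
move=> [y [yA yt] [k kK <-]].
have ytK : ~ K (y - t) by move=> ytK; apply: yt; exists (y - t) => //; zmod.
split; first exact: AK.
move=> [l lK e]; apply: ytK; have -> : y - t = l - k; last exact: KB.
by have -> : y = t + l - k by [rewrite e; zmod]; zmod.
Qed.

Lemma fprog_fopp (V : zmodType) (x d : V) (n : nat) :
  fopp (fprog x d n) = fprog (- x) (- d) n.
Proof.
apply/fsetP => y; rewrite mem_fopp; apply/fprogP/fprogP => -[i lti e]; exists i => //.
  by rewrite -[y]opprK e opprD mulNrn.
by rewrite e opprD mulNrn !opprK.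
Qed.

(** The conclusion of (iii) for one set, read in the quotient. It is stable under negation, so it
    can be transferred from -S and -T after the exchange with U. *)
Definition near_full (V Q : zmodType) (p : {additive V -> Q}) (n : nat)
    (T : {fset V}) : Prop :=
  (exists b d, proj p T = fprog b d #|` proj p T|) /\
  (exists i0, forall i, i \in proj p T -> i != i0 -> #|` fib p T i| = n).

Lemma near_full_fopp (V Q : zmodType) (p : {additive V -> Q}) (n : nat)
    (T : {fset V}) : near_full p n (fopp T) -> near_full p n T.
Proof.
move=> [[b [d pT]] [i0 full]]; split.
  exists (- b), (- d); rewrite -fprog_fopp -(card_fopp (proj p T)) -proj_fopp.
  by rewrite -pT proj_fopp foppK.
exists (- i0) => i iT ne; rewrite -(card_fopp (fib p T i)) -{1}[i]opprK -fib_fopp.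
apply: full; first by rewrite proj_fopp mem_fopp opprK.
by apply: contraNneq ne => <-; rewrite opprK.
Qed.

Lemma near_full_structure (V : zmodType) (H : zmodClosed V) (K T : {fset V}) :
  let p : {additive V -> {ideal_quot H}} := \pi_({ideal_quot H}) in
  [set` H] = [set` K] -> (forall x, (x \in K) = (p x == 0)) -> T != fset0 ->
  near_full p #|` K| T ->
  quasi_periodic [set` H] [set` T] /\ AP (\pi_({ideal_quot H}) @` [set` T])%classic.
Proof.
move=> p HK p_ker T0 [[b [d pT]] [i0 full]]; split.
  have [t tE] := ideal_quot_surj i0.
  apply: (@quasi_periodic_intro _ _ _ t) => /=; first by rewrite rpred0.
    by move=> x y; apply: rpredB.
  move=> x k xT xt kH; have kK : k \in K by rewrite p_ker ideal_quot_ker.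
  have pxk : p (x + k) = p x.
    by rewrite raddfD; move: kK; rewrite p_ker => /eqP ->; rewrite addr0.
  apply: (fib_full_mem p_ker); rewrite pxk; apply: full; first exact: mem_proj.
  apply/eqP => pxi; apply: xt; have {}tE : p t = i0 := tE.
  have : p (x - t) == 0 by rewrite raddfB pxi tE subrr.
  by rewrite ideal_quot_ker.
exists d, b, #|` proj p T|.-1; apply/seteqP; split=> z /=.
  move=> [x xT <-]; have := mem_proj p xT; rewrite {1}pT => /fprogP[i lti ->].
  by exists i => //=; move: lti; nlia.
move=> [i lei <-]; have : b + d *+ i \in proj p T.
  rewrite {1}pT mem_fprog //.
  by have := proj_neq0 p T0; rewrite -cardfs_gt0; move: lei => /=; nlia.
by move=> /projP[x xT ->]; exists x.
Qed.

Lemma dual_translate (V : zmodType) (S T W : {fset V}) (a : V) :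
  (forall x, x \in W) -> S != fset0 -> T != fset0 ->
  (exists z, z \notin S `+` T) ->
  faperiodic (S `+` T) -> (#|` S `+` T| + 1 = #|` S| + #|` T|)%N ->
  let U := [fset - a] `+` (W `\` (S `+` T)) in
  [/\ faperiodic (U `+` fopp S), (#|` U `+` fopp S| + 1 = #|` U| + #|` fopp S|)%N,
      exists z, z \notin U `+` fopp S & #|` W `\` (U `+` fopp S)| = #|` T|].
Proof.
move=> Wf S0 T0 outST apST cST U.
have [dE dap dcard] := dual_pair Wf S0 T0 outST apST cST.
pose C := W `\` (S `+` T); rewrite -/C in dE dap dcard.
have UE : U `+` fopp S = [fset - a] `+` fopp (S `+` fopp C).
  by rewrite fopp_fsum foppK [fopp S `+` C]fsumC /U fsumA.
have C0 : C != fset0.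
  by case: outST => z zST; apply/fset0Pn; exists z; rewrite in_fsetD Wf andbT.
have D0 : fopp (S `+` fopp C) != fset0 by rewrite fopp_eq0 fsum_eq0 ?fopp_eq0.
have cU : #|` U| = #|` C| by rewrite card_fsum1.
have cUS : (#|` U `+` fopp S| + 1 = #|` U| + #|` fopp S|)%N.
  by rewrite UE card_fsum1 !card_fopp cU; nlia.
have subW (Z : {fset V}) : Z `<=` W by apply/fsubsetP => z _.
have cW : #|` W `\` (U `+` fopp S)| = #|` T|.
  rewrite cardfsDS // UE card_fsum1 card_fopp dE cardfsDS // card_fopp.
  by rewrite subKn // -(card_fopp T) fsubset_leq_card.
split => //.
  by rewrite UE => x; rewrite fstab_fsum1 // fstab_opp ?fsum_eq0 ?fopp_eq0 //; apply: dap.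
have /fset0Pn[z] : W `\` (U `+` fopp S) != fset0 by rewrite -cardfs_gt0 cW cardfs_gt0.
by rewrite in_fsetD => /andP[zU _]; exists z.
Qed.

Lemma core_near_full (V : zmodType) (S T : {fset V}) (H : zmodClosed V)
    (p : {additive V -> {ideal_quot H}} := \pi_({ideal_quot H})) (K : {fset V}) (q : nat) :
  (forall x, (x \in K) = (p x == 0)) -> #|` proj p S| = q.+1 -> (0 < q)%N ->
  (forall Y : {fset V}, Y != fset0 -> (exists z, z \notin Y `+` S) ->
        (#|` Y| + q * #|` K| <= #|` Y `+` S|)%N) ->
  (q * #|` K| < #|` S|)%N -> expanding (proj p S) -> (exists z, z \notin proj p S) ->
  (#|` S `+` T| + 1 = #|` S| + #|` T|)%N -> faperiodic (S `+` T) ->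
  (exists z, z \notin S `+` T) -> (#|` S| <= #|` T|)%N ->
  (forall W : {fset V}, (forall x, x \in W) ->
     (#|` S| <= #|` W `\` (S `+` T)|)%N) ->
  near_full p #|` K| S /\ near_full p #|` K| T.
Proof.
move=> p_ker cA q0 kap ltS gA zA cST apST outST leST hC.
have [e1 e2 e3 e4] := core_main (@ideal_quot_surj V H) p_ker cA q0 kap ltS gA
  cST apST outST leST hC zA.
by split; split.
Qed.

End SetsAndFsets.

(** * The three cases of the theorem *)

Section Main.
Local Open Scope fset_scope.
Local Open Scope ring_scope.

Lemma quasi_periodic_gen_set (V : zmodType) (S T : {fset V}) :
  0 \in S -> (1 < #|` S|)%N -> T != fset0 -> faperiodic (S `+` T) ->
  (#|` S `+` T| + 1 = #|` S| + #|` T|)%N ->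
  exists t, forall x k, x \in T -> ~ gen [set` S] (x - t) -> gen [set` S] k ->
    x + k \in T.
Proof.
move=> S0 S1 T0 apST cST.
have [||K gK SK x /asboolP gx|t tP] :=
  @quasi_periodic_gen _ S T (fun x => `[< gen [set` S] x >]) _ _ _ S0 S1 T0 apST cST.
- by move=> x y /asboolP gx /asboolP gy; apply/asboolP/genB.
- by move=> x xS; apply/asboolP/gen_sub.
- by apply: (gen_fsubgroup gK) gx => y /=; apply/fsubsetP.
exists t => x k xT gx gk; apply: tP => //; last exact/asboolP.
by apply/negP => /asboolP.
Qed.

Lemma hyper_atom_near_full (V : zmodType) (S : {fset V}) (H : zmodClosed V)
    (p : {additive V -> {ideal_quot H}} := \pi_({ideal_quot H})) :
  hyper_atom [set` S] H ->
  (forall W : {fset V}, (forall x, x \in W) -> (3 * #|` S| <= #|` W| + 1)%N) ->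
  exists K : {fset V}, [/\ [set` H] = [set` K], forall x, (x \in K) = (p x == 0),
    [set` H] <> setT
  & forall T : {fset V}, (#|` S `+` T| + 1 = #|` S| + #|` T|)%N ->
      faperiodic (S `+` T) -> (exists z, z \notin S `+` T) -> (#|` S| <= #|` T|)%N ->
      (forall W : {fset V}, (forall x, x \in W) ->
         (#|` S| <= #|` W `\` (S `+` T)|)%N) ->
      near_full p #|` K| S /\ near_full p #|` K| T].
Proof.
move=> hyp small; have [K [q [HK p_ker [cA q0] kap [ltS gA zA]]]] := hyper_atom_core hyp small.
exists K; split => //; last by move=> T; apply: (core_near_full p_ker cA q0).
move=> HT; case: zA => z; case/negP; have [y yz] := ideal_quot_surj z.
have yH : [set` H] y by rewrite HT.
have S0 : 0 \in S by case: hyp.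
have -> : z = p 0 by rewrite raddf0 -yz; apply/eqP; rewrite ideal_quot_ker.
exact: mem_proj.
Qed.

(** For y outside [P], the elements x and x - y are never both in [P], so one of them lies in
    [D]. *)
Lemma finite_of_cofinite_subgroup (V : zmodType) (P : set V) (D : {fset V}) :
  P 0 -> (forall x y, P x -> P y -> P (x - y)) -> P <> setT ->
  (forall x, x \notin D -> P x) -> exists W : {fset V}, forall x, x \in W.
Proof.
move=> P0 PB PT PD; have [y Py] : exists y, ~ P y.
  apply: contrapT => nP; apply: PT; apply/seteqP; split=> // x _.
  by apply: contrapT => Px; apply: nP; exists x.
exists (D `|` ([fset y] `+` D)) => x; rewrite in_fsetU mem_fsum1.
have [//|xD /=] := boolP (x \in D); apply/negPn/negP => xyD; apply: Py.
have -> : y = x - (x - y) by zmod.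
by apply: PB; apply: PD.
Qed.

Lemma quasi_periodic_fopp (V : zmodType) (K : set V) (T : {fset V}) (t : V) :
  K 0 -> (forall x y, K x -> K y -> K (x - y)) ->
  (forall x k, x \in fopp T -> ~ K (x - t) -> K k -> x + k \in fopp T) ->
  quasi_periodic K [set` T].
Proof.
move=> K0 KB TP; have KN x : K x -> K (- x) by move=> Kx; rewrite -sub0r; apply: KB.
apply: (@quasi_periodic_intro _ _ _ (- t)) => //= x k xT xt Kk.
have : - x + - k \in fopp T.
  apply: TP; rewrite ?mem_fopp ?opprK //; last exact: KN.
  by move=> /KN; have -> : - (- x - t) = x - - t by zmod.
by rewrite mem_fopp; have -> : - (- x + - k) = x + k by zmod.
Qed.

(** The subgroup is the whole group: c - T avoids [S], and the cardinalities make it the complement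
    of [S]. *)
Lemma WP3_of_card1 (V : zmodType) (S T W : {fset V}) (c : V) :
  (forall x, x \in W) -> S != fset0 -> T != fset0 -> faperiodic S ->
  (#|` S `+` T| + 1 = #|` S| + #|` T|)%N -> W `\` (S `+` T) = [fset c] ->
  WP3 [set` S] [set` T].
Proof.
move=> Wf S0 T0 apS cST Wc; split.
  apply/seteqP; split=> [x xS|_ ->] /=.
    apply: apS; rewrite mem_fstab //; apply/eqP/fsetP => y.
    rewrite mem_fsum1; have e : translate x [set` S] = [set` S] := xS.
    apply/idP/idP => yS.
      suff : [set` S] y by [].
      by rewrite -e; exists (y - x) => //; zmod.
    have : translate x [set` S] y by rewrite e.
    by move=> [z zS <-]; have -> : x + z - x = z by zmod.
  apply/seteqP; split=> y /=; first by move=> [z zS <-]; rewrite add0r.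
  by move=> yS; exists y; rewrite ?add0r.
have gW : fsubgroup W by [].
have [H HW] := zmodClosed_of_fsubgroup gW.
have inH (X : set V) : in_coset H X.
  by exists 0 => x _; exists x; rewrite ?add0r // HW; apply: Wf.
exists H, c; split => //; first by rewrite HW; apply: finite_fset.
have subW (X : {fset V}) : X `<=` W by apply/fsubsetP => x _.
have cW : (#|` W| = #|` S `+` T| + 1)%N.
  by have := cardfsDS (subW (S `+` T)); rewrite Wc cardfs1;
    have := fsubset_leq_card (subW (S `+` T)); nlia.
have cT : [fset c] `+` fopp T = W `\` S.
  apply/eqP; rewrite eqEfcard card_fsum1 card_fopp cardfsDS //; apply/andP; split.
    apply/fsubsetP => x; rewrite mem_fsum1 mem_fopp in_fsetD Wf andbT => xT.
    apply/negP => xS; have : c \in W `\` (S `+` T) by rewrite Wc fset11.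
    rewrite in_fsetD => /andP[/negP[]]; have -> : c = x + - (x - c) by zmod.
    exact: mem_fsum.
  by have := fsubset_leq_card (subW S); nlia.
rewrite HW; apply/seteqP; split=> x /=.
  move=> [b bT <-]; split => //; apply/negP.
  have : c + - b \in W `\` S by rewrite -cT mem_fsum ?fset11 // mem_fopp opprK.
  by rewrite in_fsetD => /andP[].
move=> [_ /negP xS]; have : x \in W `\` S by rewrite in_fsetD xS Wf.
rewrite -cT mem_fsum1 mem_fopp => xT; exists (- (x - c)) => //; zmod.
Qed.

End Main.

Theorem theorem6p1 (G : zmodType) (S T : set G) (a : G) :
  finite_set S -> finite_set T ->
  gen (S `|` T) = setT ->
  (ncard S <= ncard T)%N ->
  (S `&` T) 0 ->
  ncard (sumset S T) = (ncard S + ncard T - 1)%N ->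
  aperiodic (sumset S T) ->
  ~ weak_pair S T ->
  let TS := ~` sumset T S in
  TS a ->
  let U := [set x - a | x in TS] in
  [/\ gen S <> setT -> quasi_periodic (gen S) T,
      gen S = setT -> gen U <> setT ->
        quasi_periodic (gen U) S /\ quasi_periodic (gen U) T
    & gen S = setT -> gen U = setT ->
        exists H : zmodClosed G,
          [/\ [set` H] <> setT,
              quasi_periodic [set` H] S, quasi_periodic [set` H] T,
              AP (\pi_({ideal_quot H}) @` S) /\ AP (\pi_({ideal_quot H}) @` T)
            & hyper_atom S H \/ hyper_atom U H]].
Proof.
move=> finS finT _ leST [S0 T0] cST apST nweak TS TSa U.
have [A SA] := finite_setE finS; have [B TB] := finite_setE finT.
rewrite {finS finT}SA {}TB in leST S0 T0 cST apST nweak TS TSa U *.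
rewrite sumset_fset !ncard_fset in leST cST apST.
have A0 : (0 : G) \in A := S0; have B0 : (0 : G) \in B := T0.
have AN0 : A != fset0%fset by apply/fset0Pn; exists 0.
have BN0 : B != fset0%fset by apply/fset0Pn; exists 0.
have aAB : a \notin (A `+` B)%fset.
  by apply/negP => aAB; apply: TSa; rewrite sumset_fset fsumC.
have outAB : exists z, z \notin (A `+` B)%fset by exists a.
have {}apST : faperiodic (A `+` B)%fset.
  by apply: faperiodic_aperiodic => //; apply: fsum_eq0.
have A1 : (0 < #|` A|)%N by rewrite cardfs_gt0.
have {}cST : (#|` (A `+` B)%fset| + 1 = #|` A| + #|` B|)%N by nlia.
(* A one-element [S] is excluded by (WP1). *)
have A2 : (1 < #|` A|)%N.
  rewrite ltn_neqAle A1 andbT; apply/eqP => A1E; apply: nweak; apply: Or41.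
  by rewrite /WP1 !ncard_fset -A1E; apply/minn_idPl; rewrite A1E.
have UP x : U x <-> x + a \notin (A `+` B)%fset.
  split=> [[y yTS <-]|xa].
    apply/negP; rewrite subrK => yAB; apply: yTS.
    by rewrite sumset_fset fsumC.
  exists (x + a); last by rewrite addrK.
  by rewrite /TS sumset_fset fsumC; apply/negP.
pose Uf (W : {fset G}) := ([fset - a] `+` (W `\` (A `+` B)))%fset.
have UE (W : {fset G}) : (forall x, x \in W) -> U = [set` Uf W].
  move=> Wf; apply/seteqP; split=> x /=; rewrite mem_fsum1 opprK in_fsetD Wf andbT.
    by move/UP.
  by move=> xa; apply/UP.
have UfC (W : {fset G}) : Uf W = ([fset - a] `+` (W `\` (B `+` A)))%fset.
  by rewrite /Uf [(A `+` B)%fset]fsumC.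
have outBA : exists z, z \notin (B `+` A)%fset by rewrite fsumC.
have apBA : faperiodic (B `+` A)%fset by rewrite fsumC.
have cBA : (#|` (B `+` A)%fset| + 1 = #|` B| + #|` A|)%N.
  by rewrite fsumC cST addnC.
have Uf0 (W : {fset G}) : (forall x, x \in W) -> 0 \in Uf W.
  by move=> Wf; rewrite mem_fsum1 opprK add0r in_fsetD aAB Wf.
have dualA (W : {fset G}) Wf := dual_translate a (W := W) Wf AN0 BN0 outAB apST cST.
have dualB (W : {fset G}) Wf := dual_translate a (W := W) Wf BN0 AN0 outBA apBA cBA.
split.
- move=> _; have [t tP] := quasi_periodic_gen_set A0 A2 BN0 apST cST.
  by apply: (@quasi_periodic_intro _ _ _ t); [exact: gen0|exact: genB|].
- move=> _ gU.
  (* Everything outside the finite set -a + (S + T) lies in [U], hence in the proper subgroup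
     generated by [U]; this forces G to be finite. *)
  have [W Wf] : exists W : {fset G}, forall x, x \in W.
    apply: (@finite_of_cofinite_subgroup _ (gen U) ([fset - a] `+` (A `+` B))%fset) => //.
    + exact: gen0.
    + exact: genB.
    + by move=> x; rewrite mem_fsum1 opprK => xa; apply: gen_sub; apply/UP.
  (* A sum omitting a single point is excluded by (WP3). *)
  have U2 : (1 < #|` Uf W|)%N.
    rewrite ltn_neqAle cardfs_gt0 andbC; apply/andP; split.
      by apply/fset0Pn; exists 0; apply: Uf0.
    rewrite card_fsum1 eq_sym; apply/negP => /cardfs1P[c Wc].
    apply: nweak; apply: Or43; apply: (WP3_of_card1 Wf _ _ _ cST Wc) => //.
    by move=> x /(fsubsetP (fstab_fsuml AN0 BN0)); apply: apST.
  rewrite (UE W Wf); have [ap1 c1 _ _] := dualA W Wf; have [ap2 c2 _ _] := dualB W Wf.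
  rewrite -UfC in ap2 c2; rewrite -/(Uf W) in ap1 c1.
  have NA : fopp A != fset0%fset by rewrite fopp_eq0.
  have NB : fopp B != fset0%fset by rewrite fopp_eq0.
  have [t tP] := quasi_periodic_gen_set (Uf0 W Wf) U2 NA ap1 c1.
  have [r rP] := quasi_periodic_gen_set (Uf0 W Wf) U2 NB ap2 c2.
  by split; [apply: quasi_periodic_fopp tP|apply: quasi_periodic_fopp rP];
    by [exact: gen0|exact: genB].
move=> gS gU.
(* For infinite G the condition is vacuous. Its failure means that G is finite and [U] is smaller
   than [S] and [T]. *)
have [hC|] := pselect (forall W : {fset G}, (forall x, x \in W) ->
    (#|` A| <= #|` (W `\` (A `+` B))%fset|)%N).
  have outA : exists z, z \notin A.
    by exists a; apply: contra aAB; apply: (fsubsetP (fsub_fsum A B0)).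
  have [H hypH] := hyper_atom_exists gS A0 outA; exists H.
  have small (W : {fset G}) : (forall x, x \in W) -> (3 * #|` A| <= #|` W| + 1)%N.
    move=> Wf; have := hC W Wf.
    have sub : (A `+` B `<=` W)%fset by apply/fsubsetP => x _.
    by rewrite cardfsDS //; have := fsubset_leq_card sub; nlia.
  have [K [HK p_ker HT near]] := hyper_atom_near_full hypH small.
  have [nA nB] := near B cST apST outAB leST hC.
  have [qA aA] := near_full_structure HK p_ker AN0 nA.
  have [qB aB] := near_full_structure HK p_ker BN0 nB.
  by split => //; left.
move=> /existsNP[W] /not_implyP[Wf /negP]; rewrite -ltnNge => ltC.
rewrite (UE W Wf) in gU *.
have [ap1 c1 o1 d1] := dualA W Wf; have [ap2 c2 o2 d2] := dualB W Wf.
rewrite -UfC in ap2 c2 o2 d2; rewrite -/(Uf W) in ap1 c1 o1 d1.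
have cU : #|` Uf W| = #|` (W `\` (A `+` B))%fset| by rewrite card_fsum1.
have WE (W' : {fset G}) : (forall x, x \in W') -> W' = W.
  by move=> W'f; apply/fsetP => x; rewrite W'f Wf.
have cW : (#|` W| + 1 = #|` Uf W| + #|` A| + #|` B|)%N.
  have sub : (A `+` B `<=` W)%fset by apply/fsubsetP => x _.
  by rewrite cU cardfsDS //; have := fsubset_leq_card sub; nlia.
have outU : exists z, z \notin Uf W.
  apply: contrapT => nout; have /fsubset_leq_card : (W `<=` Uf W)%fset.
    by apply/fsubsetP => x _; apply/negPn/negP => xU; apply: nout; exists x.
  by nlia.
have [H hypH] := hyper_atom_exists gU (Uf0 W Wf) outU; exists H.
have small (W' : {fset G}) : (forall x, x \in W') -> (3 * #|` Uf W| <= #|` W'| + 1)%N.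
  by move=> /WE ->; nlia.
have [K [HK p_ker HT near]] := hyper_atom_near_full hypH small.
(* One hyper-atom of [U] serves both critical pairs (U, -S) and (U, -T); the complements of their
   sums have |T| and |S| elements, both more than |U|. *)
have [||_ /near_full_fopp nA] := near (fopp A) c1 ap1 o1.
- by rewrite card_fopp; nlia.
- by move=> W' /WE ->; rewrite d1; nlia.
have [||_ /near_full_fopp nB] := near (fopp B) c2 ap2 o2.
- by rewrite card_fopp; nlia.
- by move=> W' /WE ->; rewrite d2; nlia.
have [qA aA] := near_full_structure HK p_ker AN0 nA.
have [qB aB] := near_full_structure HK p_ker BN0 nB.
by split => //; right.
Qed.
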